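(* Let $F$ be an almost balanced complete multipartite graph with at least two parts. Then the inducibility problem for $F$ is perfectly stable: there exists a constant $C>0$ such that for every $n$-vertex graph $G$ with $n\ge C$ there is an $n$-vertex complete multipartite graph $H$ satisfying \[ \mathrm{edit}(G,H)\le C\cdot\frac{I(F,n)-I(F,G)}{\binom{n}{v(F)}}\binom{n}{2}. \]
   Context: For graphs $F,G$, $I(F,G)$ is the number of subsets $S\subseteq V(G)$ with $|S|=v(F)$ such that $G[S]\cong F$, and $I(F,n)=\max\{I(F,G):v(G)=n\}$. For two graphs $G,H$ on the same number of vertices, $\mathrm{edit}(G,H)$ is the minimum number of edges one must add to or remove from $G$ to make it isomorphic to $H$. A complete multipartite graph $K_{a_1,\ldots,a_r}$ with part sizes $a_1\ge\cdots\ge a_r\ge 1$ is almost balanced if it is not a complete graph and $\binom{a_1-a_r}{2}<a_r$. *)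

(* Defs.v *)
From HB Require Import structures.
From mathcomp Require Import all_boot all_order all_fingroup all_algebra.
From mathcomp Require Export reals.
Set Implicit Arguments. Unset Strict Implicit. Unset Printing Implicit Defensive.

Definition graph (n : nat) := {set {set 'I_n}}.

Definition simple_graph n (G : graph n) : bool :=
  [forall e in G, #|e| == 2].

Definition adj n (G : graph n) (u v : 'I_n) : bool :=
  (u != v) && ([set u; v] \in G).

Definition induced_count k n (F : graph k) (G : graph n) : nat :=
  #|[set S : {set 'I_n} | (#|S| == k) &&
      [exists f : {ffun 'I_k -> 'I_n},
         [&& [forall i, f i \in S], injectiveb f &
             [forall i, forall j, adj F i j == adj G (f i) (f j)]]]]|.

Definition inducibility k (F : graph k) (n : nat) : nat :=
  \max_(G : graph n | simple_graph G) induced_count F G.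

Definition relabel n (s : {perm 'I_n}) (H : graph n) : graph n :=
  [set [set s x | x in e] | e : {set 'I_n} in H].

Definition edit n (G H : graph n) : nat :=
  \big[minn/(#|G| + #|H|)]_(s : {perm 'I_n})
     #|(G :\: relabel s H) :|: (relabel s H :\: G)|.

Definition cmp_graph n r (c : 'I_n -> 'I_r) : graph n :=
  [set e : {set 'I_n} | [exists u, exists v,
      (c u != c v) && (e == [set u; v])]].

Definition complete_multipartite n (H : graph n) : Prop :=
  exists c : 'I_n -> 'I_n, H = cmp_graph c.

Definition part_size k r (c : 'I_k -> 'I_r) (i : 'I_r) : nat :=
  #|[set x | c x == i]|.

(* K_{a_1,...,a_r} (parts = fibres of a surjective c) is almost balanced:
   it is not complete (a_1 >= 2) and binom(a_1 - a_r, 2) < a_r, where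
   a_1 is the largest and a_r the smallest part size. *)
Definition almost_balanced k r (c : 'I_k -> 'I_r) : Prop :=
  exists i1 ir : 'I_r,
    (forall j, part_size c j <= part_size c i1) /\
    (forall j, part_size c ir <= part_size c j) /\
    2 <= part_size c i1 /\
    'C(part_size c i1 - part_size c ir, 2) < part_size c ir.

(* Main.v *)
Require Import Defs.
From mathcomp Require Import all_boot all_order all_fingroup all_algebra.
From mathcomp Require Import reals.
From mathcomp Require Import zify ring lra.
Import Order.TTheory GRing.Theory Num.Theory.
Set Implicit Arguments. Unset Strict Implicit. Unset Printing Implicit Defensive.

(** Let N(G) be the number of embeddings of F in G and M an upper bound for N.
For an independent set A, let G_v arise from G by turning all vertices of A into
clones of v in A. Then the sum of N(G_v) over v in A is at least |A| N(G) plus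
the number of pairs of a copy of F in G with at least two vertices in A and a
vertex of A whose neighbourhood is wrong for this copy. This comes from
a^2 b^_j <= b^2 a^_j for 2 <= j and b <= a.

Locally: suppose that G is close to a complete multipartite graph H whose
optimal structure is rigid (a universal vertex, or an edge inside a part, costs
a positive proportion of the copies through it). Perturb G to a maximiser of
N minus a small multiple of the distance to G, so that no vertex and no pair
can be changed with a large gain. Symmetrization then shows that every vertex
sees the parts as a vertex of one of them does; rigidity removes the edges
inside the parts, and symmetrization of whole parts charges M - N(G) for every
missing pair.

Globally: Zykov's symmetrization leads from G to a complete multipartite graph
by changing one vertex at a time without decreasing N. Being close to a good
multipartite graph propagates backwards along this path by the local statement,
so it suffices to study complete multipartite graphs. If all parts of F have at
least two vertices, a vertex in a small part lies in few copies, so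
near-optimal graphs have only large parts. Otherwise all parts of F have one or two
vertices; then near-optimal graphs are nearly balanced, and comparing q parts
with q + 1 and q - 1 parts gives two inequalities on q from which rigidity
follows. *)

(** * Symmetrization *)

(** The optimal number of parts is not computed, so rigidity cannot be read off from the extremal
    graph and has to follow from near-optimality alone. The bound is linear in the defect, so
    comparisons must be made at the scale of the change: [n ^+ k.-1] copies for a vertex,
    [n ^+ k.-2] for a pair. A direct comparison of [G] with its model only gives an error of order
    [n ^+ k]; therefore the effect of a local change in [G] is compared with the effect of the same
    change in the model, and only functions through the changed vertex or pair count. Zykov steps do
    not control the distance to the initial graph. Going backwards, a step costs at most [2 * n]
    pairs, far less than [n ^+ 2], and the local statement restores the smaller radius. The
    recovered partition need not be good any more; it is replaced by a good one before the next
    step, so that the constants do not deteriorate along the path. The two cases come from almost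
    balancedness: if [a_r = 1], then binom(a_1 - 1, 2) < 1, which means [a_1 <= 2]. *)

Definition ffset (I C V : finType) (c : I -> C) (z : {ffun I -> V})
    (Y : C -> {set V}) (D : {set I}) : {set {ffun I -> V}} :=
  [set f : {ffun I -> V} | [&& [forall i, (i \notin D) ==> (f i == z i)],
     [forall i, (i \in D) ==> (f i \in Y (c i))] &
     [forall i, forall j, [&& i \in D, j \in D & f i == f j] ==> (i == j)]]].

Lemma ffsetP (I C V : finType) (c : I -> C) (z : {ffun I -> V})
    (Y : C -> {set V}) (D : {set I}) (f : {ffun I -> V}) :
  reflect [/\ forall i, i \notin D -> f i = z i,
              forall i, i \in D -> f i \in Y (c i) &
              {in D &, injective f}]
          (f \in ffset c z Y D).
Proof.
rewrite inE; apply: (iffP and3P) => [[/forallP h1 /forallP h2 /forallP h3]|[h1 h2 h3]].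
  split=> [i iD|i iD|i j iD jD fij].
  - by apply/eqP; move: (h1 i); rewrite iD.
  - by move: (h2 i); rewrite iD.
  - by apply/eqP; move: (h3 i) => /forallP/(_ j); rewrite iD jD fij eqxx.
split; apply/forallP => i.
- by apply/implyP => /h1 ->.
- by apply/implyP => /h2.
- by apply/forallP => j; apply/implyP => /and3P[iD jD /eqP /h3 ->].
Qed.

(** Remove one index [i0] from [D]: its value ranges over [Y (c i0)] minus the values already taken
    by indices of the same colour. Disjointness of the sets [Y a] keeps the other colours from
    interfering. *)
Lemma card_ffset (I C V : finType) (c : I -> C) (z : {ffun I -> V})
    (Y : C -> {set V}) (D : {set I}) :
  (forall a b, a != b -> [disjoint Y a & Y b]) ->
  #|ffset c z Y D| = \prod_a #|Y a| ^_ #|[set i in D | c i == a]|.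
Proof.
move=> Ydisj; elim: {D}#|D| {-2}D (erefl #|D|) => [|m IH] D cD.
  have -> : D = set0 by apply/eqP; rewrite -cards_eq0 cD.
  rewrite big1 => [|a _]; last first.
    by rewrite (_ : [set i in set0 | _] = set0) ?cards0 ?ffactn0 //; apply/setP => i; rewrite !inE.
  rewrite (_ : ffset _ _ _ _ = [set z]) ?cards1 //; apply/setP => f; rewrite in_set1.
  apply/ffsetP/eqP => [[h _ _]|->]; first by apply/ffunP => i; rewrite h ?inE.
  by split => // i; rewrite inE.
have [i0 i0D] : exists i0, i0 \in D by apply/set0Pn; rewrite -card_gt0 cD.
pose D' := D :\ i0.
have cD' : #|D'| = m by apply/eqP; rewrite -eqSS -cD (cardsD1 i0 D) i0D.
have inD' i : (i \in D) = (i == i0) || (i \in D').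
  by rewrite !inE; case: eqP => [->|].
have i0D' : i0 \notin D' by rewrite !inE eqxx.
pose h (f : {ffun I -> V}) : {ffun I -> V} := [ffun i => if i == i0 then z i0 else f i].
pose ext (g : {ffun I -> V}) y : {ffun I -> V} := [ffun i => if i == i0 then y else g i].
have hS f : f \in ffset c z Y D -> h f \in ffset c z Y D'.
  move=> /ffsetP[h1 h2 h3]; apply/ffsetP; split => [i iD|i iD|i j iD jD].
  - rewrite ffunE; case: eqP => [->//|/eqP ne]; apply: h1; rewrite inD' (negPf ne) /=; exact: iD.
  - have ne : i != i0 by apply: contraNneq i0D' => <-.
    by rewrite ffunE (negPf ne) h2 // inD' iD orbT.
  - have ne : i != i0 by apply: contraNneq i0D' => <-.
    have ne' : j != i0 by apply: contraNneq i0D' => <-.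
    by rewrite !ffunE (negPf ne) (negPf ne'); apply: h3; rewrite inD' ?iD ?jD orbT.
have fib g : g \in ffset c z Y D' ->
    #|[set f in ffset c z Y D | h f == g]| =
    #|Y (c i0)| - #|[set i in D' | c i == c i0]|.
  move=> /ffsetP[g1 g2 g3].
  have -> : [set f in ffset c z Y D | h f == g] = ext g @: (Y (c i0) :\: g @: D').
    apply/setP => f; apply/idP/imsetP => [|[y]].
      rewrite inE => /andP[/ffsetP[h1 h2 h3] /eqP hfg]; exists (f i0); last first.
        by apply/ffunP => i; rewrite !ffunE -hfg ffunE; case: eqP => [->|].
      rewrite inE h2 // andbT; apply/imsetP => -[i iD' e].
      have ne : i != i0 by apply: contraNneq i0D' => <-.
      move: e; rewrite -hfg ffunE (negPf ne) => /h3 e.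
      by move: ne; rewrite e ?eqxx // inD' iD' orbT.
    move=> /setDP[yY /imsetP yg] ->; rewrite inE; apply/andP; split; last first.
      apply/eqP/ffunP => i; rewrite !ffunE; case: eqP => [->|//]; by rewrite g1.
    apply/ffsetP; split => [i iD|i|i j].
    - have ne : i != i0 by apply: contraNneq iD => ->.
      by rewrite ffunE (negPf ne) g1 // -[_ \in D']orFb -(negPf ne) -inD'.
    - by rewrite inD' ffunE; case: eqP => [-> //|_ /= /g2].
    - rewrite !inD' !ffunE; case: eqP => [->|_]; case: eqP => [->|_] //=.
      + by move=> _ jD e; case: yg; exists j.
      + by move=> iD _ e; case: yg; exists i.
      + exact: g3.
  rewrite card_imset; last first.
    by move=> y y' /ffunP/(_ i0); rewrite !ffunE eqxx.
  rewrite cardsD; congr (_ - _).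
  rewrite -(card_in_imset (f := g) (D := [set i in D' | c i == c i0])); last first.
    by move=> i j; rewrite !inE => /andP[iD _] /andP[jD _]; apply: g3; rewrite !inE.
  apply: eq_card => y; rewrite inE; apply/andP/imsetP => [[yY /imsetP[i iD e]]|[i iS ->]].
    exists i => //; rewrite inE iD /=; apply: contraT => ne.
    have := disjointFr (Ydisj _ _ ne) (g2 _ iD); by rewrite -e yY.
  move: iS; rewrite inE => /andP[iD /eqP ci]; split; last exact: imset_f.
  by have := g2 i iD; rewrite ci.
rewrite -sum1_card (partition_big h (mem (ffset c z Y D'))) /=; last by move=> f /hS.
rewrite (eq_bigr (fun=> #|Y (c i0)| - #|[set i in D' | c i == c i0]|)); last first.
  move=> g gS; rewrite -(fib g gS) -sum1_card; apply: eq_bigl => f; by rewrite inE.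
rewrite sum_nat_const IH // (bigD1 (c i0)) //= [RHS](bigD1 (c i0)) //=.
have -> : #|[set i in D | c i == c i0]| = #|[set i in D' | c i == c i0]|.+1.
  rewrite (cardsD1 i0) inE i0D eqxx; congr (_.+1); apply: eq_card => i.
  by rewrite !inE andbA.
rewrite ffactnSr -!mulnA; congr (_ * _); rewrite mulnC; congr (_ * _).
apply: eq_bigr => a ne; congr (_ ^_ _); apply: eq_card => i; rewrite inE [RHS]inE inD'.
case: (eqVneq i i0) => //= ei; rewrite ei (negPf i0D') /=.
by rewrite eq_sym (negPf ne).
Qed.

(** Used for one key below: [a] is the size of [A], [b] the number of compatible vertices,
    [x = b ^_ j] and [y = a ^_ j]. Since [b * (2 * a - b) <= a ^ 2], there is a surplus of [x] for
    each of the [a - b] incompatible vertices. *)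
Lemma gain_arith a b x y :
  b <= a -> a * a * x <= b * b * y -> 0 < b -> a * x + x * (a - b) <= b * y.
Proof.
move=> ba h b0; rewrite -(leq_pmul2l b0).
have e : b * (a * x + x * (a - b)) <= a * a * x.
  by have [d ->] : exists d, a = b + d; [exists (a - b); lia | rewrite addKn; nia].
by apply: leq_trans e _; rewrite mulnA.
Qed.

(** The surplus is now measured by [b * y], the number of copies in the clones, because [b * b * y =
    a * (b * y) - b * y * (a - b)]. *)
Lemma gain_arith_clones a b x y :
  b <= a -> a * a * x <= b * b * y -> a * a * x + b * y * (a - b) <= a * (b * y).
Proof.
move=> ba h; have [d da] : exists d, a = b + d by exists (a - b); lia.
by subst a; rewrite addKn; nia.
Qed.

(* The strict gain of symmetrization comes from this inequality. *)
Lemma ffact_ratio a b j : b <= a -> 2 <= j -> a ^ 2 * b ^_ j <= b ^ 2 * a ^_ j.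
Proof.
move=> ba; elim: j => // -[//|j] IH _.
case: j IH => [_|j IH].
  rewrite !ffactnS !ffactn0 !muln1 !expnS !expn0 !muln1.
  case: b ba => [|b] ba; first by rewrite !mul0n !muln0.
  case: a ba => [//|a] ba /=.
  rewrite [leqLHS](_ : _ = a.+1 * b.+1 * (a.+1 * b)); last by lia.
  rewrite [leqRHS](_ : _ = a.+1 * b.+1 * (b.+1 * a)); last by lia.
  by rewrite leq_mul2l; apply/orP; right; nia.
rewrite (ffactnSr a) (ffactnSr b) 2!mulnA; apply: leq_mul; first exact: (IH isT).
exact: leq_sub2r.
Qed.

Section Copies.
Variables (k r : nat) (c : 'I_k -> 'I_r) (V : finType).
Implicit Types (G H : {set V * V}) (f z : {ffun 'I_k -> V}) (A : {set V}).

(* Graphs on V are symmetric irreflexive sets of ordered pairs. *)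
Definition sgraph G := [forall x, (x, x) \notin G] &&
  [forall x, forall y, ((x, y) \in G) == ((y, x) \in G)].

(** [F] enters only through its colouring [c]. Embeddings are labelled; [copies_induced] accounts
    for the automorphisms of [F]. *)
Definition copy G f :=
  injectiveb f && [forall i, forall j, ((f i, f j) \in G) == (c i != c j)].

Definition copies G : nat := #|[set f | copy G f]|.

Definition clone G A v : {set V * V} :=
  [set p | if p.1 \in A then (p.2 \notin A) && ((v, p.2) \in G)
           else if p.2 \in A then (p.1, v) \in G else p \in G].

(** [v] could take over the role of the vertices of [f] in [A]: it is joined correctly to all
    vertices of [f] outside [A]. *)
Definition compat G A f v := [forall i, forall j,
  (f i \in A) ==> (f j \notin A) ==> (((v, f j) \in G) == (c i != c j))].

Definition inpart A f := [set i | f i \in A].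

Lemma sgraphP G : reflect ((forall x, (x, x) \in G = false) /\
  (forall x y, ((x, y) \in G) = ((y, x) \in G))) (sgraph G).
Proof.
apply: (iffP andP) => -[h1 h2]; split.
- by move=> x; apply/negbTE; move/forallP: h1.
- by move=> x y; apply/eqP; move/forallP: h2 => /(_ x) /forallP.
- by apply/forallP => x; rewrite h1.
- by apply/forallP => x; apply/forallP => y; rewrite h2.
Qed.

Lemma copyP G f : reflect (injective f /\
  (forall i j, ((f i, f j) \in G) = (c i != c j))) (copy G f).
Proof.
apply: (iffP andP) => -[h1 h2]; split.
- exact/injectiveP.
- by move=> i j; apply/eqP; move/forallP: h2 => /(_ i) /forallP.
- exact/injectiveP.
- by apply/forallP => i; apply/forallP => j; rewrite h2.
Qed.

Lemma compatP G A f v : reflect (forall i j, f i \in A -> f j \notin A ->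
  ((v, f j) \in G) = (c i != c j)) (compat G A f v).
Proof.
apply: (iffP idP) => [h i j iA jA|h].
  by apply/eqP; move/forallP: h => /(_ i) /forallP/(_ j); rewrite iA jA.
apply/forallP => i; apply/forallP => j; apply/implyP => iA; apply/implyP => jA.
by rewrite (h i j).
Qed.

Section Symmetrize.
Variables (G : {set V * V}) (A : {set V}) (v0 : V).
Hypotheses (Gs : sgraph G) (Aindep : {in A &, forall x y, (x, y) \in G = false})
  (v0A : v0 \in A).

(** Since [A] is independent, a copy meets it in vertices of a single colour. The key forgets which
    vertices of [A] a copy uses and keeps the rest. With [j = #|inpart A z|], a good key [z] has
    [#|B z| ^_ j] copies over it in [G], and [a ^_ j] copies in the clone at [v] if [v] lies in
    [B z], none otherwise. *)
Let key f : {ffun 'I_k -> V} := [ffun i => if f i \in A then v0 else f i].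
Let B z := [set v in A | compat G A z v].
Let a := #|A|.
Let good z := [&& key z == z,
  [forall i, forall j, (z i \in A) && (z j \in A) ==> (c i == c j)] &
  [forall i, forall j, (z i \notin A) && (z j \notin A) ==>
     (((z i, z j) \in G) == (c i != c j)) && ((z i == z j) ==> (i == j))]].

Let goodP z : reflect [/\ key z = z,
   forall i j, z i \in A -> z j \in A -> c i = c j,
   forall i j, z i \notin A -> z j \notin A -> ((z i, z j) \in G) = (c i != c j) &
   forall i j, z i \notin A -> z j \notin A -> z i = z j -> i = j] (good z).
Proof.
apply: (iffP and3P) => [[/eqP h1 h2 h3]|[h1 h2 h3 h4]].
  split=> // i j iA jA.
  - by apply/eqP; move/forallP: h2 => /(_ i) /forallP/(_ j); rewrite iA jA.
  - by apply/eqP; move/forallP: h3 => /(_ i) /forallP/(_ j); rewrite iA jA => /andP[].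
  - move=> e; apply/eqP.
    by move/forallP: h3 => /(_ i) /forallP/(_ j); rewrite iA jA e eqxx => /andP[].
split; first exact/eqP.
- by do 2![apply/forallP => ?]; apply/implyP => /andP[iA jA]; apply/eqP/h2.
- do 2![apply/forallP => ?]; apply/implyP => /andP[iA jA]; rewrite h3 // eqxx /=.
  by apply/implyP => /eqP/h4 ->.
Qed.

Let keyA f i : (key f i \in A) = (f i \in A).
Proof. by rewrite ffunE; case: ifP => // ->. Qed.

Let keyN f i : f i \notin A -> key f i = f i.
Proof. by rewrite ffunE => /negbTE ->. Qed.

Let key_idem f : key (key f) = key f.
Proof. by apply/ffunP => i; rewrite ffunE keyA [RHS]ffunE; case: ifP => // h; rewrite ffunE h. Qed.

Let compat_key f v : compat G A (key f) v = compat G A f v.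
Proof.
apply/compatP/compatP => h i j iA jA.
  by rewrite -(h i j) ?keyA // keyN.
by rewrite !keyA in iA jA; rewrite keyN // (h i).
Qed.

Let inpart_key f : inpart A (key f) = inpart A f.
Proof. by apply/setP => i; rewrite !inE keyA. Qed.

Let fiber z (S : {set V}) : key z = z -> S \subset A ->
  #|ffset (fun=> tt) z (fun=> S) (inpart A z)| = #|S| ^_ #|inpart A z|.
Proof.
move=> _ _; rewrite card_ffset; last by case=> -[].
rewrite (big_pred1 tt) => [|[] //]; congr (_ ^_ _); apply: eq_card => i.
by rewrite inE andbT.
Qed.

Let fiberP z (S : {set V}) f : key z = z -> S \subset A ->
  f \in ffset (fun=> tt) z (fun=> S) (inpart A z) <->
  [/\ key f = z, forall i, f i \in A -> f i \in S &
      forall i j, f i \in A -> f j \in A -> f i = f j -> i = j].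
Proof.
move=> kz SA; split=> [/ffsetP[h1 h2 h3]|[kf h2 h3]].
  have fA i : (f i \in A) = (i \in inpart A z).
    apply/idP/idP => [fi|/h2/(subsetP SA)//]; apply: contraLR fi => iz.
    by move: (iz); rewrite inE h1.
  split=> [|i|i j]; rewrite ?fA; [|exact: h2|exact: h3].
  apply/ffunP => i; rewrite ffunE fA -{2}kz ffunE inE; case: ifP => // iz.
  by rewrite h1 // inE iz.
have fA i : (i \in inpart A z) = (f i \in A) by rewrite inE -kf keyA.
apply/ffsetP; split=> [i|i|i j]; rewrite ?fA; [|exact: h2|exact: h3].
by move=> iA; rewrite -kf keyN.
Qed.

Let copy_fiber z f : good z -> key f = z ->
  copy G f = (f \in ffset (fun=> tt) z (fun=> B z) (inpart A z)).
Proof.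
move=> /goodP[kz z1 z2 z3] kf.
have BA : B z \subset A by apply/subsetP => x; rewrite inE => /andP[].
have fA i : (z i \in A) = (f i \in A) by rewrite -kf keyA.
have fN i : f i \notin A -> z i = f i by rewrite -kf; exact: keyN.
have /sgraphP[G1 G2] := Gs.
apply/copyP/idP => [[fi fG]|/(fiberP _ kz BA)[_ h2 h3]].
  apply/fiberP => //; split=> // [i iA|i j _ _ /fi //].
  rewrite inE iA; apply/compatP => i' j; rewrite !fA => i'A jA.
  by rewrite (fN j) // fG (z1 i i') // fA.
have key2 i j : f i \in A -> f j \notin A -> ((f i, f j) \in G) = (c i != c j).
  move=> iA jA; have := h2 _ iA; rewrite inE => /andP[_ /compatP h].
  by rewrite -(h i j) ?fA // fN.
split=> [i j|i j].
  case: (boolP (f i \in A)) => iA; case: (boolP (f j \in A)) => jA e.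
  - exact: h3.
  - by rewrite -e iA in jA.
  - by rewrite e jA in iA.
  - by apply: z3; rewrite ?fA // (fN i) // (fN j).
case: (boolP (f i \in A)) => iA; case: (boolP (f j \in A)) => jA.
- by rewrite Aindep // (z1 i j) ?fA // eqxx.
- exact: key2.
- by rewrite G2 key2 // eq_sym.
- by rewrite -(fN i) // -(fN j) // z2 ?fA.
Qed.

Let copy_clone_fiber v z f : v \in A -> good z -> key f = z ->
  copy (clone G A v) f = (v \in B z) && (f \in ffset (fun=> tt) z (fun=> A) (inpart A z)).
Proof.
move=> vA /goodP[kz z1 z2 z3] kf.
have fA i : (z i \in A) = (f i \in A) by rewrite -kf keyA.
have fN i : f i \notin A -> z i = f i by rewrite -kf; exact: keyN.
have /sgraphP[G1 G2] := Gs.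
apply/copyP/andP => [[fi fG]|[]].
  split; last by apply/fiberP => //; split=> // i j _ _ /fi.
  rewrite inE vA; apply/compatP => i j; rewrite !fA => iA jA.
  by have := fG i j; rewrite inE /= iA jA /= fN.
rewrite inE vA => /compatP h /(fiberP _ kz (subxx A))[_ _ h3].
split=> [i j|i j].
  case: (boolP (f i \in A)) => iA; case: (boolP (f j \in A)) => jA e.
  - exact: h3.
  - by rewrite -e iA in jA.
  - by rewrite e jA in iA.
  - by apply: z3; rewrite ?fA // (fN i) // (fN j).
rewrite inE /=.
case: (boolP (f i \in A)) => iA; case: (boolP (f j \in A)) => jA /=.
- by rewrite (z1 i j) ?fA // eqxx.
- by rewrite -(h i j) ?fA // fN.
- by rewrite G2 eq_sym -(h j i) ?fA // fN.
- by rewrite -(fN i) // -(fN j) // z2 ?fA.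
Qed.

Let copy_good f : copy G f -> good (key f).
Proof.
move=> /copyP[fi fG]; apply/goodP; split=> [|i j|i j|i j]; rewrite ?key_idem ?keyA //.
- by move=> iA jA; apply/eqP; rewrite -[_ == _]negbK -fG Aindep.
- by move=> iA jA; rewrite !keyN.
- by move=> iA jA; rewrite !keyN // => /fi.
Qed.

Let copy_clone_good v f : copy (clone G A v) f -> good (key f).
Proof.
move=> /copyP[fi fG]; apply/goodP; split=> [|i j|i j|i j]; rewrite ?key_idem ?keyA //.
- by move=> iA jA; apply/eqP; rewrite -[_ == _]negbK -fG inE /= iA jA.
- by move=> iA jA; rewrite !keyN // -fG inE /= (negbTE iA) (negbTE jA).
- by move=> iA jA; rewrite !keyN // => /fi.
Qed.

Let BA z : B z \subset A. Proof. by apply/subsetP => x; rewrite inE => /andP[]. Qed.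

Let B_full z : inpart A z = set0 -> B z = A.
Proof.
move=> z0; apply/setP => v; rewrite inE andb_idr // => _; apply/compatP => i j iA.
have : i \in inpart A z by rewrite inE.
by rewrite z0 inE.
Qed.

Let sum_key (Q : pred {ffun 'I_k -> V}) (F : {ffun 'I_k -> V} -> nat) :
  (forall f, Q f -> good (key f)) ->
  (forall f, Q f -> F (key f) = F f) ->
  \sum_(f | Q f) F f = \sum_(z | good z) #|[set f | Q f && (key f == z)]| * F z.
Proof.
move=> Qg QF; rewrite (partition_big key good) //=; apply: eq_bigr => z _.
rewrite -sum_nat_const; apply: eq_big => [f|f /andP[Qf /eqP <-]]; first by rewrite inE.
by rewrite QF.
Qed.

Let card_fib z : good z -> #|[set f | copy G f && (key f == z)]| = #|B z| ^_ #|inpart A z|.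
Proof.
move=> gz; have /goodP[kz _ _ _] := gz; rewrite -(fiber kz (BA z)); apply: eq_card => f.
rewrite inE; apply/andP/idP => [[fG /eqP kf]|h]; first by rewrite -(copy_fiber gz kf).
have [kf _ _] := (fiberP f kz (BA z)).1 h.
by rewrite kf eqxx (copy_fiber gz kf).
Qed.

Let card_clone_fib v z : v \in A -> good z ->
  #|[set f | copy (clone G A v) f && (key f == z)]| = (v \in B z) * a ^_ #|inpart A z|.
Proof.
move=> vA gz; have /goodP[kz _ _ _] := gz.
case: (boolP (v \in B z)) => vB; last first.
  rewrite mul0n; apply: eq_card0 => f; rewrite inE; apply/negbTE/negP => /andP[fG /eqP kf].
  by move: fG; rewrite (copy_clone_fiber vA gz kf) (negbTE vB).
rewrite mul1n -(fiber kz (subxx A)); apply: eq_card => f.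
rewrite inE; apply/andP/idP => [[fG /eqP kf]|h].
  by move: fG; rewrite (copy_clone_fiber vA gz kf) => /andP[].
have [kf _ _] := (fiberP f kz (subxx A)).1 h.
by rewrite kf eqxx (copy_clone_fiber vA gz kf) vB.
Qed.

Let copiesE : copies G = \sum_(z | good z) #|B z| ^_ #|inpart A z|.
Proof.
rewrite /copies -sum1_card (eq_bigl (copy G)); last by move=> f; rewrite inE.
rewrite (sum_key copy_good) //; apply: eq_bigr => z gz; by rewrite muln1 card_fib.
Qed.

Let copies_cloneE : \sum_(v in A) copies (clone G A v) =
  \sum_(z | good z) #|B z| * a ^_ #|inpart A z|.
Proof.
transitivity (\sum_(v in A) \sum_(z | good z) (v \in B z) * a ^_ #|inpart A z|).
  apply: eq_bigr => v vA.
  rewrite /copies -sum1_card (eq_bigl (copy (clone G A v))); last by move=> f; rewrite inE.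
  rewrite (sum_key (@copy_clone_good v)) //; apply: eq_bigr => z gz.
  by rewrite muln1 card_clone_fib.
rewrite exchange_big /=; apply: eq_bigr => z gz; rewrite -big_distrl /=; congr (_ * _).
rewrite -sum1_card big_mkcond /= [RHS]big_mkcond /=; apply: eq_bigr => v _.
by rewrite inE; case: (v \in A); case: (compat _ _ _ _).
Qed.

Let cardB z : #|B z| <= a. Proof. exact: subset_leq_card. Qed.

Let BF z : #|[set u in A | ~~ compat G A z u]| = a - #|B z|.
Proof.
rewrite -cardsDS //; apply: eq_card => u; rewrite !inE.
by case: (u \in A) => //=; rewrite ?andbT ?andbF.
Qed.

(** Key by key this is [a * b ^_ j + b ^_ j * (a - b) <= b * a ^_ j] for [2 <= j], by [ffact_ratio].
    For [j = 1] both sides of the comparison without surplus agree, and for [j = 0] every vertex of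
    [A] is compatible. *)
Lemma symmetrize_gain :
  a * copies G + \sum_(f | copy G f && (2 <= #|inpart A f|))
     #|[set u in A | ~~ compat G A f u]|
  <= \sum_(v in A) copies (clone G A v).
Proof.
rewrite copies_cloneE copiesE.
have -> : \sum_(f | copy G f && (2 <= #|inpart A f|)) #|[set u in A | ~~ compat G A f u]| =
   \sum_(z | good z) #|B z| ^_ #|inpart A z| * ((2 <= #|inpart A z|) * (a - #|B z|)).
  rewrite big_mkcondr /= (eq_bigr (fun f => (2 <= #|inpart A f|) * (a - #|B f|))); last first.
    by move=> f _; rewrite BF; case: (2 <= _); rewrite ?mul1n.
  rewrite (sum_key copy_good); last first.
    move=> f _; rewrite inpart_key -!BF; congr (_ * _); apply: eq_card => u.
    by rewrite !inE compat_key.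
  by apply: eq_bigr => z gz; rewrite card_fib.
rewrite big_distrr -big_split /=; apply: leq_sum => z gz.
have ba := cardB z; have [j2|j2] := leqP 2 #|inpart A z|.
  have := ffact_ratio ba j2; rewrite mul1n !expnS !expn0 !muln1.
  have [b0 _|b0] := posnP #|B z|; last by move=> h; exact: gain_arith.
  by move: j2; rewrite b0; case: #|inpart A z| => // j _; rewrite ffact0n !mul0n muln0.
rewrite mul0n muln0 addn0.
move: j2; case: (posnP #|inpart A z|) => [/eqP|j0 j1].
  by rewrite cards_eq0 => /eqP z0 _; rewrite z0 cards0 !ffactn0 B_full.
have -> : #|inpart A z| = 1 by apply/eqP; rewrite eqn_leq j0 -ltnS j1.
by rewrite !ffactn1 mulnC.
Qed.

(** Here the surplus is charged to copies in the cloned graphs. It is used when [G] itself is not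
    known to have many copies with two vertices in [A], while the clone at one particular vertex
    has. *)
Lemma symmetrize_gain_clones :
  a ^ 2 * copies G + \sum_(v in A) \sum_(f | copy (clone G A v) f && (2 <= #|inpart A f|))
     #|[set u in A | ~~ compat G A f u]|
  <= a * \sum_(v in A) copies (clone G A v).
Proof.
rewrite copies_cloneE copiesE.
have -> : \sum_(v in A) \sum_(f | copy (clone G A v) f && (2 <= #|inpart A f|))
     #|[set u in A | ~~ compat G A f u]| =
   \sum_(z | good z) #|B z| * a ^_ #|inpart A z| * ((2 <= #|inpart A z|) * (a - #|B z|)).
  transitivity (\sum_(v in A) \sum_(z | good z) (v \in B z) * a ^_ #|inpart A z| *
     ((2 <= #|inpart A z|) * (a - #|B z|))).
    apply: eq_bigr => v vA.
    rewrite big_mkcondr /= (eq_bigr (fun f => (2 <= #|inpart A f|) * (a - #|B f|))); last first.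
      by move=> f _; rewrite BF; case: (2 <= _); rewrite ?mul1n.
    rewrite (sum_key (@copy_clone_good v)); last first.
      move=> f _; rewrite inpart_key -!BF; congr (_ * _); apply: eq_card => u.
      by rewrite !inE compat_key.
    by apply: eq_bigr => z gz; rewrite card_clone_fib.
  rewrite exchange_big /=; apply: eq_bigr => z gz; rewrite -2!big_distrl /=.
  congr (_ * _ * _); rewrite -sum1_card big_mkcond /= [RHS]big_mkcond /=.
  by apply: eq_bigr => v _; rewrite inE; case: (v \in A); case: (compat _ _ _ _).
rewrite !big_distrr -big_split /=; apply: leq_sum => z gz.
have ba := cardB z; have [j2|j2] := leqP 2 #|inpart A z|.
  have := ffact_ratio ba j2; rewrite mul1n !expnS !expn0 !muln1; by move=> h; exact: gain_arith_clones.
rewrite mul0n muln0 addn0.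
move: j2; case: (posnP #|inpart A z|) => [/eqP|j0 j1].
  by rewrite cards_eq0 => /eqP z0 _; rewrite z0 cards0 !ffactn0 B_full // -mulnA.
have -> : #|inpart A z| = 1 by apply/eqP; rewrite eqn_leq j0 -ltnS j1.
rewrite !ffactn1 -mulnn -mulnA leq_mul2l [#|B z| * _]mulnC leqnn orbT //.
Qed.
End Symmetrize.
End Copies.

Lemma card_exists_le (T U : finType) (A : {set T}) (S : {set U}) (B : U -> {set T}) :
  (forall x, x \in A -> exists2 u, u \in S & x \in B u) ->
  #|A| <= \sum_(u in S) #|B u|.
Proof.
move=> h; rewrite -sum1_card (eq_bigr (fun u => \sum_(x | x \in B u) 1)); last first.
  by move=> u _; rewrite sum1_card.
rewrite (exchange_big_dep predT) //= big_mkcond /=; apply: leq_sum => x _.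
by case: ifP => // /h[u uS xu]; rewrite (bigD1 u) ?uS.
Qed.

(** * Counting copies *)

Section Boxes.
Variables (I V : finType).
Implicit Types (f z : {ffun I -> V}) (W : {set V * V}) (Y : I -> {set V}) (Z : {set I}).

Lemma card_box Y : #|[set f : {ffun I -> V} | [forall i, f i \in Y i]]| = \prod_i #|Y i|.
Proof.
rewrite (eq_card (B := mem (family (fun i => mem (Y i))))) => [|f]; last first.
  by rewrite inE; apply/forallP/familyP.
by rewrite card_family foldrE big_map big_enum.
Qed.

Lemma card_box_pair Y W i j : i != j ->
  #|[set f : {ffun I -> V} | [forall l, f l \in Y l] && ((f i, f j) \in W)]|
  <= #|[set p in W | (p.1 \in Y i) && (p.2 \in Y j)]| *
     \prod_(l | (l != i) && (l != j)) #|Y l|.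
Proof.
move=> ij; rewrite -sum1_card.
rewrite (partition_big (fun f : {ffun I -> V} => (f i, f j))
   (mem [set p in W | (p.1 \in Y i) && (p.2 \in Y j)])) /=; last first.
  by move=> f; rewrite !inE => /andP[/forallP h ->]; rewrite !h.
rewrite -sum_nat_const; apply: leq_sum => -[x y] _.
rewrite sum1_card.
pose Y' l := if l == i then [set x] else if l == j then [set y] else Y l.
apply: (@leq_trans #|[set f : {ffun I -> V} | [forall l, f l \in Y' l]]|).
  apply: subset_leq_card; apply/subsetP => f.
  rewrite unfold_in !inE -andbA => /and3P[/forallP h _ /eqP[fx fy]].
  apply/forallP => l.
  rewrite /Y'; case: (eqVneq l i) => [->|li]; first by rewrite inE fx.
  by case: (eqVneq l j) => [->|lj]; rewrite ?inE ?fy.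
rewrite card_box (bigD1 i) //= (bigD1 j) /=; last by rewrite eq_sym.
rewrite /Y' eqxx eq_sym (negPf ij) eqxx !cards1 !mul1n.
by apply: eq_leq; apply: eq_bigr => l /andP[/negPf -> /negPf ->].
Qed.

Definition pinned Z z f := [forall i, (i \in Z) ==> (f i == z i)].

Lemma pinnedP Z z f : reflect (forall i, i \in Z -> f i = z i) (pinned Z z f).
Proof.
apply: (iffP forallP) => h i; first by move=> iZ; apply/eqP; move: (h i); rewrite iZ.
by apply/implyP => /h ->.
Qed.

(** Pairs of two pinned indices are excluded: their images are prescribed, so no count makes them
    rare. *)
Definition bad_pair Z W f :=
  [exists i, exists j, [&& i != j, (i \notin Z) || (j \notin Z) & (f i, f j) \in W]].

Lemma bad_pairPn Z W f i j : ~~ bad_pair Z W f -> i != j ->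
  (i \notin Z) || (j \notin Z) -> (f i, f j) \notin W.
Proof.
move=> /existsPn/(_ i)/existsPn/(_ j) h ij ijZ; move: h; by rewrite ij ijZ.
Qed.

Let PY Z z l : {set V} := if l \in Z then [set z l] else setT.

Let pinned_box Z z f : pinned Z z f = [forall l, f l \in PY Z z l].
Proof.
apply/pinnedP/forallP => [h l|h l lZ]; rewrite /PY.
  by case: ifP => [/h ->|_]; rewrite inE.
by have := h l; rewrite /PY lZ inE => /eqP.
Qed.

Variable R : realFieldType.
Local Open Scope ring_scope.
Local Notation n := (#|V|%:R : R).

(** For two free indices the size of [W] gains the factor [e]; if one of them is pinned, the degree
    of its image in [W] does. The exponent of [n] is the number of free indices in each case. *)
Lemma card_bad_pair1 Z z W (e : R) i j : 0 <= e -> #|W|%:R <= e * n ^+ 2 ->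
  (forall i, i \in Z -> #|[set y | (z i, y) \in W]|%:R <= e * n) ->
  (forall i, i \in Z -> #|[set y | (y, z i) \in W]|%:R <= e * n) ->
  i != j -> (i \notin Z) || (j \notin Z) ->
  #|[set f : {ffun I -> V} | pinned Z z f && ((f i, f j) \in W)]|%:R <= e * n ^+ #|~: Z|.
Proof.
move=> e0 hW hl hr ij ijZ.
have := card_box_pair (PY Z z) W ij.
rewrite (_ : [set f : {ffun I -> V} | _ & _] =
  [set f : {ffun I -> V} | pinned Z z f && ((f i, f j) \in W)]); last first.
  by apply/setP => f; rewrite !inE pinned_box.
rewrite -(ler_nat R) natrM => /le_trans; apply.
have -> : (\prod_(l | (l != i) && (l != j)) #|PY Z z l|)%N =
  (#|V| ^ #|[set l in ~: Z | (l != i) && (l != j)]|)%N.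
  rewrite (bigID (mem Z)) /= big1 => [|l /andP[_ lZ]]; last by rewrite /PY lZ cards1.
  rewrite mul1n -prod_nat_const; apply: eq_big => [l|l /andP[_ lZ]].
    by rewrite !inE andbC.
  by rewrite /PY (negbTE lZ) cardsT.
have cZ : #|~: Z| = ((i \notin Z) + (j \notin Z) + #|[set l in ~: Z | (l != i) && (l != j)]|)%N.
  rewrite (cardsD1 i) (cardsD1 j (_ :\ _)) !inE eq_sym (negbTE ij) /= addnA.
  congr (_ + _ + _)%N; apply: eq_card => l; rewrite !inE.
  by rewrite andbA andbC [(l != j) && _]andbC.
move: #|[set l in _ | _]| cZ => m cZ; rewrite cZ natrX !exprD !mulrA.
apply: ler_wpM2r; first by rewrite exprn_ge0.
case: (boolP (i \in Z)) ijZ cZ => iZ; case: (boolP (j \in Z)) => jZ //= _ cZ.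
- rewrite expr0 mulr1 expr1; apply: le_trans (hl i iZ).
  rewrite ler_nat -(card_imset (mem [set y | (z i, y) \in W]) (f := pair (z i))); last by move=> ? ? [].
  apply: subset_leq_card; apply/subsetP => -[x y]; rewrite !inE /= /PY iZ inE.
  by move=> /and3P[xyW /eqP xz _]; apply/imsetP; exists y; rewrite ?inE -?xz.
- rewrite expr0 mulr1 expr1; apply: le_trans (hr j jZ).
  rewrite ler_nat -(card_imset (mem [set y | (y, z j) \in W]) (f := pair^~ (z j))); last by move=> ? ? [].
  apply: subset_leq_card; apply/subsetP => -[x y]; rewrite !inE /= /PY jZ inE.
  by move=> /and3P[xyW _ /eqP xz]; apply/imsetP; exists x; rewrite ?inE -?xz.
- rewrite expr1 -mulrA -expr2; apply: le_trans hW; rewrite ler_nat.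
  by apply: subset_leq_card; apply/subsetP => p; rewrite inE => /andP[].
Qed.

Lemma card_bad_pair Z z W (e : R) : 0 <= e -> #|W|%:R <= e * n ^+ 2 ->
  (forall i, i \in Z -> #|[set y | (z i, y) \in W]|%:R <= e * n) ->
  (forall i, i \in Z -> #|[set y | (y, z i) \in W]|%:R <= e * n) ->
  #|[set f : {ffun I -> V} | pinned Z z f && bad_pair Z W f]|%:R
    <= #|I|%:R ^+ 2 * e * n ^+ #|~: Z|.
Proof.
move=> e0 hW hl hr.
pose T := [set p : I * I | (p.1 != p.2) && ((p.1 \notin Z) || (p.2 \notin Z))].
apply: (@le_trans _ _ (\sum_(p in T) #|[set f : {ffun I -> V} |
    pinned Z z f && ((f p.1, f p.2) \in W)]|)%:R).
  rewrite ler_nat; apply: card_exists_le => f.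
  rewrite inE => /andP[pf /existsP[i /existsP[j /and3P[ij ijZ fW]]]].
  by exists (i, j); rewrite !inE ?ij // pf.
rewrite natr_sum; apply: (@le_trans _ _ (\sum_(p in T) e * n ^+ #|~: Z|)).
  by apply: ler_sum => p; rewrite inE => /andP[? ?]; exact: card_bad_pair1.
rewrite sumr_const -[leLHS]mulr_natl -[leRHS]mulrA; apply: ler_wpM2r.
  by rewrite mulr_ge0 ?exprn_ge0.
by rewrite -natrX ler_nat -mulnn -card_prod max_card.
Qed.

Lemma card_good_box Z z W Y (e d : R) : 0 <= e -> 0 <= d -> #|W|%:R <= e * n ^+ 2 ->
  (forall i, i \in Z -> #|[set y | (z i, y) \in W]|%:R <= e * n) ->
  (forall i, i \in Z -> #|[set y | (y, z i) \in W]|%:R <= e * n) ->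
  (forall i, i \notin Z -> d * n <= #|Y i|%:R) ->
  (d ^+ #|~: Z| - #|I|%:R ^+ 2 * e) * n ^+ #|~: Z| <=
  #|[set f : {ffun I -> V} | [&& pinned Z z f,
      [forall i, (i \notin Z) ==> (f i \in Y i)] & ~~ bad_pair Z W f]]|%:R.
Proof.
move=> e0 d0 hW hl hr hY.
pose Y' i := if i \in Z then [set z i] else Y i.
have pY f : [forall i, f i \in Y' i] =
    pinned Z z f && [forall i, (i \notin Z) ==> (f i \in Y i)].
  apply/forallP/andP => [h|[/pinnedP h1 /forallP h2] i].
    split; [apply/pinnedP => i iZ|apply/forallP => i; apply/implyP => iZ].
      by have := h i; rewrite /Y' iZ inE => /eqP.
    by have := h i; rewrite /Y' (negbTE iZ).
  rewrite /Y'; case: (boolP (i \in Z)) => iZ; first by rewrite inE h1.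
  by have := h2 i; rewrite iZ.
have h1 : d ^+ #|~: Z| * n ^+ #|~: Z| <= #|[set f : {ffun I -> V} | [forall i, f i \in Y' i]]|%:R.
  rewrite card_box (bigID (mem Z)) /= big1 => [|l lZ]; last by rewrite /Y' lZ cards1.
  rewrite mul1n natr_prod -exprMn -prodr_const.
  rewrite (eq_bigl (fun i => i \notin Z)); last by move=> i; rewrite inE.
  apply: ler_prod => i iZ; rewrite mulr_ge0 //= /Y' (negbTE iZ); exact: hY.
have h2 := card_bad_pair e0 hW hl hr.
have h3 : (#|[set f : {ffun I -> V} | [forall i, f i \in Y' i]]| <=
  #|[set f : {ffun I -> V} | [&& pinned Z z f,
      [forall i, (i \notin Z) ==> (f i \in Y i)] & ~~ bad_pair Z W f]]| +
  #|[set f : {ffun I -> V} | pinned Z z f && bad_pair Z W f]|)%N.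
  apply: leq_trans (leq_card_setU _ _); apply: subset_leq_card; apply/subsetP => f.
  by rewrite !inE pY => /andP[-> ->]; rewrite /= orNb.
move: h3; rewrite -(ler_nat R) natrD mulrBl => h3; lra.
Qed.

End Boxes.

(** * Comparing the numbers of copies in two graphs *)

Definition gdiff (V : finType) (G H : {set V * V}) := [set p | (p \in G) != (p \in H)].

Definition cmg (V : finType) (L : eqType) (P : V -> L) : {set V * V} :=
  [set p | P p.1 != P p.2].

Section Diff.
Variables (k r : nat) (c : 'I_k -> 'I_r) (V : finType) (R : realFieldType).
Implicit Types (G H : {set V * V}) (f : {ffun 'I_k -> V}).
Local Open Scope ring_scope.
Local Notation n := (#|V|%:R : R).
Local Notation K := (k%:R : R).

Lemma cmgE (L : eqType) (P : V -> L) x y : ((x, y) \in cmg P) = (P x != P y).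
Proof. by rewrite inE. Qed.

Lemma cmg_sgraph (L : eqType) (P : V -> L) : sgraph (cmg P).
Proof. by apply/sgraphP; split=> [x|x y]; rewrite !cmgE ?eqxx // eq_sym. Qed.

Lemma gdiffC G H : gdiff G H = gdiff H G.
Proof. by apply/setP => p; rewrite !inE eq_sym. Qed.

Lemma gdiff_tri G H J : (#|gdiff G J| <= #|gdiff G H| + #|gdiff H J|)%N.
Proof.
apply: leq_trans (leq_card_setU _ _); apply: subset_leq_card; apply/subsetP => p.
by rewrite !inE; case: (p \in G); case: (p \in H); case: (p \in J).
Qed.

Lemma gdiff_sym G H : sgraph G -> sgraph H ->
  forall x y, ((x, y) \in gdiff G H) = ((y, x) \in gdiff G H).
Proof. by move=> /sgraphP[_ Gs] /sgraphP[_ Hs] x y; rewrite !inE Gs Hs. Qed.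

Lemma copy_agree G H f : sgraph G -> sgraph H ->
  (forall i j, i != j -> (f i, f j) \notin gdiff G H) -> copy c G f = copy c H f.
Proof.
move=> /sgraphP[Gi _] /sgraphP[Hi _] h.
have e i j : ((f i, f j) \in G) = ((f i, f j) \in H).
  have [->|/h] := eqVneq i j; first by rewrite Gi Hi.
  by rewrite inE negbK => /eqP.
by apply/copyP/copyP => -[fi fG]; split=> // i j; rewrite -fG e.
Qed.

(** A comparison of increments: passing from [G'] to [G] adds no more copies than passing from [H']
    to [H], up to the exceptional functions. Each of those contributes at most 2, as four indicator
    values are involved. *)
Lemma copies_quad G G' H H' (Q : pred {ffun 'I_k -> V}) :
  (forall f, ~~ Q f -> copy c G f + copy c H' f <= copy c G' f + copy c H f)%N ->
  (copies c G + copies c H' <= copies c G' + copies c H + 2 * #|[set f | Q f]|)%N.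
Proof.
move=> h.
have E J : copies c J = (\sum_f (copy c J f : nat))%N.
  by rewrite /copies -sum1_card big_mkcond; apply: eq_bigr => f _; rewrite inE; case: (copy _ _ _).
have -> : #|[set f | Q f]| = (\sum_f (Q f : nat))%N.
  by rewrite -sum1_card big_mkcond; apply: eq_bigr => f _; rewrite inE; case: (Q f).
rewrite !E big_distrr -!big_split /=; apply: leq_sum => f _.
case: (boolP (Q f)) => [_|/h]; last by rewrite muln0 addn0.
by do 4!case: (copy _ _ _).
Qed.

Lemma copies_lip G H (e : R) : sgraph G -> sgraph H -> 0 <= e ->
  #|gdiff G H|%:R <= e * n ^+ 2 ->
  (copies c G)%:R <= (copies c H)%:R + K ^+ 2 * e * n ^+ k.
Proof.
move=> Gs Hs e0 hW.
case: (pickP {ffun 'I_k -> V}) => [z _|noz]; last first.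
  rewrite {1}/copies eq_card0 => [|f]; last by have := noz f.
  by rewrite addr_ge0 ?mulr_ge0 ?exprn_ge0.
have h := @card_bad_pair _ V R set0 z _ e e0 hW.
have {h} := h (fun i => ltac:(by rewrite inE)) (fun i => ltac:(by rewrite inE)).
rewrite setC0 cardsT card_ord => h.
apply: le_trans (lerD (lexx _) h); rewrite -natrD ler_nat.
apply: leq_trans (leq_card_setU _ _); apply: subset_leq_card; apply/subsetP => f.
rewrite !inE => fG.
case: (boolP (bad_pair set0 (gdiff G H) f)) => [b|/bad_pairPn b].
  have -> : pinned set0 z f by apply/pinnedP => i; rewrite inE.
  by rewrite orbT.
by rewrite -(copy_agree (f := f) Gs Hs) ?fG // => i j ij; apply: b => //; rewrite inE.
Qed.

(** A function avoiding [u] cancels within [G, G'] and within [H, H']. A function through [u]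
    cancels across, between [G] and [H] and between [G'] and [H'], unless it uses a pair of [W].
    With the image [u] pinned and the degree of [u] in [W] small, only [e * n ^+ k.-1] functions up
    to a constant remain. *)
Lemma copies_vertex_diff G G' H H' u (e : R) :
  sgraph G -> sgraph G' -> sgraph H -> sgraph H' -> 0 <= e ->
  (forall x y, x != u -> y != u -> ((x, y) \in G) = ((x, y) \in G')) ->
  (forall x y, x != u -> y != u -> ((x, y) \in H) = ((x, y) \in H')) ->
  #|gdiff G H :|: gdiff G' H'|%:R <= e * n ^+ 2 ->
  #|[set y | (u, y) \in gdiff G H :|: gdiff G' H']|%:R <= e * n ->
  (copies c G)%:R + (copies c H')%:R <=
  (copies c G')%:R + (copies c H)%:R + 2 * (K ^+ 3 * e * n ^+ k.-1).
Proof.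
move=> Gs Gs' Hs Hs' e0 uG uH; set W := _ :|: _ => hW hdeg.
have Wsym x y : ((x, y) \in W) = ((y, x) \in W) by rewrite !in_setU gdiff_sym // [X in _ || X]gdiff_sym.
pose Q f := [exists i, (f i == u) && bad_pair [set i] W f].
have hQ : #|[set f | Q f]|%:R <= K ^+ 3 * e * n ^+ k.-1.
  apply: (@le_trans _ _ (\sum_(i in [set: 'I_k])
      #|[set f | pinned [set i] [ffun=> u] f && bad_pair [set i] W f]|)%:R).
    rewrite ler_nat; apply: card_exists_le => f.
    rewrite inE => /existsP[i /andP[/eqP fi bi]]; exists i; rewrite ?inE // bi andbT.
    by apply/pinnedP => j; rewrite inE => /eqP ->; rewrite ffunE.
  rewrite natr_sum; apply: (@le_trans _ _ (\sum_(i in [set: 'I_k]) K ^+ 2 * e * n ^+ k.-1)).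
    apply: ler_sum => i _.
    have -> : k.-1 = #|~: [set i]| by rewrite cardsC1 card_ord.
    have := @card_bad_pair _ V R [set i] [ffun=> u] _ e e0 hW; rewrite card_ord; apply.
      by move=> j _; rewrite ffunE.
    move=> j _; rewrite ffunE; apply: le_trans hdeg; rewrite ler_nat.
    by apply: eq_leq; apply: eq_card => y; rewrite !inE; have := Wsym y u; rewrite !inE.
  by rewrite sumr_const cardsT card_ord -[leLHS]mulr_natl (exprS K 2) !mulrA.
suff hp f : ~~ Q f -> (copy c G f + copy c H' f <= copy c G' f + copy c H f)%N.
  have := copies_quad hp; rewrite -(ler_nat R) natrD [X in _ <= X -> _]natrD natrD natrM => h.
  by apply: le_trans h _; rewrite lerD2l ler_wpM2l.
rewrite negb_exists => /forallP hf.
have agree J J' : sgraph J -> sgraph J' -> (forall i j, i != j -> (f i, f j) \in gdiff J J' -> False) ->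
    copy c J f = copy c J' f.
  by move=> Js Js' h'; apply: copy_agree => // i j ij; apply/negP; exact: h'.
case: (boolP [exists i, f i == u]) => [/existsP[i fi]|/existsPn nu].
  have := hf i; rewrite fi /= => /bad_pairPn b.
  have b' j l : j != l -> (f j, f l) \notin W.
    move=> jl; apply: b => //; rewrite !inE -negb_and.
    by apply: contra jl => /andP[/eqP -> /eqP ->].
  rewrite (agree G H) // => [|j l /b']; last by rewrite in_setU negb_or => /andP[/negP].
  rewrite (agree G' H') // => [|j l /b']; last by rewrite in_setU negb_or => /andP[_ /negP].
  by rewrite addnC.
rewrite (agree G G') // => [|j l _]; last by rewrite inE uG ?nu // eqxx.
by rewrite (agree H H') // => j l _; rewrite inE uH ?nu // eqxx.
Qed.

(** The same cancellation with two pinned vertices. The pair [(u, v)] itself is not in [W], since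
    the graphs agree there, so a bad pair involves a free index and the error drops to order
    [n ^+ k.-2]. *)
Lemma copies_pair_diff G G' H H' u v (e : R) : u != v ->
  sgraph G -> sgraph G' -> sgraph H -> sgraph H' -> 0 <= e ->
  (forall p, p != (u, v) -> p != (v, u) -> (p \in G) = (p \in G')) ->
  (forall p, p != (u, v) -> p != (v, u) -> (p \in H) = (p \in H')) ->
  ((u, v) \in G) = ((u, v) \in H) -> ((u, v) \in G') = ((u, v) \in H') ->
  #|gdiff G H :|: gdiff G' H'|%:R <= e * n ^+ 2 ->
  #|[set y | (u, y) \in gdiff G H :|: gdiff G' H']|%:R <= e * n ->
  #|[set y | (v, y) \in gdiff G H :|: gdiff G' H']|%:R <= e * n ->
  (copies c G)%:R + (copies c H')%:R <=
  (copies c G')%:R + (copies c H)%:R + 2 * (K ^+ 4 * e * n ^+ k.-2).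
Proof.
move=> uv Gs Gs' Hs Hs' e0 uG uH euv euv'; set W := _ :|: _ => hW hdu hdv.
have Wsym x y : ((x, y) \in W) = ((y, x) \in W) by rewrite !in_setU gdiff_sym // [X in _ || X]gdiff_sym.
have uvW : (u, v) \notin W by rewrite !inE euv euv' !eqxx.
pose z (i : 'I_k) : {ffun 'I_k -> V} := [ffun l => if l == i then u else v].
pose S := [set p : 'I_k * 'I_k | p.1 != p.2].
pose Q f := [exists p, [&& p \in S, f p.1 == u, f p.2 == v & bad_pair [set p.1; p.2] W f]].
have hQ : #|[set f | Q f]|%:R <= K ^+ 4 * e * n ^+ k.-2.
  apply: (@le_trans _ _ (\sum_(p in S)
      #|[set f | pinned [set p.1; p.2] (z p.1) f && bad_pair [set p.1; p.2] W f]|)%:R).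
    rewrite ler_nat; apply: card_exists_le => f.
    rewrite inE => /existsP[[i j] /and4P[pS /eqP fi /eqP fj bi]]; exists (i, j) => //.
    rewrite inE bi andbT; apply/pinnedP => l; rewrite !inE ffunE /= => /orP[/eqP ->|/eqP ->].
      by rewrite eqxx.
    by move: pS; rewrite inE eq_sym => /negbTE /= ->.
  rewrite natr_sum; apply: (@le_trans _ _ (\sum_(p in S) K ^+ 2 * e * n ^+ k.-2)).
    apply: ler_sum => -[i j]; rewrite inE /= => ij.
    have -> : k.-2 = #|~: [set i; j]| by rewrite cardsCs setCK cards2 ij card_ord subn2.
    have := @card_bad_pair _ V R [set i; j] (z i) _ e e0 hW; rewrite card_ord; apply.
      by move=> l _; rewrite ffunE; case: ifP.
    move=> l _; rewrite ffunE.
    have hy w : #|[set y | (y, w) \in W]| = #|[set y | (w, y) \in W]|.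
      by apply: eq_card => y; rewrite in_set [RHS]in_set Wsym.
    by rewrite hy; case: ifP.
  rewrite sumr_const -[leLHS]mulr_natl (_ : K ^+ 4 * e * n ^+ k.-2 = K ^+ 2 * (K ^+ 2 * e * n ^+ k.-2)); last by ring.
  apply: ler_wpM2r; first by rewrite !mulr_ge0 ?exprn_ge0.
  by rewrite -natrX ler_nat -mulnn -[X in (X * _)%N](card_ord k) -[X in (_ * X)%N](card_ord k) -card_prod max_card.
suff hp f : ~~ Q f -> (copy c G f + copy c H' f <= copy c G' f + copy c H f)%N.
  have := copies_quad hp; rewrite -(ler_nat R) natrD [X in _ <= X -> _]natrD natrD natrM => h.
  by apply: le_trans h _; rewrite lerD2l ler_wpM2l.
rewrite negb_exists => /forallP hf.
have agree J J' : sgraph J -> sgraph J' -> (forall i j, i != j -> (f i, f j) \in gdiff J J' -> False) ->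
    copy c J f = copy c J' f.
  by move=> Js Js' h'; apply: copy_agree => // i j ij; apply/negP; exact: h'.
case: (boolP [exists p, [&& p \in S, f p.1 == u & f p.2 == v]]) => [/existsP[[i j]]|/existsPn nu].
  move=> /and3P[pS /= fi fj]; have := hf (i, j); rewrite pS fi fj /= => /bad_pairPn b.
  have ij : i != j by move: pS; rewrite inE.
  have b' s l : s != l -> (f s, f l) \notin W.
    move=> sl; case: (boolP ((s \notin [set i; j]) || (l \notin [set i; j]))) => [/b -> //|].
    rewrite negb_or !negbK !in_set2.
    move=> /andP[/orP[/eqP si|/eqP sj] /orP[/eqP li|/eqP lj]].
    - by rewrite si li eqxx in sl.
    - by rewrite si lj (eqP fi) (eqP fj).
    - by rewrite sj li (eqP fi) (eqP fj) Wsym.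
    - by rewrite sj lj eqxx in sl.
  rewrite (agree G H) // => [|s l /b']; last by rewrite in_setU negb_or => /andP[/negP].
  rewrite (agree G' H') // => [|s l /b']; last by rewrite in_setU negb_or => /andP[_ /negP].
  by rewrite addnC.
have nuv s l : s != l -> (f s, f l) != (u, v).
  by move=> sl; apply: contra (nu (s, l)) => /eqP[<- <-]; rewrite inE sl !eqxx.
have nvu s l : s != l -> (f s, f l) != (v, u).
  move=> sl; apply: contra (nu (l, s)) => /eqP[<- <-]; by rewrite inE eq_sym sl !eqxx.
rewrite (agree G G') // => [|j l jl]; last by rewrite inE uG ?nuv ?nvu // eqxx.
by rewrite (agree H H') // => j l jl; rewrite inE uH ?nuv ?nvu // eqxx.
Qed.

End Diff.

(** * Charging the defect for missing pairs *)

Lemma inj_through1 r q (i : 'I_r) (a : 'I_q) : r <= q ->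
  exists pi : 'I_r -> 'I_q, injective pi /\ pi i = a.
Proof.
move=> rq; exists (fun l => tperm (widen_ord rq i) a (widen_ord rq l)).
split; last exact: tpermL.
by move=> x y /perm_inj /(congr1 val) /= ?; exact: val_inj.
Qed.

Lemma inj_through2 r q (i j : 'I_r) (a b : 'I_q) : r <= q -> i != j -> a != b ->
  exists pi : 'I_r -> 'I_q, [/\ injective pi, pi i = a & pi j = b].
Proof.
move=> rq ij ab; have [pi [pinj pia]] := inj_through1 i a rq.
exists (fun l => tperm (pi j) b (pi l)); split.
- by move=> x y /perm_inj /pinj.
- by rewrite pia tpermD // -?pia ?(inj_eq pinj) // eq_sym // pia.
- exact: tpermL.
Qed.

Definition part (V : finType) (L : eqType) (P : V -> L) (j : L) := [set x | P x == j].

Section Missing.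
Variables (k r : nat) (c : 'I_k -> 'I_r) (V : finType) (R : realFieldType).
Implicit Types (G H : {set V * V}) (A : {set V}) (f : {ffun 'I_k -> V}).
Local Open Scope ring_scope.
Local Notation n := (#|V|%:R : R).
Local Notation K := (k%:R : R).

(** The diagonal is added to the forbidden pairs [W], so that functions without a bad pair are
    injective; this is the origin of [+ n] and [+ 1] in the hypotheses. A function that respects the
    type [pi] and avoids [W] is then a copy. *)
Lemma many_copies (L : eqType) G (W : {set V * V}) (U : {set V}) (P : V -> L) (pi : 'I_r -> L)
    (Z : {set 'I_k}) (z : {ffun 'I_k -> V}) (Y : 'I_k -> {set V}) (e d : R) :
  sgraph G -> injective pi -> 0 <= e -> 0 <= d ->
  (forall x y, x \in U -> y \in U -> x != y -> (x, y) \notin W ->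
     ((x, y) \in G) = (P x != P y)) ->
  #|W|%:R + n <= e * n ^+ 2 ->
  (forall i, i \in Z -> #|[set y | (z i, y) \in W]|%:R + 1 <= e * n) ->
  (forall i, i \in Z -> #|[set y | (y, z i) \in W]|%:R + 1 <= e * n) ->
  (forall i, i \in Z -> z i \in U /\ P (z i) = pi (c i)) ->
  (forall i j, i \in Z -> j \in Z -> i != j -> z i != z j /\ (z i, z j) \notin W) ->
  (forall i, i \notin Z -> d * n <= #|Y i|%:R) ->
  (forall i x, i \notin Z -> x \in Y i -> x \in U /\ P x = pi (c i)) ->
  (d ^+ #|~: Z| - K ^+ 2 * e) * n ^+ #|~: Z| <=
  #|[set f | [&& pinned Z z f, [forall i, (i \notin Z) ==> (f i \in Y i)] & copy c G f]]|%:R.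
Proof.
move=> Gs pinj e0 d0 hG hW hl hr hz hzz hY hYP.
have /sgraphP[Gi _] := Gs.
pose W' := W :|: [set (x, x) | x : V].
have cD : #|[set (x, x) | x : V]| = #|V|.
  by rewrite card_imset ?cardsT // => x y [].
have := @card_good_box _ V R Z z W' Y e d e0 d0 _ _ _ hY; rewrite card_ord.
move=> /(_ _ _ _)/le_trans; apply.
- apply: le_trans hW; rewrite -natrD ler_nat; apply: leq_trans (leq_card_setU _ _) _.
  by rewrite cD.
- move=> i iZ; apply: le_trans (hl i iZ); rewrite natr1 ler_nat.
  apply: (@leq_trans #|z i |: [set y | (z i, y) \in W]|); last by rewrite cardsU1; case: (_ \notin _); lia.
  apply: subset_leq_card; apply/subsetP => y; rewrite !inE => /orP[->|/imsetP[x _ [<- ->]]].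
    by rewrite orbT.
  by rewrite eqxx.
- move=> i iZ; apply: le_trans (hr i iZ); rewrite natr1 ler_nat.
  apply: (@leq_trans #|z i |: [set y | (y, z i) \in W]|); last by rewrite cardsU1; case: (_ \notin _); lia.
  apply: subset_leq_card; apply/subsetP => y; rewrite !inE => /orP[->|/imsetP[x _ [<- ->]]].
    by rewrite orbT.
  by rewrite eqxx.
rewrite ler_nat; apply: subset_leq_card; apply/subsetP => f.
rewrite !inE => /and3P[pf Yf bf]; rewrite pf Yf /=; move/pinnedP: pf => pf.
have UP i : f i \in U /\ P (f i) = pi (c i).
  have [iZ|iZ] := boolP (i \in Z); first by rewrite pf //; exact: hz.
  by apply: hYP => //; move/forallP: Yf => /(_ i); rewrite iZ.
have sep i j : i != j -> f i != f j /\ (f i, f j) \notin W.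
  move=> ij; have [/andP[iZ jZ]|] := boolP ((i \in Z) && (j \in Z)); first by rewrite !pf //; exact: hzz.
  rewrite negb_and => ijZ; have := bad_pairPn bf ij ijZ.
  rewrite in_setU negb_or => /andP[-> /imsetP h]; split=> //.
  by apply/eqP => e1; apply: h; exists (f i); rewrite ?e1.
have finj : injective f.
  by move=> i j e1; apply/eqP; apply: contraT => /sep[/eqP].
apply/copyP; split=> // i j.
have [->|ij] := eqVneq i j; first by rewrite Gi eqxx.
have [U1 P1] := UP i; have [U2 P2] := UP j; have [s1 s2] := sep _ _ ij.
by rewrite hG // P1 P2 (inj_eq pinj).
Qed.

Variables (i1 : 'I_r).
Hypotheses (i1_big : (2 <= #|[set i | c i == i1]|)%N) (csurj : forall j, exists i, c i = j)
  (r2 : (2 <= r)%N).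

Lemma other_color : exists i, c i != i1.
Proof.
have [j ji] : exists j : 'I_r, j != i1.
  have : (1 < #|'I_r|)%N by rewrite card_ord.
  by move=> /card_gt1P[x [y [_ _ xy]]]; have [e|] := eqVneq x i1; [exists y; rewrite -e eq_sym|exists x].
by have [i ci] := csurj j; exists i; rewrite ci.
Qed.

Lemma clone_sgraph G A v : sgraph G -> v \in A -> sgraph (clone G A v).
Proof.
move=> /sgraphP[Gi Gs] vA; apply/sgraphP; split=> [x|x y]; rewrite !inE /=.
  by rewrite Gi; case: (x \in A).
by case: (x \in A); case: (y \in A); rewrite //= Gs.
Qed.

Lemma inpart_big G A f i : copy c G f -> c i = i1 ->
  (forall j, c j = i1 -> f j \in A) -> (2 <= #|inpart A f|)%N.
Proof.
move=> _ _ h; apply: leq_trans i1_big _; apply: subset_leq_card; apply/subsetP => j.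
by rewrite !inE => /eqP/h.
Qed.

(** Symmetrize a part [a], which is independent. If [u] in [a] misses [w] outside [a], then every
    copy through [w] at a colour other than [i1], with its whole class [i1] inside [a], is
    incompatible with [u]. There are at least [g] such copies, so each missing pair at [a] yields a
    gain of [g], while the total gain is at most [#|part P a|] times the defect. Summing over the
    parts gives the factor [n]. *)
Lemma missing_pairs q (P : V -> 'I_q) G (M : nat) (e d : R) :
  (r <= q)%N -> sgraph G -> (forall G', sgraph G' -> copies c G' <= M)%N ->
  0 <= e -> 0 <= d -> K ^+ 2 * e <= d ^+ k.-1 ->
  (forall j, d * n <= #|part P j|%:R) ->
  (forall x y, P x = P y -> (x, y) \notin G) ->
  (forall x, #|[set y | (x, y) \in gdiff G (cmg P)]|%:R + 1 <= e * n) ->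
  (d ^+ k.-1 - K ^+ 2 * e) * n ^+ k.-1 * #|gdiff G (cmg P)|%:R
    <= n * (M%:R - (copies c G)%:R).
Proof.
move=> rq Gs GM e0 d0 g0 hP hin hdeg.
set W := gdiff G (cmg P); set g := (d ^+ k.-1 - K ^+ 2 * e) * n ^+ k.-1.
have [/existsP[x0 _]|] := boolP [exists x : V, true]; last first.
  rewrite negb_exists => /forallP noV.
  have -> : #|W| = 0%N by apply: eq_card0 => -[x y]; have := noV x.
  by rewrite mulr0 mulr_ge0 // subr_ge0 ler_nat GM.
have [i0 ci0] := other_color.
have Wsym x y : ((x, y) \in W) = ((y, x) \in W) by rewrite /W gdiff_sym // cmg_sgraph.
have cW : #|W| = (\sum_u #|[set w | (u, w) \in W]|)%N.
  rewrite -sum1_card (eq_bigl (fun p => (p.1 \in V) && ((p.1, p.2) \in W))); last by case.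
  rewrite -(pair_big_dep predT (fun u w => (u, w) \in W) (fun _ _ => 1%N)) /=.
  by apply: eq_bigr => u _; rewrite -sum1_card; apply: eq_bigl => w; rewrite inE.
have hW : #|W|%:R + n <= e * n ^+ 2.
  have -> : #|W|%:R + n = \sum_(u : V) (#|[set w | (u, w) \in W]|%:R + 1) :> R.
    by rewrite cW big_split natr_sum /= sumr_const.
  apply: (@le_trans _ _ (\sum_(u : V) e * n)); first exact: ler_sum.
  by rewrite sumr_const -[leLHS]mulr_natl expr2 mulrCA.
have degsym x : #|[set y | (y, x) \in W]| = #|[set y | (x, y) \in W]|.
  by apply: eq_card => y; rewrite in_set [RHS]in_set Wsym.
pose S a w := [set f | [&& copy c G f, f i0 == w & [forall i, (c i == i1) ==> (P (f i) == a)]]].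
have cS a w : P w != a -> g <= #|S a w|%:R.
  move=> wa; have [pi [pinj pi1 pi0]] := inj_through2 rq ci0 wa.
  have := @many_copies _ G W setT P pi [set i0] [ffun=> w] (fun i => part P (pi (c i))) e d Gs pinj e0 d0.
  rewrite cardsC1 card_ord => h; apply: le_trans (h _ _ _ _ _ _ _ _) _ => // {h}.
  - by move=> x y _ _ _; rewrite !inE negbK => /eqP ->.
  - by move=> i _; rewrite ffunE degsym; exact: hdeg.
  - by move=> i; rewrite !inE ffunE => /eqP ->; rewrite pi1.
  - by move=> i j; rewrite !inE => /eqP -> /eqP ->; rewrite eqxx.
  - by move=> i x _; rewrite !inE => /eqP ->.
  rewrite ler_nat; apply: subset_leq_card; apply/subsetP => f.
  rewrite !inE => /and3P[/pinnedP pf /forallP Yf ->] /=; apply/andP; split.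
    by rewrite pf ?inE // ffunE.
  apply/forallP => i; apply/implyP => /eqP ci; have := Yf i; rewrite !inE ci pi0.
  by have -> : i != i0 by apply: contraNneq ci0 => <-; rewrite ci.
have per_part a : g * (\sum_(u in part P a) #|[set w | (u, w) \in W]|)%:R <=
    #|part P a|%:R * (M%:R - (copies c G)%:R).
  have [/existsP[v0 v0a]|] := boolP [exists v, v \in part P a]; last first.
    rewrite negb_exists => /forallP nov; rewrite big_pred0 => [|u]; last exact/negbTE.
    by rewrite mulr0 mulr_ge0 // subr_ge0 ler_nat GM.
  have aind : {in part P a &, forall x y, (x, y) \in G = false}.
    by move=> x y; rewrite !inE => /eqP xa /eqP ya; apply/negbTE/hin; rewrite xa.
  have := @symmetrize_gain k r c V G _ v0 Gs aind v0a.
  have ub : (\sum_(v in part P a) copies c (clone G (part P a) v) <= #|part P a| * M)%N.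
    rewrite -sum_nat_const; apply: leq_sum => v va; apply: GM; exact: clone_sgraph.
  move=> /leq_trans/(_ ub); rewrite -(ler_nat R) natrD !natrM mulrBr.
  set X := (X in _ + X <= _); suff : g * (\sum_(u in part P a) #|[set w | (u, w) \in W]|)%:R <= X by lra.
  rewrite /X natr_sum mulr_sumr.
  apply: (@le_trans _ _ (\sum_(u in part P a) \sum_(w | (u, w) \in W) #|S a w|)%:R).
    rewrite natr_sum; apply: ler_sum => u ua.
    have -> : g * #|[set w | (u, w) \in W]|%:R = \sum_(w | (u, w) \in W) g.
      by rewrite sumr_const -[RHS]mulr_natr; congr (_ * _%:R); apply: eq_card => w; rewrite inE.
    rewrite natr_sum; apply: ler_sum => w uw; apply: cS; move: uw; rewrite !inE.
    move: ua; rewrite inE => /eqP <-; rewrite eq_sym.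
    by have [e1|//] := eqVneq (P u) (P w); rewrite (negbTE (hin _ _ e1)).
  rewrite ler_nat.
  rewrite (eq_bigr (fun f => \sum_(u in part P a) (~~ compat c G (part P a) f u : nat))%N); last first.
    move=> f _; rewrite -sum1_card big_mkcond [RHS]big_mkcond; apply: eq_bigr => u _.
    by rewrite inE; case: (u \in _); case: (compat _ _ _ _ _).
  rewrite [leqRHS](exchange_big_dep (mem (part P a))) //=; apply: leq_sum => u ua.
  (* For fixed [u], the incompatible copies are sorted by the vertex [w] at [i0], so no copy is
     charged to two missing pairs at [u]. *)
  rewrite -big_mkcondr /= (partition_big (fun f : {ffun 'I_k -> V} => f i0) predT) //=.
  rewrite big_mkcond /=; apply: leq_sum => w _; case: ifP => // uw; rewrite sum1_card.
  apply: subset_leq_card; apply/subsetP => f; rewrite inE unfold_in.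
  move=> /and3P[fG /eqP fi0 /forallP fa].
  have fa' i : c i = i1 -> f i \in part P a.
    by move=> ci; have := fa i; rewrite ci eqxx inE.
  have [i ci] := csurj i1.
  rewrite fi0 eqxx fG (inpart_big fG ci fa') ua andbT /=.
  have wa : w \notin part P a.
    move: ua uw; rewrite !inE => /eqP ua uw; apply/negP => /eqP wa.
    have := hin u w; rewrite ua wa => /(_ erefl)/negbTE e1.
    by move: uw; rewrite e1 ua wa eqxx.
  apply/negP => /compatP/(_ i i0 (fa' i ci)); rewrite fi0 => /(_ wa).
  rewrite ci eq_sym ci0 => uwG; move: uw; rewrite !inE uwG.
  by move: ua wa; rewrite !inE => /eqP ->; rewrite eq_sym => ->.
have -> : n = \sum_a #|part P a|%:R.
  rewrite -natr_sum -sum1_card (partition_big P predT) //=; congr (_%:R).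
  by apply: eq_bigr => a _; rewrite -sum1_card; apply: eq_bigl => x; rewrite inE.
rewrite mulr_suml; apply: le_trans (ler_sum _ (fun a _ => per_part a)).
rewrite -mulr_sumr -natr_sum cW (partition_big P predT) //=.
by rewrite ler_wpM2l // ?mulr_ge0 ?subr_ge0 ?exprn_ge0 // ler_nat; apply: leq_sum => a _;
  apply: eq_leq; apply: eq_bigl => x; rewrite inE.
Qed.
End Missing.

(** * Local stability *)

Definition setnb (V : finType) (H : {set V * V}) (u : V) (X : {set V}) : {set V * V} :=
  [set p | if p.1 == u then (p.2 != u) && (p.2 \in X)
           else if p.2 == u then p.1 \in X else p \in H].

Section Vertex.
Variables (k r : nat) (c : 'I_k -> 'I_r) (V : finType) (R : realFieldType).
Implicit Types (G H : {set V * V}) (A X : {set V}) (f : {ffun 'I_k -> V}).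
Local Open Scope ring_scope.
Local Notation n := (#|V|%:R : R).
Local Notation K := (k%:R : R).
Variables (i1 : 'I_r).
Hypotheses (i1_big : (2 <= #|[set i | c i == i1]|)%N) (csurj : forall j, exists i, c i = j)
  (r2 : (2 <= r)%N).

Lemma setnb_sgraph H u X : sgraph H -> sgraph (setnb H u X).
Proof.
move=> /sgraphP[Hi Hs]; apply/sgraphP; split=> [x|x y]; rewrite !inE /=.
  by case: eqP.
by case: (eqVneq x u) => ?; case: (eqVneq y u) => ? //=; exact: Hs.
Qed.

Lemma setnb_off H u X x y : x != u -> y != u -> ((x, y) \in setnb H u X) = ((x, y) \in H).
Proof. by move=> /negbTE xu /negbTE yu; rewrite inE /= xu yu. Qed.

Lemma setnb_at H u X y : ((u, y) \in setnb H u X) = (y != u) && (y \in X).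
Proof. by rewrite inE /= eqxx. Qed.

Lemma card_touch u : (#|[set p : V * V | (p.1 == u) || (p.2 == u)]| <= 2 * #|V|)%N.
Proof.
apply: (@leq_trans #|[set (u, y) | y : V] :|: [set (y, u) | y : V]|).
  apply: subset_leq_card; apply/subsetP => -[x y]; rewrite !inE /=.
  by move=> /orP[/eqP->|/eqP->]; apply/orP; [left|right]; exact: imset_f.
apply: leq_trans (leq_card_setU _ _) _; rewrite mul2n -addnn.
by apply: leq_add; apply: leq_imset_card.
Qed.

Lemma card_del A x : #|A|%:R - 1 <= #|A :\ x|%:R :> R.
Proof. by rewrite lerBlDr natr1 ler_nat (cardsD1 x A) addnC -[leqRHS]addn1 leq_add2l leq_b1. Qed.

Lemma card_setnb H u X Y : sgraph H ->
  (#|gdiff (setnb H u X) (setnb H u Y)| <= 2 * #|(X :\: Y) :|: (Y :\: X)|)%N.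
Proof.
move=> Hs; set D := _ :|: _.
apply: (@leq_trans #|[set (u, y) | y in D] :|: [set (y, u) | y in D]|).
  apply: subset_leq_card; apply/subsetP => -[x y]; rewrite in_set [in X in X -> _]inE [in X in _ == X]inE /=.
  case: (eqVneq x u) => [->|xu]; case: (eqVneq y u) => [->|yu] //=; rewrite ?eqxx // in_setU.
    move=> h; apply/orP; left; apply: imset_f; rewrite !inE.
    by move: h; case: (y \in X); case: (y \in Y).
  move=> h; apply/orP; right; apply: (imset_f (fun y => (y, u))); rewrite !inE.
  by move: h; case: (x \in X); case: (x \in Y).
apply: leq_trans (leq_card_setU _ _) _; rewrite mul2n -addnn.
by apply: leq_add; apply: leq_imset_card.
Qed.

(* Symmetrize u with the non-neighbours of u in a part j. If u misses many vertices of two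
   parts, or many but not almost all of one part, this gains too much; if u misses few
   vertices of every part, then u is nearly universal, which universal_gap excludes. *)
Lemma vertex_class q (P0 : V -> 'I_q) G u (M : nat) (d e eta delta w cV e' : R) :
  let H := cmg P0 in let X := [set y | (u, y) \in G] in
  let Hj j := setnb H u [set y | P0 y != j] in
  (0 < k)%N -> (r <= q)%N -> sgraph G -> (forall G', sgraph G' -> copies c G' <= M)%N ->
  0 <= e -> #|gdiff G H|%:R <= e * n ^+ 2 ->
  (forall G', sgraph G' -> (forall x y, x != u -> y != u -> ((x, y) \in G') = ((x, y) \in G)) ->
     (copies c G')%:R <= (copies c G)%:R + w * n ^+ k.-1) ->
  (exists j, (copies c (setnb H u setT))%:R + cV * n ^+ k.-1 <= (copies c (Hj j))%:R) ->
  (forall j, d * n <= #|part P0 j|%:R) ->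
  (forall j, M%:R <= (copies c (Hj j))%:R + delta * n ^+ k) ->
  0 < eta -> eta <= 1 -> 2 <= eta * n -> 2 * eta <= d -> 0 <= e' -> 3 <= e' * n ->
  K ^+ 2 * e' <= (eta / 2) ^+ k / 2 -> 0 <= delta -> 0 <= w ->
  delta + (w + 2 * K ^+ 3 * e) < eta / 2 * ((eta / 2) ^+ k / 2) ->
  2 * K ^+ 2 * q%:R * eta + (w + 2 * K ^+ 3 * e) < cV ->
  exists j, #|part P0 j :&: X|%:R < eta * n /\
    forall l, l != j -> #|part P0 l :\: X|%:R < eta * n.
Proof.
move=> H X Hj k0 rq Gs GM e0 hGH hmove hV1 hd hM eta0 eta1 etan etad e'0 e'n he' delta0 w0 hsmall hcV.
have Hs : sgraph H := cmg_sgraph P0.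
have n0 : 0 < n by rewrite -(pmulr_rgt0 _ eta0); lra.
have nk : n ^+ k = n * n ^+ k.-1 by rewrite -exprS prednK.
have nk0 : 0 < n ^+ k.-1 by rewrite exprn_gt0.
set w' := w + 2 * K ^+ 3 * e in hsmall hcV.
have w'0 : 0 <= w' by rewrite addr_ge0 // !mulr_ge0 // exprn_ge0.
(* The model graph in which only [u] keeps its neighbourhood from [G]. *)
pose T := setnb H u X.
have Ts : sgraph T by exact: setnb_sgraph.
have uX : u \notin X by have /sgraphP[Gi _] := Gs; rewrite inE Gi.
have /sgraphP[Gi Gsym] := Gs.
(* Moving [u] into class [j] gains at most [w * n ^+ k.-1] in [G], hence hardly more in the model.
   The difference sets compared here never touch [u], so their degree condition at [u] is
   trivial. *)
have key j : (copies c (Hj j))%:R <= (copies c T)%:R + w' * n ^+ k.-1.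
  have Gjs : sgraph (setnb G u [set y | P0 y != j]) by exact: setnb_sgraph.
  have := @copies_vertex_diff k r c V R (Hj j) T (setnb G u [set y | P0 y != j]) G u e.
  have offW p : p \in gdiff (Hj j) (setnb G u [set y | P0 y != j]) :|: gdiff T G ->
      [&& p.1 != u, p.2 != u & p \in gdiff G H].
    case: p => x y; rewrite in_setU /gdiff !in_set /=.
    case: (eqVneq x u) => [->|xu]; case: (eqVneq y u) => [->|yu]; rewrite ?eqxx //=.
    - by rewrite Gi.
    - by rewrite Gsym eqxx.
    - by rewrite orbb eq_sym.
  have h1 : #|gdiff (Hj j) (setnb G u [set y | P0 y != j]) :|: gdiff T G|%:R <= e * n ^+ 2.
    apply: le_trans hGH; rewrite ler_nat; apply: subset_leq_card; apply/subsetP => p.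
    by move=> /offW/and3P[].
  have h2 : #|[set y | (u, y) \in gdiff (Hj j) (setnb G u [set y | P0 y != j]) :|: gdiff T G]|%:R <= e * n.
    rewrite eq_card0 ?mulr_ge0 // => y; apply/negbTE; rewrite in_set.
    by apply/negP => /offW; rewrite eqxx.
  have hmv := hmove _ Gjs (fun x y xu yu => setnb_off G _ xu yu).
  move=> /(_ (setnb_sgraph _ _ Hs) Ts Gjs Gs e0) h.
  have {h} := h _ _ h1 h2; rewrite /w'.
  have offa x y : x != u -> y != u -> ((x, y) \in Hj j) = ((x, y) \in T).
    by move=> xu yu; rewrite !setnb_off.
  have offb x y : x != u -> y != u -> ((x, y) \in setnb G u [set y | P0 y != j]) = ((x, y) \in G).
    by move=> xu yu; rewrite setnb_off.
  by move=> /(_ offa offb); move: hmv; clear -i1_big csurj r2 R; lra.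
pose eta' := eta / 2; pose g := eta' ^+ k / 2.
have eta'0 : 0 < eta' by rewrite /eta'; move: eta0; clear -i1_big csurj r2 R; lra.
have g0 : 0 < g by rewrite /g divr_gt0 // exprn_gt0.
have gap : g <= eta' ^+ k - K ^+ 2 * e'.
  by move: he'; rewrite -/eta' /g; clear -i1_big csurj r2 R; lra.
have [i0 ci0] := other_color i1 csurj r2.
have small_W : #|[set p : V * V | (p.1 == u) || (p.2 == u)]|%:R + n <= e' * n ^+ 2.
  apply: (@le_trans _ _ (3 * n)); last by rewrite expr2 mulrA ler_wpM2r // ltW.
  have -> : 3 * n = (2 * #|V|)%:R + n by rewrite natrM; ring.
  by rewrite lerD2r ler_nat card_touch.
have cardY := card_del.
have inA j x : x \in u |: (part P0 j :\: X) -> x != u -> P0 x = j /\ x \notin X.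
  by rewrite !inE => /orP[->//|/andP[? /eqP]].
have Aind j : {in u |: (part P0 j :\: X) &, forall x y, (x, y) \in T = false}.
  move=> x y /inA hx /inA hy; rewrite inE /=.
  have [_|/hx[xj xX]] := eqVneq x u.
    by have [//|/hy[_ /negbTE ->]] := eqVneq y u.
  have [yu|/hy[yj yX]] := eqVneq y u; first exact/negbTE.
  by rewrite cmgE xj yj eqxx.
have uA j : u \in u |: (part P0 j :\: X) by rewrite !inE eqxx.
(* Every vertex of the set other than [u] has the neighbourhood of part [j]. Hence all its clones
   give the same graph [Hj j], and only the clone at [u] has to be bounded by [M]. *)
have cl j v : v \in u |: (part P0 j :\: X) -> v != u ->
    clone T (u |: (part P0 j :\: X)) v = Hj j.
  move=> vA vu; have [vj vX] := inA _ _ vA vu; move: (inA j) (uA j).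
  have nA x : x != u -> P0 x != j -> x \notin u |: (part P0 j :\: X).
    by move=> xu xj; apply/negP => xA; have [xj' _] := inA _ _ xA xu; rewrite xj' eqxx in xj.
  move: (u |: _) nA => A nA hA uA'; apply/setP => -[x y].
  have vT z : ((v, z) \in T) = (z != u) && (j != P0 z).
    rewrite inE /= (negbTE vu); have [zu|_] := eqVneq z u; first exact/negbTE.
    by rewrite cmgE vj.
  have Tv z : ((z, v) \in T) = (z != u) && (j != P0 z).
    by have /sgraphP[_ ->] := Ts.
  rewrite in_set /= vT Tv [RHS]in_set /= !in_set [j == P0 x]eq_sym [j == P0 y]eq_sym.
  have [->|xu] := eqVneq x u.
    rewrite uA'; have [//|yu] := eqVneq y u; rewrite /= ?andbF //.
    have [_|yj] := eqVneq (P0 y) j; rewrite ?andbF // andbT; exact: nA.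
  have [->|yu] := eqVneq y u.
    rewrite uA' /=; case: (boolP (x \in A)) => // xA.
    by have [-> _] := hA _ xA xu; rewrite eqxx.
  case: (boolP (x \in A)) => xA /=.
    have [-> _] := hA _ xA xu; rewrite eq_sym; have [|yj] := eqVneq (P0 y) j; rewrite ?andbF // andbT; exact: nA.
  case: (boolP (y \in A)) => yA; first by have [-> _] := hA _ yA yu.
  by [].
have ub j : (\sum_(v in u |: (part P0 j :\: X)) copies c (clone T (u |: (part P0 j :\: X)) v)
     <= #|u |: (part P0 j :\: X)|.-1 * copies c (Hj j) + M)%N.
  rewrite (bigD1 u) /= // addnC leq_add ?GM ?clone_sgraph //.
  rewrite (eq_bigr (fun=> copies c (Hj j))); last by move=> v /andP[vA vu]; rewrite cl.
  rewrite sum_nat_const leq_mul2r; apply/orP; right; rewrite (cardsD1 u (u |: _)) uA /=.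
  by apply: eq_leq; apply: eq_card => x; rewrite [RHS]in_set andbC inE.
have cAn j : (#|u |: (part P0 j :\: X)|%:R : R) <= n by rewrite ler_nat max_card.
have cA0 j : (0 < #|u |: (part P0 j :\: X)|)%N by rewrite card_gt0; apply/set0Pn; exists u.
have predA j : (#|u |: (part P0 j :\: X)|.-1%:R : R) = #|u |: (part P0 j :\: X)|%:R - 1.
  by rewrite -subn1 natrB.
(* An upper bound for the total gain of the symmetrization, written as
   [a * (N(Hj) - N(T)) + (M - N(Hj))]. *)
have slack (j : 'I_q) (a : R) : 0 <= a -> a <= n ->
    (a - 1) * (copies c (Hj j))%:R + M%:R - a * (copies c T)%:R <= (w' + delta) * n ^+ k.
  move=> a0 an; have h1 := key j; have h2 := hM j.
  have h3 : a * ((copies c (Hj j))%:R - (copies c T)%:R) <= n * (w' * n ^+ k.-1).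
    apply: (@le_trans _ _ (a * (w' * n ^+ k.-1))); first by rewrite ler_wpM2l //; move: h1; clear -i1_big csurj r2 R; lra.
    by rewrite ler_wpM2r // mulr_ge0 // ltW.
  have -> : (w' + delta) * n ^+ k = n * (w' * n ^+ k.-1) + delta * n ^+ k by rewrite nk; ring.
  by move: h2 h3; clear -i1_big csurj r2 R; lra.
have shr A : eta * n <= #|A|%:R -> eta' * n <= #|A :\ u|%:R.
  by move=> hA; have := cardY A u; rewrite /eta'; move: hA etan; clear -i1_big csurj r2 R; lra.
(* The copies that pay have class [i1] among the non-neighbours of [u] in part [j] and [i0] at a
   non-neighbour of [u] in part [l]: [u] is incompatible with each of them. *)
have no_i1 j l : l != j -> eta * n <= #|part P0 j :\: X|%:R ->
    eta * n <= #|part P0 l :\: X|%:R -> False.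
  move=> lj hj hl.
  have [pi [pinj pi0 pi1]] := inj_through2 rq ci0 lj.
  have := @symmetrize_gain k r c V T _ u Ts (Aind j) (uA j).
  set S := (X in (_ + X <= _)%N).
  have hS : g * n ^+ k <= S%:R.
    pose Y i := if c i == i1 then (part P0 j :\: X) :\ u
                else if i == i0 then (part P0 l :\: X) :\ u else part P0 (pi (c i)) :\ u.
    have := @many_copies k r c V R _ T [set p | (p.1 == u) || (p.2 == u)] setT P0 pi set0 [ffun=> u] Y e' eta' Ts pinj e'0 (ltW eta'0).
    rewrite setC0 cardsT card_ord => h.
    apply: (@le_trans _ _ ((eta' ^+ k - K ^+ 2 * e') * n ^+ k)).
      by rewrite ler_wpM2r // exprn_ge0.
    apply: le_trans (h _ small_W _ _ _ _ _ _) _ => {h}.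
    - move=> x y _ _ _; rewrite in_set /= negb_or => /andP[xu yu].
      by rewrite setnb_off // cmgE.
    - by move=> i; rewrite inE.
    - by move=> i; rewrite inE.
    - by move=> i; rewrite inE.
    - by move=> i j'; rewrite inE.
    - move=> i _; rewrite /Y; case: ifP => _; last case: ifP => _.
      + exact: shr.
      + exact: shr.
      + apply: shr; apply: le_trans (hd _); rewrite ler_wpM2r //.
        by move: etad eta0; clear -i1_big csurj r2 R; lra.
    - move=> i x _ xY; split; first by rewrite inE.
      move: xY; rewrite /Y; case: (eqVneq (c i) i1) => [->|_]; first by rewrite !inE pi1 => /and3P[_ _ /eqP ->].
      by case: (eqVneq i i0) => [->|_]; rewrite !inE; [rewrite pi0 => /and3P[_ _ /eqP ->]|move=> /andP[_ /eqP ->]].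
    rewrite ler_nat -sum1_card /S big_mkcond [leqRHS]big_mkcond /=; apply: leq_sum => f _.
    rewrite inE; case: ifP => // /and3P[_ /forallP fY fT].
    have fY1 i : c i = i1 -> f i \in part P0 j :\: X.
      by move=> ci; have := fY i; rewrite !inE /Y ci eqxx !inE => /andP[_].
    have [i ci] := csurj i1.
    have fA i' : c i' = i1 -> f i' \in u |: (part P0 j :\: X).
      by move=> /fY1 h; rewrite in_setU h orbT.
    rewrite fT (inpart_big i1_big fT ci fA) /= card_gt0; apply/set0Pn; exists u.
    rewrite inE uA /=; apply/negP => /compatP/(_ i i0 (fA i ci)) h.
    have := fY i0; rewrite inE /Y (negbTE ci0) eqxx in_setD1 in_setD [_ \in part _ _]inE /=.
    move=> /and3P[fu fX /eqP fl]; move: h; rewrite setnb_at (negbTE fX) andbF ci eq_sym ci0.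
    have -> : f i0 \notin u |: (part P0 j :\: X); last by move=> /(_ isT).
    by rewrite in_setU1 in_setD (negbTE fu) fX inE fl (negbTE lj).
  move=> /leq_trans/(_ (ub j)); rewrite -(ler_nat R) natrD [X in _ <= X -> _]natrD !natrM predA => h.
  have sl := slack j _ (ler0n _ _) (cAn j).
  have : g * n ^+ k <= (w' + delta) * n ^+ k by apply: le_trans hS _; move: h sl; clear -i1_big csurj r2 R; lra.
  rewrite ler_pM2r ?exprn_gt0 // => gw.
  have eta'1 : eta' <= 1 by rewrite /eta'; move: eta1; clear -i1_big csurj r2 R; lra.
  have : eta' * g <= 1 * g by rewrite ler_wpM2r // ltW.
  by move: hsmall gw; rewrite -/eta' -/g; clear -i1_big csurj r2 R; lra.
(* Now the clone at [u] is used. It joins the non-neighbours in part [j] to the neighbours of [u] in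
   the same part; on the copies using such a pair, every vertex of the set except [u] is wrong. *)
have no_i2 j : eta * n <= #|part P0 j :\: X|%:R -> eta * n <= #|part P0 j :&: X|%:R ->
    (forall l, l != j -> #|part P0 l :\: X|%:R < eta * n) -> False.
  move=> hj hjX hl.
  have [pi [pinj pi0]] := inj_through1 (c i0) j rq.
  have := @symmetrize_gain_clones k r c V T _ u Ts (Aind j) (uA j).
  set S := (X in (_ + X <= _)%N).
  have hS : eta' * n * (g * n ^+ k) <= S%:R.
    pose J := clone T (u |: (part P0 j :\: X)) u.
    have Js : sgraph J by exact: clone_sgraph.
    (* On [U], the clone at [u] is complete multipartite with the cloned set as a new class [None],
       separated from what is left of part [j]. *)
    pose P x := if x \in u |: (part P0 j :\: X) then None else Some (P0 x).
    pose pi' l := if l == i1 then None else Some (pi l).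
    have pinj' : injective pi'.
      move=> l l'; rewrite /pi'; case: (eqVneq l i1) => [->|_]; case: (eqVneq l' i1) => [->|_] //.
      by case=> /pinj.
    pose Y i := if c i == i1 then (part P0 j :\: X) :\ u else part P0 (pi (c i)) :&: X.
    pose U := (part P0 j :\: X) :\ u :|: X.
    have Uu x : x \in U -> x != u.
      by rewrite !inE => /orP[/and3P[]//|]; apply: contraTneq => ->; move: uX; rewrite inE.
    have AX x : x \in X -> x \notin u |: (part P0 j :\: X).
      by move=> xX; rewrite !in_setU in_setD xX /= orbF inE; apply: contraTneq xX => ->.
    have small : (#|(set0 : {set (V * V)%type})|%:R + n : R) <= e' * n ^+ 2.
      rewrite cards0 add0r expr2 mulrA; apply: le_trans (_ : 3 * n <= _); last by rewrite ler_wpM2r // ltW.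
      by move: n0; clear -i1_big csurj r2 R; lra.
    have := @many_copies k r c V R _ J set0 U P pi' set0 [ffun=> u] Y e' eta' Js pinj' e'0 (ltW eta'0).
    rewrite setC0 cardsT card_ord => h.
    have {h} h : (eta' ^+ k - K ^+ 2 * e') * n ^+ k <= #|[set f | [&& pinned set0 [ffun=> u] f,
        [forall i, (i \notin set0) ==> (f i \in Y i)] & copy c J f]]|%:R.
      apply: (h _ small) => [x y xU yU _ _|i|i|i|i j'|i _|i x _]; rewrite ?[_ \in set0]inE //.
      + have xu := Uu _ xU; have yu := Uu _ yU.
        have XA z : z \in U -> z \notin u |: (part P0 j :\: X) -> z \in X.
          move=> zU; apply: contraR => zX; move: zU.
          by rewrite /U in_setU (negbTE zX) orbF in_setD1 in_setU1 => /andP[_ ->]; rewrite orbT.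
        have Txu : ((x, u) \in T) = (x \in X) by have /sgraphP[_ ->] := Ts; rewrite setnb_at xu.
        rewrite /J /P in_set /= Txu setnb_at yu /= setnb_off //.
        have [xA|xA] := boolP (x \in u |: _); have [yA|yA] := boolP (y \in u |: _) => //=.
        * by rewrite XA.
        * by rewrite XA.
        * by rewrite cmgE (inj_eq (@Some_inj _)).
      + rewrite /Y; case: ifP => _; first exact: shr.
        rewrite /eta'; have [->|pj] := eqVneq (pi (c i)) j; first by apply: le_trans hjX; rewrite ler_wpM2r //; move: eta0; clear -i1_big csurj r2 R; lra.
        have hl' := hl _ pj; have hd' := hd (pi (c i)).
        have : (#|part P0 (pi (c i)) :&: X| + #|part P0 (pi (c i)) :\: X| = #|part P0 (pi (c i))|)%N by rewrite cardsID.
        move=> /(congr1 (fun m => m%:R : R)); rewrite natrD => e1.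
        have : 2 * eta * n <= d * n by rewrite ler_wpM2r // ltW.
        by move: hl' hd' e1 eta0 n0 (mulr_gt0 eta0 n0); clear -i1_big csurj r2 R; lra.
      rewrite /Y /P /pi'; case: (eqVneq (c i) i1) => [_|ci]; last rewrite in_setI => /andP[xp xX].
        move=> xY; split; first by rewrite in_setU xY.
        by move: xY; rewrite in_setU1 in_setD1 => /andP[_ ->]; rewrite orbT.
      by rewrite (negbTE (AX _ xX)) in_setU xX orbT; split=> //; move: xp; rewrite inE => /eqP ->.
    rewrite /S; apply: (@le_trans _ _ (\sum_(f | copy c J f && (2 <= #|inpart (u |: (part P0 j :\: X)) f|)%N)
        #|[set u' in u |: (part P0 j :\: X) | ~~ compat c T (u |: (part P0 j :\: X)) f u']|)%:R); last first.
      by rewrite ler_nat [leqRHS](bigD1 u) //= leq_addr.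
    apply: (@le_trans _ _ (\sum_(f in [set f | [&& pinned set0 [ffun=> u] f,
        [forall i, (i \notin set0) ==> (f i \in Y i)] & copy c J f]]) eta' * n)).
      rewrite sumr_const -[leRHS]mulr_natl mulrC; apply: ler_wpM2r; first by rewrite mulr_ge0 // ltW.
      by apply: le_trans h; rewrite ler_wpM2r // exprn_ge0.
    rewrite natr_sum big_mkcond [leRHS]big_mkcond /=; apply: ler_sum => f _.
    rewrite inE; case: ifP => [/and3P[_ /forallP fY fT]|_]; last by case: ifP.
    have fY1 i : c i = i1 -> f i \in part P0 j :\: X.
      by move=> ci; have := fY i; rewrite !inE /Y ci eqxx !inE => /andP[_].
    have [i ci] := csurj i1.
    have fA i' : c i' = i1 -> f i' \in u |: (part P0 j :\: X).
      by move=> /fY1 h'; rewrite in_setU h' orbT.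
    rewrite fT (inpart_big i1_big fT ci fA) /=; apply: le_trans (shr _ hj) _; rewrite ler_nat.
    apply: subset_leq_card; apply/subsetP => u' u'A; rewrite inE.
    have := u'A; rewrite in_setD1 => /andP[u'u u'j]; rewrite in_setU u'j orbT /=.
    apply/negP => /compatP/(_ i i0 (fA i ci)) h'.
    have := fY i0; rewrite inE /Y (negbTE ci0) pi0 in_setI /= => /andP[fj fX].
    have fu : f i0 != u by apply: contraTneq fX => ->.
    move: h' (AX _ fX) => h' /h'; rewrite setnb_off // cmgE ci [i1 == _]eq_sym ci0.
    by move: u'j fj; rewrite in_setD !inE => /andP[_ /eqP ->] /eqP ->; rewrite eqxx.
  move=> /leq_trans h.
  have {h} := h _ (leq_mul (leqnn _) (ub j)).
  rewrite -(ler_nat R) natrD !natrM natrD natrM predA => h.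
  have sl := slack j _ (ler0n _ _) (cAn j).
  set a := (#|_|%:R : R) in h sl.
  have a0 : 0 <= a by exact: ler0n.
  have an : a <= n by exact: cAn.
  have h2 : S%:R <= a * ((w' + delta) * n ^+ k).
    apply: le_trans (ler_wpM2l a0 sl); move: h; rewrite -lerBrDl => /le_trans; apply.
    by rewrite le_eqVlt; apply/orP; left; apply/eqP; ring.
  have h3 : a * ((w' + delta) * n ^+ k) <= n * ((w' + delta) * n ^+ k).
    by rewrite ler_wpM2r // mulr_ge0 ?exprn_ge0 // addr_ge0.
  have : n * (eta' * g) * n ^+ k <= n * (w' + delta) * n ^+ k.
    by move: (le_trans hS (le_trans h2 h3)); congr (_ <= _); ring.
  rewrite ler_pM2r ?exprn_gt0 // ler_pM2l // => gw.
  by move: hsmall gw; rewrite -/eta' -/g; clear -i1_big csurj r2 R; lra.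
have [/existsP[j hj]|] := boolP [exists j, eta * n <= #|part P0 j :\: X|%:R].
  exists j; have hl l : l != j -> #|part P0 l :\: X|%:R < eta * n.
    by move=> lj; rewrite ltNge; apply/negP; exact: no_i1 lj hj.
  by split=> //; rewrite ltNge; apply/negP => hjX; exact: no_i2 hj hjX hl.
(* All parts are almost completely joined to [u]. Making [u] universal changes few pairs, so [hV1]
   provides a class [j] in which [u] would lie in many more copies, against [key]. *)
rewrite negb_exists => /forallP hX; exfalso.
have cX : #|~: X|%:R <= q%:R * (eta * n).
  rewrite -sum1_card (partition_big P0 predT) //= natr_sum.
  apply: (@le_trans _ _ (\sum_(j : 'I_q) eta * n)); last by rewrite sumr_const card_ord -[leLHS]mulr_natl.
  apply: ler_sum => j _; have := hX j; rewrite -ltNge => /ltW; apply: le_trans.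
  by rewrite sum1_card ler_nat; apply: eq_leq; apply: eq_card => x; rewrite unfold_in in_setC [RHS]in_setD [_ \in part _ _]inE.
have hT : (copies c T)%:R <= (copies c (setnb H u setT))%:R + K ^+ 2 * (2 * q%:R * eta / n) * n ^+ k.
  apply: copies_lip => //; first exact: setnb_sgraph.
    by rewrite !mulr_ge0 // ?invr_ge0 // ltW.
  apply: (@le_trans _ _ (2 * #|~: X|)%:R).
    rewrite ler_nat; apply: leq_trans (card_setnb _ _ _ Hs) _; rewrite leq_mul2l.
    by apply/orP; right; apply: subset_leq_card; apply/subsetP => x; rewrite !inE; case: (_ \in G).
  rewrite natrM; apply: le_trans (_ : 2 * (q%:R * (eta * n)) <= _); first by rewrite ler_wpM2l.
  by rewrite le_eqVlt; apply/orP; left; apply/eqP; field; rewrite gt_eqF.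
have [j hj] := hV1.
have h1 := key j.
have e1 : K ^+ 2 * (2 * q%:R * eta / n) * n ^+ k = 2 * K ^+ 2 * q%:R * eta * n ^+ k.-1.
  by rewrite nk; field; rewrite gt_eqF.
have : cV * n ^+ k.-1 <= (2 * K ^+ 2 * q%:R * eta + w') * n ^+ k.-1.
  by rewrite e1 in hT; rewrite mulrDl; move: hT hj h1; clear -i1_big csurj r2 R; lra.
by rewrite ler_pM2r // leNgt hcV.
Qed.
End Vertex.

Local Open Scope ring_scope.

(** All smallness conditions on one constant are put into the form [a * x <= b], so that they can be
    met at once. *)
Lemma small_exists (R : realFieldType) (s : seq (R * R)) :
  all (fun p => (0 <= p.1) && (0 < p.2)) s ->
  exists x : R, 0 < x /\ all (fun p => p.1 * x <= p.2) s.
Proof.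
elim: s => [|[a b] s IH] /=; first by exists 1.
move=> /andP[/andP[a0 b0] hs]; have [x [x0 hx]] := IH hs.
pose y := Num.min x (b / (a + 1)).
have a1 : 0 < a + 1 by rewrite ltr_wpDl.
have y0 : 0 < y by rewrite lt_min x0 divr_gt0.
have y1 : y <= b / (a + 1) by rewrite ge_min lexx orbT.
have y2 : y <= x by rewrite ge_min lexx.
exists y; split=> //; apply/andP; split.
  have : (a + 1) * y <= b by rewrite mulrC -ler_pdivlMr.
  by rewrite mulrDl mul1r; apply: le_trans; rewrite lerDl ltW.
apply/allP => p ps; have /andP[p0 _] := allP hs _ ps.
by apply: le_trans (allP hx _ ps); rewrite ler_wpM2l.
Qed.

Lemma large_exists (R : realFieldType) (s : seq (R * R)) :
  all (fun p => (0 < p.1) && (0 <= p.2)) s ->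
  exists x : R, 0 < x /\ forall y, x <= y -> all (fun p => p.2 <= p.1 * y) s.
Proof.
elim: s => [|[a b] s IH] /=; first by exists 1.
move=> /andP[/andP[a0 b0] /IH [x [x0 hx]]]; exists (x + b / a); split.
  by rewrite ltr_pwDl // divr_ge0 // ltW.
move=> y hy; rewrite hx ?andbT; last by apply: le_trans hy; rewrite lerDl divr_ge0 // ltW.
rewrite mulrC -ler_pdivrMr //; apply: le_trans hy; by rewrite lerDr ltW.
Qed.

Lemma finite_max (R : realFieldType) (T : finType) (Q : pred T) (F : T -> R) x0 :
  Q x0 -> exists x, Q x /\ forall y, Q y -> F y <= F x.
Proof.
move=> Qx0; exists [arg max_(x > x0 | Q x) F x]%O.
by case: arg_maxP => // x Qx hx.
Qed.

Lemma card_pairs (V : finType) (W : {set V * V}) :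
  #|W| = (\sum_u #|[set w | (u, w) \in W]|)%N.
Proof.
rewrite -sum1_card (eq_bigl (fun p => (p.1 \in V) && ((p.1, p.2) \in W))); last by case.
rewrite -(pair_big_dep predT (fun u w => (u, w) \in W) (fun _ _ => 1%N)) /=.
by apply: eq_bigr => u _; rewrite -sum1_card; apply: eq_bigl => w; rewrite inE.
Qed.

Definition addedge (V : finType) (H : {set V * V}) (u v : V) : {set V * V} :=
  H :|: [set (u, v); (v, u)].

Lemma in_gdiff (V : finType) (G H : {set V * V}) p : (p \in gdiff G H) = ((p \in G) != (p \in H)).
Proof. by rewrite inE. Qed.

Section Local.
Variables (k r : nat) (c : 'I_k -> 'I_r) (R : realFieldType).
Local Notation K := (k%:R : R).
Variables (i1 : 'I_r).
Hypotheses (i1_big : (2 <= #|[set i | c i == i1]|)%N) (csurj : forall j, exists i, c i = j)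
  (r2 : (2 <= r)%N).

Definition universal_gap (V : finType) q (P : V -> 'I_q) (cV : R) := forall u, exists j,
  (copies c (setnb (cmg P) u setT))%:R + cV * #|V|%:R ^+ k.-1 <=
  (copies c (setnb (cmg P) u [set y | P y != j]))%:R.

Definition edge_gap (V : finType) q (P : V -> 'I_q) (c2 : R) := forall u v, u != v -> P u = P v ->
  (copies c (addedge (cmg P) u v))%:R + c2 * #|V|%:R ^+ k.-2 <= (copies c (cmg P))%:R.

(** Maximise the number of copies minus [w] times the distance to [G0]. By the triangle inequality
    the penalty relative to [G0] bounds every further gain by a penalty relative to the maximiser
    itself. *)
Lemma ekeland (V : finType) (G0 : {set V * V}) (w : R) : sgraph G0 ->
  exists G, [/\ sgraph G,
    (copies c G0)%:R + w * #|gdiff G G0|%:R <= (copies c G)%:R &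
    0 <= w -> forall G', sgraph G' ->
      (copies c G')%:R <= (copies c G)%:R + w * #|gdiff G' G|%:R].
Proof.
move=> G0s.
have [G [Gs hG]] := finite_max (fun G => (copies c G)%:R - w * #|gdiff G G0|%:R) G0s.
exists G; split=> //.
  have := hG _ G0s; have -> : gdiff G0 G0 = set0 by apply/setP => p; rewrite !inE eqxx.
  by rewrite cards0 mulr0 subr0 lerBrDr.
move=> w0 G' Gs'; have := hG _ Gs'.
have : w * #|gdiff G' G0|%:R <= w * #|gdiff G' G|%:R + w * #|gdiff G G0|%:R.
  by rewrite -mulrDr ler_wpM2l // -natrD ler_nat gdiff_tri.
move: (copies c G)%:R (copies c G')%:R (w * _) (w * _) (w * _) => a b x y z; clear -i1_big csurj r2 R; lra.
Qed.

Lemma gdiff_off (V : finType) (G G' : {set V * V}) u :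
  (forall x y, x != u -> y != u -> ((x, y) \in G') = ((x, y) \in G)) ->
  (#|gdiff G' G| <= 2 * #|V|)%N.
Proof.
move=> h; apply: leq_trans (card_touch u); apply: subset_leq_card; apply/subsetP => -[x y].
rewrite !inE /=; apply: contraR; rewrite negb_or => /andP[xu yu]; by rewrite h.
Qed.

(** The penalty per pair is [w0 * n ^+ k.-2], the order of the number of copies through a pair, with
    [w0] below both gaps. The two inverses in the conclusion come from the two legs of the distance:
    [w0^-1] from [G0] to the maximiser [G], the other one from [G] to its multipartite graph by
    [missing_pairs]. *)
Lemma local_stability_estimate (V : finType) q (P0 : V -> 'I_q) (G0 : {set V * V}) (M : nat)
  (d cV c2 t eta e1 e delta w0 e' : R) :
  let n := #|V|%:R : R in let g := eta / 2 * ((eta / 2) ^+ k / 2) in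
  (2 < k)%N -> (r <= q)%N -> (forall G' : {set V * V}, sgraph G' -> copies c G' <= M)%N ->
  (forall j, d * n <= #|part P0 j|%:R) -> universal_gap P0 cV ->
  (forall P : V -> 'I_q, #|[set x | P x != P0 x]|%:R <= t * n -> edge_gap P c2) ->
  0 < d -> 0 < cV -> 0 < c2 -> 0 < t -> 0 < eta -> 0 < e1 -> 0 < e -> 0 < delta -> 0 < w0 -> 0 < e' ->
  2 * eta <= d -> eta <= 1 -> 2 * K ^+ 2 * q%:R * eta <= cV / 2 -> q%:R * eta <= e1 / 2 ->
  2 * K ^+ 4 * e1 <= c2 / 2 -> 2 * K ^+ 2 * e1 <= (d / 2) ^+ k.-1 / 2 ->
  2 * w0 <= g / 8 -> 2 * w0 <= cV / 8 -> 2 * w0 <= c2 / 4 ->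
  2 * K ^+ 3 * e <= g / 8 -> 2 * K ^+ 3 * e <= cV / 8 -> 2 * K ^+ 2 * e <= g / 8 ->
  2 * e <= d * (e1 / 2) -> 2 * e <= d * t -> 2 * e <= d * (d / 2) -> delta <= g / 8 -> 2 * delta <= w0 * e ->
  K ^+ 2 * e' <= (eta / 2) ^+ k / 2 ->
  2 <= eta * n -> 3 <= e' * n -> 2 <= e * n -> 1 <= e1 * n ->
  sgraph G0 -> #|gdiff G0 (cmg P0)|%:R <= e / 2 * n ^+ 2 ->
  M%:R <= (copies c G0)%:R + delta * n ^+ k ->
  exists P : V -> 'I_q, #|[set x | P x != P0 x]|%:R <= t * n /\
    #|gdiff G0 (cmg P)|%:R * n ^+ k.-2 <= (w0^-1 + ((d / 2) ^+ k.-1 / 2)^-1) * (M%:R - (copies c G0)%:R).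
Proof.
move=> n g k2 rq GM hd hV1 hV2 d0 cV0 c20 t0 eta0 e10 e0 delta0 w00 e'0.
move=> etad eta1 etacV etae1 e1c2 e1d w0g w0cV w0c2 eg ecV e2g ede1 edt edd dg dw he' etan e'n en e1n G0s hG0 hM.
have n0 : 0 < n by rewrite -(pmulr_rgt0 _ eta0) (lt_le_trans _ etan).
have Hs := cmg_sgraph P0.
have kE1 : n ^+ k = n * n ^+ k.-1 by rewrite -exprS prednK // (ltn_trans _ k2).
have kE2 : n ^+ k.-1 = n * n ^+ k.-2 by rewrite -exprS; congr (_ ^+ _); case: k k2 => [|[|]].
have nk2 : 0 < n ^+ k.-2 by rewrite exprn_gt0.
have nk1 : 0 < n ^+ k.-1 by rewrite exprn_gt0.
have nk : 0 < n ^+ k by rewrite exprn_gt0.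
have [[[[[nk2' nk1'] nk'] w00'] d0'] e10'] := (ltW nk2, ltW nk1, ltW nk, ltW w00, ltW d0, ltW e10).
have [G [Gs hG hGmax]] := ekeland (w0 * n ^+ k.-2) G0s.
have {}hGmax := hGmax (ltW (mulr_gt0 w00 nk2)).
have NG : (copies c G)%:R <= M%:R :> R by rewrite ler_nat GM.
have hGG0 : #|gdiff G G0|%:R <= e / 2 * n ^+ 2.
  have h : w0 * n ^+ k.-2 * #|gdiff G G0|%:R <= delta * n ^+ k.
    by move: hG hM NG; clear -i1_big csurj r2 R; lra.
  have : w0 * n ^+ k.-2 * #|gdiff G G0|%:R <= w0 * n ^+ k.-2 * (e / 2 * n ^+ 2).
    apply: le_trans h _; rewrite kE1 kE2.
    rewrite (_ : w0 * _ * _ = (w0 * e / 2) * (n * (n * n ^+ k.-2))); last by ring.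
    rewrite ler_wpM2r ?mulr_ge0 ?(ltW n0) ?(ltW nk2) //; move: dw; clear -i1_big csurj r2 R; lra.
  by rewrite ler_pM2l // mulr_gt0.
have hGH : #|gdiff G (cmg P0)|%:R <= e * n ^+ 2.
  have := gdiff_tri G G0 (cmg P0); rewrite -(ler_nat R) natrD => h.
  apply: le_trans h _; move: hGG0 hG0; clear -i1_big csurj r2 R; lra.
have en2 : 2 * n <= e * n ^+ 2 by rewrite expr2 mulrA ler_wpM2r // ltW.
have move1 u G' : sgraph G' -> (forall x y, x != u -> y != u -> ((x, y) \in G') = ((x, y) \in G)) ->
    (copies c G')%:R <= (copies c G)%:R + 2 * w0 * n ^+ k.-1.
  move=> Gs' hoff; apply: le_trans (hGmax _ Gs') _; rewrite lerD2l kE2.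
  rewrite (_ : 2 * w0 * _ = w0 * n ^+ k.-2 * (2 * n)); last by ring.
  by rewrite ler_wpM2l ?mulr_ge0 // -natrM ler_nat; exact: gdiff_off hoff.
(* Placing [u] in any class of the model changes at most [2 * n] pairs, so the new model is still
   nearly extremal. *)
have near u j : M%:R <= (copies c (setnb (cmg P0) u [set y | P0 y != j]))%:R + g / 4 * n ^+ k.
  have h1 : #|gdiff G (setnb (cmg P0) u [set y | P0 y != j])|%:R <= (2 * e) * n ^+ 2.
    have := gdiff_tri G (cmg P0) (setnb (cmg P0) u [set y | P0 y != j]).
    have h1 : #|gdiff (cmg P0) (setnb (cmg P0) u [set y | P0 y != j])|%:R <= 2 * n.
      rewrite -natrM ler_nat.
      exact: gdiff_off (fun x y xu yu => esym (setnb_off (cmg P0) [set y | P0 y != j] xu yu)).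
    rewrite -(ler_nat R) natrD => h2; apply: le_trans h2 _.
    by move: h1 en2 hGH; clear -i1_big csurj r2 R; lra.
  have := copies_lip c Gs (setnb_sgraph _ _ Hs) _ h1.
  rewrite mulr_ge0 ?(ltW e0) // => /(_ isT) h2.
  have h3 : K ^+ 2 * (2 * e) * n ^+ k <= g / 8 * n ^+ k.
    rewrite ler_wpM2r ?(ltW nk) //; move: e2g; clear -i1_big csurj r2 R; lra.
  have h4 : delta * n ^+ k <= g / 8 * n ^+ k by rewrite ler_wpM2r.
  have h5 : (copies c G0)%:R <= (copies c G)%:R :> R.
    by apply: le_trans hG; rewrite lerDl !mulr_ge0.
  rewrite (_ : g / 4 * n ^+ k = g / 8 * n ^+ k + g / 8 * n ^+ k); last by field.
  by move: h2 h3 h4 h5 hM; clear -i1_big csurj r2 R; lra.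
have g0 : 0 < g by rewrite /g !mulr_gt0 ?exprn_gt0 ?invr_gt0 ?mulr_gt0 ?invr_gt0.
have classes u : exists j, #|part P0 j :&: [set y | (u, y) \in G]|%:R < eta * n /\
    forall l, l != j -> #|part P0 l :\: [set y | (u, y) \in G]|%:R < eta * n.
  apply: (@vertex_class k r c V R i1 i1_big csurj r2 q P0 G u M d e eta (g / 4) (2 * w0) cV e') => //;
    try (by rewrite ltW); try exact: move1; try by exact: hV1.
  - by rewrite (ltn_trans _ k2).
  - by rewrite divr_ge0 ?ltW.
  - by rewrite mulr_ge0.
  - rewrite -/g; move: w0g eg g0; clear -i1_big csurj r2 R; lra.
  - move: etacV ecV w0cV cV0; clear -i1_big csurj r2 R; lra.
have [P hP] : exists P : V -> 'I_q, forall u,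
    #|part P0 (P u) :&: [set y | (u, y) \in G]|%:R < eta * n /\
    forall l, l != P u -> #|part P0 l :\: [set y | (u, y) \in G]|%:R < eta * n.
  exact: (fin_all_exists classes).
pose S := [set x | P x != P0 x].
have Gsym x y : ((x, y) \in G) = ((y, x) \in G) by have /sgraphP[_] := Gs.
have Gi x : (x, x) \in G = false by have /sgraphP[] := Gs.
have moved : #|S|%:R <= 2 * e / d * n.
  have h : #|S|%:R * (d / 2 * n) <= e * n ^+ 2.
    apply: le_trans hGH; rewrite card_pairs natr_sum mulr_natl -sumr_const.
    rewrite big_mkcond /=; apply: ler_sum => x _; case: ifP => //; rewrite inE => xS.
    apply: (@le_trans _ _ (#|part P0 (P x) :\: [set y | (x, y) \in G]|%:R)).
      have := cardsID [set y | (x, y) \in G] (part P0 (P x)).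
      move=> /(congr1 (fun m => m%:R : R)); rewrite natrD => e2.
      have [h1 _] := hP x; have h2 := hd (P x).
      have h3 : 2 * eta * n <= d * n by rewrite ler_wpM2r.
      move: e2 h1 h2 h3; clear -i1_big csurj r2 R; lra.
    rewrite ler_nat; apply: subset_leq_card; apply/subsetP => y.
    by rewrite !inE => /andP[/negbTE -> /eqP ->]; rewrite [P0 x == _]eq_sym xS.
  have h2 : #|S|%:R * (d / 2 * n) <= (2 * e / d * n) * (d / 2 * n).
    by apply: le_trans h _; rewrite le_eqVlt; apply/orP; left; apply/eqP; field; rewrite gt_eqF.
  by move: h2; rewrite ler_pM2r // mulr_gt0 // divr_gt0.
have sized x : 2 * e <= d * x -> #|S|%:R <= x * n.
  by move=> h; apply: le_trans moved _; rewrite ler_wpM2r // ler_pdivrMr // [leRHS]mulrC.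
have typical u : #|[set y | (u, y) \in gdiff G (cmg P)]|%:R <= e1 * n.
  pose B l := if l == P u then part P0 l :&: [set y | (u, y) \in G]
              else part P0 l :\: [set y | (u, y) \in G].
  have h1 : (#|[set y | (u, y) \in gdiff G (cmg P)]| <= #|S| + \sum_(l in [set: 'I_q]) #|B l|)%N.
    apply: (@leq_trans (#|S| + #|[set y | (u, y) \in gdiff G (cmg P)] :\: S|)).
      apply: leq_trans (leq_card_setU _ _); apply: subset_leq_card; apply/subsetP => y.
      by rewrite in_setU in_setD; case: (y \in S).
    rewrite leq_add2l; apply: card_exists_le => y; rewrite 4!inE negbK /gdiff !inE /= => /andP[/eqP Py h].
    exists (P0 y); rewrite ?inE // /B; move: h; rewrite Py [P u == _]eq_sym.
    case: (eqVneq (P0 y) (P u)) => [e2|ne]; rewrite !inE ?e2 eqxx; first by case: (_ \in G).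
    by rewrite andbT; case: (_ \in G).
  have h2 : (\sum_(l in [set: 'I_q]) #|B l|)%:R <= q%:R * eta * n.
    rewrite natr_sum -mulrA mulr_natl -[X in _ *+ X]card_ord -cardsT -sumr_const.
    apply: ler_sum => l _; have [h3 h4] := hP u; rewrite ltW // /B.
    by case: eqVneq => [->|/h4].
  have h3 := sized _ ede1.
  have h4 : q%:R * eta * n <= e1 / 2 * n by rewrite ler_wpM2r.
  move: h1; rewrite -(ler_nat R) natrD => h1; move: h1 h2 h3 h4; clear -i1_big csurj r2 R; lra.
have partP j : d / 2 * n <= #|part P j|%:R.
  have h1 : (#|part P0 j| <= #|part P j| + #|S|)%N.
    apply: leq_trans (leq_card_setU _ _); apply: subset_leq_card; apply/subsetP => y.
    by rewrite !inE => /eqP <-; case: eqP.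
  move: h1; rewrite -(ler_nat R) natrD => h1; have h2 := hd j; have h3 := sized _ edd.
  move: h1 h2 h3; clear -i1_big csurj r2 R; lra.
have typW : #|gdiff G (cmg P)|%:R <= e1 * n ^+ 2.
  rewrite card_pairs natr_sum; apply: (@le_trans _ _ (\sum_(u : V) e1 * n)); first exact: ler_sum.
  by rewrite sumr_const -[leLHS]mulr_natl expr2 mulrCA.
have Ps := cmg_sgraph P.
(* In the model, adding an edge inside a part costs [c2 * n ^+ k.-2]. All degrees in the difference
   are small, so deleting such an edge from [G] gains almost as much, more than the penalty for the
   two ordered pairs. *)
have no_inner x y : P x = P y -> (x, y) \notin G.
  move=> xy; have [->|nxy] := eqVneq x y; first by rewrite Gi.
  apply/negP => xyG; have gap := hV2 P (sized _ edt) x y nxy xy.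
  pose D := [set (x, y); (y, x)].
  have inD p : (p \in D) = (p == (x, y)) || (p == (y, x)) by rewrite !inE.
  have Dsym p1 p2 : ((p1, p2) \in D) = ((p2, p1) \in D).
    by rewrite !inD !xpair_eqE [X in X || _]andbC [X in _ || X]andbC orbC.
  have Di p1 : ((p1, p1) \in D) = false.
    rewrite inD !xpair_eqE; apply/negP => /orP[]/andP[/eqP h1 /eqP h2]; move: nxy; by rewrite -h1 -h2 eqxx.
  have As : sgraph (addedge (cmg P) x y).
    apply/sgraphP; split=> [z|z1 z2]; rewrite /addedge -/D ![_ \in _ :|: D]in_setU ?Di ?cmgE ?eqxx //.
    by rewrite Dsym eq_sym.
  have G's : sgraph (G :\: D).
    by apply/sgraphP; split=> [z|z1 z2]; rewrite !in_setD ?Gi ?andbF // Dsym Gsym.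
  have h1 := hGmax _ G's.
  have h2 : w0 * n ^+ k.-2 * #|gdiff (G :\: D) G|%:R <= w0 * n ^+ k.-2 * 2.
    rewrite ler_wpM2l ?mulr_ge0 ?(ltW nk2) // ler_nat.
    apply: (@leq_trans #|D|); last by rewrite cards2; case: (_ != _).
    apply: subset_leq_card; apply/subsetP => p; rewrite /gdiff inE in_setD.
    by case: (p \in D); rewrite //= eqxx.
  have subW p : p \in gdiff (cmg P) (G :\: D) :|: gdiff (addedge (cmg P) x y) G -> p \in gdiff G (cmg P).
    rewrite in_setU !in_gdiff /addedge -/D [_ \in _ :|: D]in_setU in_setD.
    have [|_] := boolP (p \in D); rewrite /= ?orbF; last by rewrite orbb eq_sym.
    by rewrite inD => /orP[]/eqP->; rewrite /= ?cmgE xy eqxx ?xyG // Gsym xyG.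
  have deg z : #|[set y0 | (z, y0) \in gdiff (cmg P) (G :\: D) :|: gdiff (addedge (cmg P) x y) G]|%:R <= e1 * n.
    apply: le_trans (typical z); rewrite ler_nat; apply: subset_leq_card; apply/subsetP => y0.
    by move=> h; rewrite in_set; apply: subW; move: h; rewrite in_set.
  have := @copies_pair_diff k r c V R (cmg P) (addedge (cmg P) x y) (G :\: D) G x y e1 nxy Ps As G's Gs (ltW e10) _ _ _ _ _ (deg x) (deg y).
  move=> h3; have {}h3 : (copies c (cmg P))%:R + (copies c G)%:R <= (copies c (addedge (cmg P) x y))%:R + (copies c (G :\: D))%:R + 2 * (K ^+ 4 * e1 * n ^+ k.-2).
    apply: h3.
    - by move=> p p1 p2; rewrite /addedge -/D in_setU inD (negbTE p1) (negbTE p2) /= orbF.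
    - by move=> p p1 p2; rewrite in_setD inD (negbTE p1) (negbTE p2).
    - by rewrite cmgE xy eqxx in_setD inD eqxx.
    - by rewrite xyG /addedge -/D in_setU inD eqxx orbT.
    - by apply: le_trans typW; rewrite ler_nat; apply: subset_leq_card; apply/subsetP.
  have : c2 * n ^+ k.-2 <= (2 * w0 + 2 * K ^+ 4 * e1) * n ^+ k.-2.
    rewrite mulrDl (_ : 2 * w0 * _ = w0 * n ^+ k.-2 * 2); last by ring.
    rewrite (_ : 2 * K ^+ 4 * e1 * _ = 2 * (K ^+ 4 * e1 * n ^+ k.-2)); last by ring.
    by move: h1 h2 h3 gap; clear -i1_big csurj r2 R; lra.
  by rewrite ler_pM2r //; move: w0c2 e1c2 c20; clear -i1_big csurj r2 R; lra.
exists P; split; first exact: sized.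
set D := (d / 2) ^+ k.-1 in e1d *.
have D0 : 0 < D by rewrite exprn_gt0 // divr_gt0.
have h6 : D / 2 * n ^+ k.-2 * #|gdiff G (cmg P)|%:R <= M%:R - (copies c G)%:R.
  (* The degree bound is doubled to make room for the [+ 1] in the hypothesis. *)
  have := @missing_pairs k r c V R i1 i1_big csurj r2 q P G M (2 * e1) (d / 2) rq Gs GM _ _ _ partP no_inner.
  rewrite -/D => h; have {}h : (D - K ^+ 2 * (2 * e1)) * n ^+ k.-1 * #|gdiff G (cmg P)|%:R <= n * (M%:R - (copies c G)%:R).
    apply: h; rewrite ?mulr_ge0 ?(ltW e10) ?invr_ge0 ?(ltW d0) //.
    - by move: e1d D0; clear -i1_big csurj r2 R; lra.
    - by move=> x; have := typical x; move: e1n; clear -i1_big csurj r2 R; lra.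
  rewrite -(ler_pM2l n0); apply: le_trans h; rewrite kE2.
  rewrite (_ : n * (D / 2 * n ^+ k.-2 * _) = D / 2 * (n * n ^+ k.-2 * #|gdiff G (cmg P)|%:R)); last by ring.
  rewrite -[leRHS]mulrA; apply: ler_wpM2r; first by rewrite !mulr_ge0.
  by move: e1d; clear -i1_big csurj r2 R; lra.
have := gdiff_tri G0 G (cmg P); rewrite [gdiff G0 G]gdiffC -(ler_nat R) natrD => h7.
have h8 : #|gdiff G G0|%:R * n ^+ k.-2 <= w0^-1 * (M%:R - (copies c G0)%:R).
  rewrite [leRHS]mulrC ler_pdivlMr // (_ : _ * w0 = w0 * n ^+ k.-2 * #|gdiff G G0|%:R); last by ring.
  move: hG NG; clear -i1_big csurj r2 R; lra.
have h9 : #|gdiff G (cmg P)|%:R * n ^+ k.-2 <= (D / 2)^-1 * (M%:R - (copies c G0)%:R).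
  rewrite [leRHS]mulrC ler_pdivlMr ?divr_gt0 //.
  rewrite (_ : _ * (D / 2) = D / 2 * n ^+ k.-2 * #|gdiff G (cmg P)|%:R); last by ring.
  apply: le_trans h6 _.
  have : (copies c G0)%:R <= (copies c G)%:R :> R by apply: le_trans hG; rewrite lerDl !mulr_ge0.
  clear -i1_big csurj r2 R; lra.
rewrite mulrDl; apply: le_trans (lerD h8 h9); by rewrite -mulrDl ler_wpM2r.
Qed.
End Local.

Section LocalStability.
Variables (k r : nat) (c : 'I_k -> 'I_r) (R : realFieldType).
Local Notation K := (k%:R : R).
Variables (i1 : 'I_r).
Hypotheses (i1_big : (2 <= #|[set i | c i == i1]|)%N) (csurj : forall j, exists i, c i = j)
  (r2 : (2 <= r)%N).

Lemma local_stability (d cV c2 t : R) (Q : nat) :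
  (2 < k)%N -> 0 < d -> 0 < cV -> 0 < c2 -> 0 < t ->
  exists eps delta C n0 : R, [/\ 0 < eps, 0 < delta, 0 < C & 0 < n0] /\
  forall (V : finType) q (P0 : V -> 'I_q) (M : nat),
  n0 <= #|V|%:R -> (q <= Q)%N -> (r <= q)%N ->
  (forall G : {set V * V}, sgraph G -> copies c G <= M)%N ->
  (forall j, d * #|V|%:R <= #|part P0 j|%:R) -> universal_gap c P0 cV ->
  (forall P : V -> 'I_q, #|[set x | P x != P0 x]|%:R <= t * #|V|%:R -> edge_gap c P c2) ->
  forall G : {set V * V}, sgraph G -> #|gdiff G (cmg P0)|%:R <= eps * #|V|%:R ^+ 2 ->
  M%:R <= (copies c G)%:R + delta * #|V|%:R ^+ k ->
  exists P : V -> 'I_q, #|[set x | P x != P0 x]|%:R <= t * #|V|%:R /\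
    #|gdiff G (cmg P)|%:R * #|V|%:R ^+ k.-2 <= C * (M%:R - (copies c G)%:R).
Proof.
move=> k2 d0 cV0 c20 t0.
have K0 : 0 < K by rewrite ltr0n (ltn_trans _ k2).
have h2 m : 0 <= 2 * K ^+ m by rewrite mulr_ge0 // exprn_ge0.
have dk : 0 < (d / 2) ^+ k.-1 / 2 by rewrite divr_gt0 // exprn_gt0 // divr_gt0.
have half x : 0 < x -> 0 < x / 2 by move=> x0; rewrite divr_gt0.
(* The order of choice matters: the degree bound [e1] depends on the gaps only, [eta] on [e1], the
   penalty [w0] on [eta], the radius [e] on both [eta] and [e1], and [delta] on the product of [w0]
   and [e]. The size of [V] comes last. *)
have [e1 [e10 /and3P[e1a e1b _]]] : exists x : R, 0 < x /\
    all (fun p => p.1 * x <= p.2) [:: (2 * K ^+ 4, c2 / 2); (2 * K ^+ 2, (d / 2) ^+ k.-1 / 2)].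
  by apply: small_exists; rewrite /=; repeat (apply/andP; split); rewrite ?h2 ?half ?div8 ?ler0n ?ler01 ?exprn_gt0 ?mulr_ge0 ?mulr_gt0 ?exprn_ge0 ?invr_gt0 ?ltr0n ?half ?ler0n.
have [eta [eta0 /and5P[eta_a eta_b eta_c eta_d _]]] : exists x : R, 0 < x /\
    all (fun p => p.1 * x <= p.2) [:: (2, d); (1, 1); (2 * K ^+ 2 * Q%:R, cV / 2); (Q%:R, e1 / 2)].
  by apply: small_exists; rewrite /=; repeat (apply/andP; split); rewrite ?h2 ?half ?div8 ?ler0n ?ler01 ?exprn_gt0 ?mulr_ge0 ?mulr_gt0 ?exprn_ge0 ?invr_gt0 ?ltr0n ?half ?ler0n.
have [g gE] : exists g, g = eta / 2 * ((eta / 2) ^+ k / 2) by eexists.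
have g0 : 0 < g by rewrite gE mulr_gt0 ?half ?exprn_gt0 ?half.
have div8 x m : 0 < x -> 0 < x / m.+1%:R :> R by move=> x0; rewrite divr_gt0.
have [w0 [w00 /and4P[w_a w_b w_c _]]] : exists x : R, 0 < x /\
    all (fun p => p.1 * x <= p.2) [:: (2, g / 8); (2, cV / 8); (2, c2 / 4)].
  by apply: small_exists; rewrite /=; repeat (apply/andP; split); rewrite ?h2 ?half ?div8 ?ler0n ?ler01 ?exprn_gt0 ?mulr_ge0 ?mulr_gt0 ?exprn_ge0 ?invr_gt0 ?ltr0n ?half ?ler0n.
have [e [e0 /and5P[e_a e_b e_c e_d /and3P[e_e e_f _]]]] : exists x : R, 0 < x /\
    all (fun p => p.1 * x <= p.2) [:: (2 * K ^+ 3, g / 8); (2 * K ^+ 3, cV / 8); (2 * K ^+ 2, g / 8);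
      (2, d * (e1 / 2)); (2, d * t); (2, d * (d / 2))].
  by apply: small_exists; rewrite /=; repeat (apply/andP; split); rewrite ?h2 ?half ?div8 ?ler0n ?ler01 ?exprn_gt0 ?mulr_ge0 ?mulr_gt0 ?exprn_ge0 ?invr_gt0 ?ltr0n ?half ?ler0n.
have [delta [delta0 /and3P[d_a d_b _]]] : exists x : R, 0 < x /\
    all (fun p => p.1 * x <= p.2) [:: (1, g / 8); (2, w0 * e)].
  by apply: small_exists; rewrite /=; repeat (apply/andP; split); rewrite ?h2 ?half ?div8 ?ler0n ?ler01 ?exprn_gt0 ?mulr_ge0 ?mulr_gt0 ?exprn_ge0 ?invr_gt0 ?ltr0n ?half ?ler0n.
have [e' [e'0 /andP[e'a _]]] : exists x : R, 0 < x /\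
    all (fun p => p.1 * x <= p.2) [:: (K ^+ 2, (eta / 2) ^+ k / 2)].
  by apply: small_exists; rewrite /=; repeat (apply/andP; split); rewrite ?h2 ?half ?div8 ?ler0n ?ler01 ?exprn_gt0 ?mulr_ge0 ?mulr_gt0 ?exprn_ge0 ?invr_gt0 ?ltr0n ?half ?ler0n.
have [n0 [n00 hn]] : exists x : R, 0 < x /\ forall y, x <= y ->
    all (fun p => p.2 <= p.1 * y) [:: (eta, 2); (e', 3); (e, 2); (e1, 1)].
  by apply: large_exists; rewrite /= eta0 e'0 e0 e10 !ler0n ler01.
exists (e / 2), delta, (w0^-1 + ((d / 2) ^+ k.-1 / 2)^-1), n0; split.
  by split=> //; [exact: half|rewrite addr_gt0 // invr_gt0].
move=> V q P0 M /hn/and5P[n1 n2 n3 n4 _] qQ rq GM hd hV1 hV2 G Gs hG hM.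
rewrite gE in w_a e_a e_c d_a.
have qQ' : q%:R <= Q%:R :> R by rewrite ler_nat.
apply: (@local_stability_estimate k r c R i1 i1_big csurj r2 V q P0 G M d cV c2 t eta e1 e delta w0 e') => //.
- by move: eta_b; rewrite mul1r.
- by apply: le_trans eta_c; rewrite ler_wpM2r ?(ltW eta0) // ler_wpM2l.
- by apply: le_trans eta_d; rewrite ler_wpM2r ?(ltW eta0).
- by move: d_a; rewrite mul1r.
Qed.
End LocalStability.

(** * From local to global stability *)

Section Path.
Variables (k r : nat) (c : 'I_k -> 'I_r) (V : finType).
Implicit Types (G H : {set V * V}).

Definition same_nb G x y := [forall w, ((x, w) \in G) == ((y, w) \in G)].
Definition twins G : nat := #|[set p | same_nb G p.1 p.2]|.
(* A Zykov step may keep the number of copies; it then increases the number of twins. *)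
Definition zykov_measure G : nat := (copies c G * (#|V| ^ 2).+1 + twins G)%N.

Lemma same_nbP G x y : reflect (forall w, ((x, w) \in G) = ((y, w) \in G)) (same_nb G x y).
Proof. by apply: (iffP forallP) => h w; [exact/eqP|rewrite h]. Qed.

(** There are at most [#|V| ^ 2] pairs of twins, so the measure is lexicographic. *)
Lemma copies_le_of_measure G G' : (zykov_measure G < zykov_measure G')%N -> (copies c G <= copies c G')%N.
Proof.
have tw : (twins G' <= #|V| ^ 2)%N by rewrite -mulnn -card_prod; exact: max_card.
rewrite /zykov_measure => h; rewrite leqNgt; apply/negP => lt.
have : (copies c G' * (#|V| ^ 2).+1 + (#|V| ^ 2).+1 <= copies c G * (#|V| ^ 2).+1)%N.
  by rewrite -mulSnr leq_mul2r lt orbT.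
move: h tw; lia.
Qed.

(** Twins avoiding [u] survive. The pairs through [u] numbered twice its old twin class minus 1;
    they become at least twice the class of [v] plus 1, as [u] joins that class. *)
Lemma twins_clone G u v : sgraph G -> u != v -> (u, v) \notin G -> ~~ same_nb G u v ->
  (twins G + 2 * #|[set y | same_nb G v y]| + 2 <=
   twins (clone G [set u; v] v) + 2 * #|[set y | same_nb G u y]|)%N.
Proof.
move=> /sgraphP[Gi Gs] uv nuv ntw; set G' := clone G _ v.
have nvu : (v, u) \notin G by rewrite Gs.
have G'u w : ((u, w) \in G') = ((v, w) \in G).
  rewrite inE /= !inE eqxx /= negb_or; have [->|] := eqVneq w u; first by rewrite (negbTE nvu).
  by have [->|] := eqVneq w v; rewrite // Gi.
have G's x y : x != u -> ((x, y) \in G') = if y == u then (x, v) \in G else (x, y) \in G.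
  move=> xu; rewrite inE /= !inE (negbTE xu) /= negb_or.
  have [->|xv] := eqVneq x v.
    have [->|yu] := eqVneq y u; first by rewrite Gi.
    by have [->|] := eqVneq y v; rewrite //= Gi.
  by have [|yu] := eqVneq y u; have [->|] := eqVneq y v.
pose T0 := [set p : V * V | [&& p.1 != u, p.2 != u & same_nb G p.1 p.2]].
have sub0 p : p \in T0 -> same_nb G' p.1 p.2.
  rewrite inE => /and3P[p1 p2 /same_nbP h]; apply/same_nbP => w; rewrite !G's //.
  by case: ifP.
have symG x y : same_nb G x y = same_nb G y x.
  by apply/same_nbP/same_nbP => h w; rewrite h.
have up : (twins G <= #|T0| + (2 * #|[set y | same_nb G u y]|).-1)%N.
  pose Su := [set y | same_nb G u y] :\ u.
  have cSu : #|[set y | same_nb G u y]| = #|Su|.+1.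
    by rewrite (cardsD1 u) inE (_ : same_nb G u u) //; apply/same_nbP.
  apply: (@leq_trans #|T0 :|: ((u, u) |: ([set (u, y) | y in Su] :|: [set (y, u) | y in Su]))|).
    apply: subset_leq_card; apply/subsetP => -[x y]; rewrite inE /= => h.
    rewrite in_setU [_ \in T0]inE /= h andbT in_setU1 in_setU.
    have [xu|xu] := eqVneq x u; have [yu|yu] := eqVneq y u => //=.
    - by rewrite xu yu eqxx.
    - by rewrite xu (imset_f (pair u)) ?orbT // !inE yu -xu.
    - by rewrite yu (imset_f (fun y => (y, u))) ?orbT // !inE xu symG -yu.
  apply: leq_trans (leq_card_setU _ _) _; rewrite leq_add2l cSu.
  apply: leq_trans (leq_card_setU _ _) _; rewrite cards1.
  apply: (@leq_trans (1 + (#|Su| + #|Su|))); last by lia.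
  rewrite leq_add2l; apply: leq_trans (leq_card_setU _ _) _.
  by apply: leq_add; exact: leq_imset_card.
have u0 : (0 < #|[set y | same_nb G u y]|)%N.
  by rewrite card_gt0; apply/set0Pn; exists u; rewrite inE; apply/same_nbP.
suff low : (#|T0| + 2 * #|[set y | same_nb G v y]| + 1 <= twins G')%N by lia.
pose Sv := [set y | same_nb G v y].
have uSv : u \notin Sv by rewrite inE symG.
have Svu y : y \in Sv -> y != u by move=> h; apply: contraNneq uSv => <-.
pose A1 := [set (u, y) | y in Sv]; pose A2 := [set (y, u) | y in Sv].
have c1 : #|A1| = #|Sv| by rewrite card_imset // => ? ? [].
have c2 : #|A2| = #|Sv| by rewrite card_imset // => ? ? [].
have d1 : [disjoint T0 & [set (u, u)]].
  by rewrite disjoint_sym disjoints1 inE eqxx.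
have d2 : [disjoint A1 & A2].
  apply/pred0P => -[x y] /=; apply/negP => /andP[/imsetP[y1 h1 [-> _]] /imsetP[y2 /Svu/eqP h2 [/esym h3 _]]].
  exact: h2 h3.
have d3 : [disjoint T0 :|: [set (u, u)] & A1 :|: A2].
  apply/pred0P => -[x y] /=; rewrite !in_setU; apply/negP => /andP[].
  move=> h /orP[]/imsetP[z /Svu zu [xz yz]]; move: h; rewrite !inE xz yz !eqxx ?andbF /=.
    by rewrite xpair_eqE (negbTE zu) andbF.
  by rewrite xpair_eqE (negbTE zu).
have -> : (#|T0| + 2 * #|Sv| + 1)%N = #|(T0 :|: [set (u, u)]) :|: (A1 :|: A2)|.
  rewrite cardsU (disjoint_setI0 d3) cards0 subn0 cardsU (disjoint_setI0 d1) cards0 subn0 cards1.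
  by rewrite cardsU (disjoint_setI0 d2) cards0 subn0 c1 c2 mul2n -addnn addnAC.
have twu y : y \in Sv -> same_nb G' u y.
  move=> ySv; apply/same_nbP => w; rewrite G'u G's ?Svu //.
  have h w' : ((v, w') \in G) = ((y, w') \in G) by apply/same_nbP; move: ySv; rewrite inE.
  have [->|_] := eqVneq w u; last exact: h.
  by rewrite -(h v) Gi (negbTE nvu).
have symG' x y : same_nb G' x y = same_nb G' y x.
  by apply/same_nbP/same_nbP => h w; rewrite h.
apply: subset_leq_card; apply/subsetP => -[x y].
move=> h; rewrite inE /=; move: h; rewrite !in_setU => /orP[/orP[/sub0 //|]|/orP[]].
- by rewrite in_set1 => /eqP[-> ->]; apply/same_nbP.
- by case/imsetP => z /twu zS [-> ->].
- by case/imsetP => z /twu zS [-> ->]; rewrite symG'.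
Qed.

(** Add up the two ways of cloning. The copies do not decrease on the sum, by [symmetrize_gain], and
    the class sizes cancel in [twins_clone], leaving a gain of 4. Hence one of the two clonings
    increases the measure strictly. *)
Lemma zykov_step G u v w : sgraph G -> (u, v) \notin G -> (v, w) \notin G -> (u, w) \in G ->
  exists G', [/\ sgraph G', (#|gdiff G' G| <= 2 * #|V|)%N & (zykov_measure G < zykov_measure G')%N].
Proof.
move=> Gs nuv nvw uw; have /sgraphP[Gi Gsym] := Gs.
have uv : u != v by apply: contraNneq nvw => <-.
have ntw : ~~ same_nb G u v.
  by apply/negP => /same_nbP/(_ w); rewrite uw (negbTE nvw).
have ntw' : ~~ same_nb G v u.
  by apply/negP => /same_nbP/(_ w); rewrite uw (negbTE nvw).
have Aind : {in [set u; v] &, forall x y, (x, y) \in G = false}.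
  move=> x y; rewrite !inE => /orP[]/eqP-> /orP[]/eqP->; rewrite ?Gi ?(negbTE nuv) //.
  by rewrite Gsym (negbTE nuv).
have uA : u \in [set u; v] by rewrite !inE eqxx.
have vA : v \in [set u; v] by rewrite !inE eqxx orbT.
have h1 := twins_clone Gs uv nuv ntw.
have h2 : (twins G + 2 * #|[set y | same_nb G u y]| + 2 <=
   twins (clone G [set u; v] u) + 2 * #|[set y | same_nb G v y]|)%N.
  have -> : [set u; v] = [set v; u] by rewrite setUC.
  by apply: twins_clone; rewrite // ?[v == u]eq_sym // Gsym.
have h3 : (2 * copies c G <= copies c (clone G [set u; v] u) + copies c (clone G [set u; v] v))%N.
  have := @symmetrize_gain k r c V G _ u Gs Aind uA; rewrite cards2 uv.
  rewrite (big_setD1 u) //= (_ : [set u; v] :\ u = [set v]) ?big_set1.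
    by apply: leq_trans; exact: leq_addr.
  by apply/setP => x; rewrite !inE; have [->|] := eqVneq x u; rewrite // (negbTE uv).
have : (zykov_measure G < zykov_measure (clone G [set u; v] u) \/ zykov_measure G < zykov_measure (clone G [set u; v] v))%N.
  have : (2 * zykov_measure G < zykov_measure (clone G [set u; v] u) + zykov_measure (clone G [set u; v] v))%N.
    by rewrite /zykov_measure; move: h1 h2 h3; move: (#|V| ^ 2)%N => N; clear; nia.
  lia.
have near (x x' : V) : [set u; v] = [set x; x'] -> ((x, x') \in G) = false ->
    (#|gdiff (clone G [set u; v] x) G| <= 2 * #|V|)%N.
  move=> -> _; apply: (@gdiff_off _ _ _ x') => a b ax' bx'; rewrite inE /= !inE (negbTE ax') (negbTE bx') !orbF.
  have [->|ax] := eqVneq a x; have [->|bx] := eqVneq b x; rewrite ?Gi //=.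
by case=> h; [exists (clone G [set u; v] u)|exists (clone G [set u; v] v)]; split=> //;
  rewrite ?clone_sgraph // ?(near u v) ?(near v u) // 1?setUC // ?(negbTE nuv) // Gsym (negbTE nuv).
Qed.

(** A graph is complete multipartite exactly when non-adjacency is transitive, and a failure of
    transitivity is the situation of [zykov_step]. In the transitive case [pick] selects the same
    representative for a whole class, since the predicates agree. *)
Lemma multipartite_or_step G : sgraph G ->
  (exists P : V -> V, G = cmg P) \/
  exists G', [/\ sgraph G', (#|gdiff G' G| <= 2 * #|V|)%N & (zykov_measure G < zykov_measure G')%N].
Proof.
move=> Gs; have /sgraphP[Gi Gsym] := Gs.
have [/existsP[u /existsP[v /existsP[w /and3P[h1 h2 h3]]]]|nbad] :=
    boolP [exists u, exists v, exists w, [&& (u, v) \notin G, (v, w) \notin G & (u, w) \in G]].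
  by right; exact: zykov_step h1 h2 h3.
have tr u v w : (u, v) \notin G -> (v, w) \notin G -> (u, w) \notin G.
  move=> h1 h2; apply: contra nbad => h3.
  by apply/existsP; exists u; apply/existsP; exists v; apply/existsP; exists w; rewrite h1 h2.
left; exists (fun x => odflt x [pick y | (x, y) \notin G]); apply/setP => -[x y]; rewrite cmgE.
have hx z : (z, odflt z [pick y | (z, y) \notin G]) \notin G.
  by case: pickP => [//|/(_ z)]; rewrite Gi.
have [xyG|xyG] := boolP ((x, y) \in G); apply/esym.
  apply: contraTneq xyG => e1; apply: (tr x _ y (hx x)); rewrite e1 Gsym; exact: hx.
apply/negbTE; rewrite negbK; apply/eqP.
have -> : [pick z | (x, z) \notin G] = [pick z | (y, z) \notin G].
  apply: eq_pick => z; apply/idP/idP; apply: tr => //; by rewrite Gsym.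
by case: pickP => [//|/(_ y)]; rewrite Gi.
Qed.

(** The path is followed upwards in the measure, which is bounded, and [Q] is pulled back along
    it. *)
Lemma path_induction (Q : {set V * V} -> Prop) (N0 : nat) :
  (forall G, sgraph G -> N0 <= copies c G -> Q G \/
    exists G', [/\ sgraph G', #|gdiff G' G| <= 2 * #|V| & zykov_measure G < zykov_measure G'])%N ->
  (forall G G', sgraph G -> sgraph G' -> N0 <= copies c G -> #|gdiff G' G| <= 2 * #|V| ->
     Q G' -> Q G)%N ->
  forall G, sgraph G -> (N0 <= copies c G)%N -> Q G.
Proof.
move=> hstep hback G.
pose B := (\max_(H : {set V * V}) zykov_measure H)%N.
elim: {G}(B - zykov_measure G)%N {-2}G (leqnn (B - zykov_measure G)%N) => [|m IH] G hm Gs hN.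
  have [//|[G' [_ _ lt]]] := hstep G Gs hN.
  have : (zykov_measure G' <= B)%N by exact: leq_bigmax.
  by move: hm lt; lia.
have [//|[G' [G's near lt]]] := hstep G Gs hN.
apply: (hback G G') => //; apply: IH => //; last exact: leq_trans hN (copies_le_of_measure lt).
have : (zykov_measure G' <= B)%N by exact: leq_bigmax.
by move: hm lt; lia.
Qed.

End Path.

Lemma cmg_relabel (V : finType) (L : eqType) (P : V -> L) : exists P' : V -> V, cmg P' = cmg P.
Proof.
exists (fun x => odflt x [pick y | P y == P x]); apply/setP => -[x y]; rewrite !cmgE.
have hx z : P (odflt z [pick y | P y == P z]) = P z.
  by case: pickP => [w /eqP //|/(_ z)]; rewrite eqxx.
congr (~~ _); apply/eqP/eqP => [e|->]; first by rewrite -(hx x) e hx.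
by case: pickP => [//|/(_ y)]; rewrite eqxx.
Qed.

(** * Backward induction along the path *)

Section Assembly.
Variables (k r : nat) (c : 'I_k -> 'I_r) (R : realFieldType).
Local Notation K := (k%:R : R).
Variables (i1 : 'I_r).
Hypotheses (i1_big : (2 <= #|[set i | c i == i1]|)%N) (csurj : forall j, exists i, c i = j)
  (r2 : (2 <= r)%N) (k2 : (2 < k)%N).

Definition extremal_bound (V : finType) (M : nat) :=
  forall G : {set V * V}, sgraph G -> (copies c G <= M)%N.

Definition near_extremal (V : finType) (M : nat) (delta : R) (G : {set V * V}) :=
  M%:R <= (copies c G)%:R + delta * #|V|%:R ^+ k.

Variable good : forall (V : finType) q, (V -> 'I_q) -> Prop.

Definition close_to_good (V : finType) (eps : R) (G : {set V * V}) :=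
  exists q (P0 : V -> 'I_q), good P0 /\ #|gdiff G (cmg P0)|%:R <= eps * #|V|%:R ^+ 2.

(** The first assumption makes local stability available around good partitions. The second starts
    the induction at multipartite graphs, with a further step as a way out. The third replaces the
    partition found by local stability, which is merely close to a good one, by a good one again. *)
Lemma stability_criterion (d cV c2 t n1 : R) (Q : nat) :
  0 < d -> 0 < cV -> 0 < c2 -> 0 < t ->
  (forall (V : finType) q (P0 : V -> 'I_q), n1 <= #|V|%:R -> good P0 ->
    [/\ (q <= Q)%N, (r <= q)%N, forall j, d * #|V|%:R <= #|part P0 j|%:R, universal_gap c P0 cV &
      forall P : V -> 'I_q, #|[set x | P x != P0 x]|%:R <= t * #|V|%:R -> edge_gap c P c2]) ->
  (forall eps : R, 0 < eps -> exists delta n0 : R, 0 < delta /\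
    forall (V : finType) M (P : V -> V), n0 <= #|V|%:R -> extremal_bound V M ->
      near_extremal M delta (cmg P) -> close_to_good eps (cmg P) \/
      exists G', [/\ sgraph G', #|gdiff G' (cmg P)| <= 2 * #|V| & zykov_measure c (cmg P) < zykov_measure c G']%N) ->
  (forall eps : R, 0 < eps -> exists delta n0 : R, 0 < delta /\
    forall (V : finType) M q (P0 P : V -> 'I_q), n0 <= #|V|%:R -> extremal_bound V M -> good P0 ->
      #|[set x | P x != P0 x]|%:R <= t * #|V|%:R ->
      near_extremal M delta (cmg P) -> close_to_good eps (cmg P)) ->
  exists C n0 : R, 0 < C /\ forall (V : finType) M (G : {set V * V}), n0 <= #|V|%:R ->
    extremal_bound V M -> sgraph G -> exists P : V -> V,
      #|gdiff G (cmg P)|%:R * #|V|%:R ^+ k.-2 <= C * (M%:R - (copies c G)%:R).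
Proof.
move=> d0 cV0 c20 t0 hgood hR1 hR2.
have [eps [dl [C [n2 [[eps0 dl0 C0 n20] hloc]]]]] := local_stability i1_big csurj r2 Q k2 d0 cV0 c20 t0.
have eps20 : 0 < eps / 2 by rewrite divr_gt0.
have eps40 : 0 < eps / 4 by rewrite divr_gt0.
have [d1 [n3 [d10 h1]]] := hR1 _ eps20.
have [d2 [n4 [d20 h2]]] := hR2 _ eps40.
(* The recovered multipartite graph is within [C * delta * n ^+ 2] of the given one, so by
   [copies_lip] its defect density is at most [(1 + K ^+ 2 * C) * delta]; the last condition bounds
   that distance. *)
have [delta [delta0 /and5P[e1 e2 e3 e4 _]]] : exists x : R, 0 < x /\
    all (fun p => p.1 * x <= p.2) [:: (1, dl); (1, d1); (1 + K ^+ 2 * C, d2); (C, eps / 4)].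
  apply: small_exists; rewrite /= dl0 d10 d20 eps40 ler01 (ltW C0) andbT /= addr_ge0 //.
  by rewrite mulr_ge0 ?exprn_ge0 // ltW.
rewrite !mul1r in e1 e2.
have [n5 [n50 hn5]] : exists x : R, 0 < x /\ forall y, x <= y ->
    all (fun p => p.2 <= p.1 * y) [:: (eps / 2, 2); (1, 1)].
  by apply: large_exists; rewrite /= eps20 ltr01 ler01 ler0n.
pose n0 := Num.max n1 (Num.max n2 (Num.max n3 (Num.max n4 n5))).
exists (C + delta^-1), n0; split; first by rewrite addr_gt0 ?invr_gt0.
move=> V M G; rewrite !ge_max => /and5P[hn1 hn2 hn3 hn4 /hn5/and3P[hn6 hn7 _]] GM Gs.
rewrite mul1r in hn7.
set n := #|V|%:R : R; have n0' : 0 < n by apply: lt_le_trans hn7.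
have kE1 : n ^+ k = n ^+ 2 * n ^+ k.-2 by rewrite -exprD; congr (_ ^+ _); case: k k2 => [|[|]].
have nk2 : 0 < n ^+ k.-2 by rewrite exprn_gt0.
have NG (H : {set V * V}) : sgraph H -> (copies c H)%:R <= M%:R :> R by move=> Hs; rewrite ler_nat; exact: GM.
have local (H : {set V * V}) : sgraph H -> near_extremal M delta H -> close_to_good eps H ->
    exists q (P0 P : V -> 'I_q), [/\ good P0, #|[set x | P x != P0 x]|%:R <= t * n &
      #|gdiff H (cmg P)|%:R * n ^+ k.-2 <= C * (M%:R - (copies c H)%:R)].
  move=> Hs hH [q [P0 [gP0 hP0]]]; have [qQ rq hd hV1 hV2] := hgood _ _ _ hn1 gP0.
  have hM : M%:R <= (copies c H)%:R + dl * n ^+ k.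
    by apply: le_trans hH _; rewrite lerD2l ler_wpM2r // exprn_ge0.
  have [P [hP hPC]] := hloc V q P0 M hn2 qQ rq GM hd hV1 hV2 H Hs hP0 hM.
  by exists q, P0, P.
have [far|hG] := ltP ((copies c G)%:R + delta * n ^+ k) M%:R.
  (* If the defect exceeds [delta * n ^+ k], any multipartite graph will do, since a distance is at
     most [n ^+ 2]. *)
  exists id; apply: (@le_trans _ _ (n ^+ k)).
    rewrite kE1 ler_wpM2r ?(ltW nk2) // /n -natrX ler_nat -mulnn -card_prod; exact: max_card.
  apply: (@le_trans _ _ (delta^-1 * (M%:R - (copies c G)%:R))).
    rewrite [leRHS]mulrC ler_pdivlMr // mulrC; move: far; clear -i1_big csurj r2 k2 R; lra.
  by rewrite ler_wpM2r ?lerDr ?(ltW C0) // subr_ge0 NG.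
have back (H : {set V * V}) : sgraph H -> near_extremal M delta H -> close_to_good eps H ->
    exists q (P0 P : V -> 'I_q), [/\ good P0, #|[set x | P x != P0 x]|%:R <= t * n,
      near_extremal M d2 (cmg P) & #|gdiff H (cmg P)|%:R <= eps / 4 * n ^+ 2].
  move=> Hs hH /(local _ Hs hH)[q [P0 [P [gP0 hP hd]]]]; exists q, P0, P.
  have hC : #|gdiff H (cmg P)|%:R <= C * delta * n ^+ 2.
    rewrite -(ler_pM2r nk2); apply: le_trans hd _; rewrite (_ : _ * _ * _ * _ = C * (delta * n ^+ k)); last by rewrite kE1; ring.
    rewrite ler_wpM2l ?(ltW C0) //.
    by move: hH; rewrite /near_extremal; clear -i1_big csurj r2 k2 R; lra.
  split=> //; last by apply: le_trans hC _; rewrite ler_wpM2r ?exprn_ge0.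
  have Cd0 : 0 <= C * delta by rewrite mulr_ge0 // ltW.
  have h3 := copies_lip c Hs (cmg_sgraph P) Cd0 hC.
  have h4 : (1 + K ^+ 2 * C) * delta * n ^+ k <= d2 * n ^+ k by rewrite ler_wpM2r ?exprn_ge0.
  move: hH h3 h4; rewrite /near_extremal -/n; clear -i1_big csurj r2 k2 R; lra.
have weaken (H : {set V * V}) (x y : R) : x <= y -> close_to_good x H -> close_to_good y H.
  move=> xy [q [P0 [gP0 h]]]; exists q, P0; split=> //; apply: le_trans h _.
  by rewrite ler_wpM2r ?exprn_ge0.
suff cl : close_to_good (eps / 2) G.
  have epsle : eps / 2 <= eps by rewrite ler_pdivrMr // ler_peMr ?(ltW eps0) // ler1n.
  have [q [P0 [P [_ _ hP]]]] := local _ Gs hG (weaken _ _ _ epsle cl).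
  have [P' eP'] := cmg_relabel P; exists P'; rewrite eP'; apply: le_trans hP _.
  by rewrite ler_wpM2r ?lerDl ?invr_ge0 ?(ltW delta0) // subr_ge0 NG.
have nE (H : {set V * V}) : (copies c G <= copies c H)%N -> near_extremal M delta H.
  by move=> h; apply: le_trans hG _; rewrite lerD2r ler_nat.
apply: (@path_induction k r c V (close_to_good (eps / 2)) (copies c G)) => // [H Hs hN|H H' Hs H's hN hnear [q [P0 [gP0 hP0]]]].
  have [[P eH]|//] := multipartite_or_step c Hs; last by right.
  subst H.
  have h : near_extremal M d1 (cmg P).
    have := nE _ hN; rewrite /near_extremal => h; apply: le_trans h _.
    by rewrite lerD2l ler_wpM2r ?exprn_ge0.
  have [?|[G' hG']] := h1 V M P hn3 GM h; first by left.
  by right; exists G'.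
(* Undoing a step enlarges the radius from [eps / 2] to [eps] at most. Local stability and the
   return to a good partition then cost [eps / 4] each, which restores [eps / 2]. *)
have hH : close_to_good eps H.
  exists q, P0; split=> //; have := gdiff_tri H H' (cmg P0); rewrite [gdiff H H']gdiffC.
  rewrite -(ler_nat R) natrD => h3; apply: le_trans h3 _.
  have h4 : #|gdiff H' H|%:R <= 2 * n by rewrite /n -natrM ler_nat.
  have h5 : 2 * n <= eps / 2 * n ^+ 2 by rewrite expr2 mulrA ler_wpM2r // ltW.
  rewrite (_ : eps * n ^+ 2 = eps / 2 * n ^+ 2 + eps / 2 * n ^+ 2); last by field.
  by move: h4 h5 hP0; rewrite -/n; clear -i1_big csurj r2 k2 R; lra.
have [q1 [P1 [P2 [gP1 hP1 hN2 hd2]]]] := back _ Hs (nE _ hN) hH.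
have [q3 [P3 [gP3 hP3]]] := h2 V M q1 P1 P2 hn4 GM gP1 hP1 hN2.
exists q3, P3; split=> //; have := gdiff_tri H (cmg P2) (cmg P3); rewrite -(ler_nat R) natrD => h3.
apply: le_trans h3 _; rewrite (_ : eps / 2 = eps / 4 + eps / 4); last by field.
by rewrite mulrDl lerD.
Qed.
End Assembly.

(** * Lower bounds from multipartite graphs *)

Lemma balanced_colouring (V : finType) q : (0 < q)%N ->
  exists P : V -> 'I_q, forall j, (#|V| %/ q <= #|part P j|)%N.
Proof.
move=> q0; exists (fun x => Ordinal (ltn_pmod (enum_rank x) q0)) => j.
have lt (t : 'I_(#|V| %/ q)) : (t * q + j < #|V|)%N.
  apply: (@leq_trans ((t.+1) * q)); first by rewrite mulSn addnC ltn_add2r.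
  by apply: leq_trans (leq_trunc_div #|V| q); rewrite leq_mul2r ltn_ord orbT.
rewrite -[X in (X <= _)%N]card_ord -(@card_imset _ _ (fun t => enum_val (Ordinal (lt t)))); last first.
  move=> t t' /enum_val_inj [] /eqP; rewrite eqn_add2r eqn_pmul2r // => /eqP ?; exact: val_inj.
apply: subset_leq_card; apply/subsetP => x /imsetP[t _ ->]; rewrite inE enum_valK.
by apply/eqP/val_inj; rewrite /= modnMDl modn_small.
Qed.

Section Bounds.
Variables (k r : nat) (c : 'I_k -> 'I_r) (R : realFieldType).
Local Notation K := (k%:R : R).

(** In a multipartite graph only the diagonal is forbidden, so [many_copies] applies with [e] equal
    to the inverse of [#|V|]. *)
Lemma many_copies_exact (V : finType) (L : eqType) (P : V -> L) (pi : 'I_r -> L)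
    (Z : {set 'I_k}) (z : {ffun 'I_k -> V}) (Y : 'I_k -> {set V}) (d : R) :
  injective pi -> 0 <= d -> 0 < #|V|%:R :> R ->
  (forall i, i \in Z -> P (z i) = pi (c i)) ->
  (forall i j, i \in Z -> j \in Z -> i != j -> z i != z j) ->
  (forall i, i \notin Z -> d * #|V|%:R <= #|Y i|%:R) ->
  (forall i x, i \notin Z -> x \in Y i -> P x = pi (c i)) ->
  K ^+ 2 <= d ^+ #|~: Z| / 2 * #|V|%:R ->
  d ^+ #|~: Z| / 2 * #|V|%:R ^+ #|~: Z| <=
  #|[set f | [&& pinned Z z f, [forall i, (i \notin Z) ==> (f i \in Y i)] & copy c (cmg P) f]]|%:R.
Proof.
move=> pinj d0 n0 hz hzz hY hYP hK.
have h := @many_copies k r c V R L (cmg P) set0 setT P pi Z z Y (#|V|%:R)^-1 d (cmg_sgraph P) pinj.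
apply: le_trans (h _ d0 _ _ _ _ _ _ hY _) => //.
- rewrite ler_wpM2r ?exprn_ge0 //.
  have : K ^+ 2 * #|V|%:R^-1 <= d ^+ #|~: Z| / 2 by rewrite ler_pdivrMr.
  clear; lra.
- by rewrite invr_ge0 ltW.
- by move=> x y _ _ _ _; rewrite cmgE.
- by rewrite cards0 add0r expr2 mulrA mulVf ?mul1r // gt_eqF.
- move=> i _; rewrite (_ : [set y | _] = set0) ?cards0 ?add0r ?mulVf // ?gt_eqF //.
  by apply/setP => y; rewrite !inE.
- move=> i _; rewrite (_ : [set y | _] = set0) ?cards0 ?add0r ?mulVf // ?gt_eqF //.
  by apply/setP => y; rewrite !inE.
- by move=> i iZ; rewrite inE hz.
- by move=> i j iZ jZ ij; rewrite hzz // inE.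
- by move=> i x iZ xY; rewrite inE (hYP i).
Qed.

Lemma multipartite_lower q (d : R) : (0 < k)%N -> (r <= q)%N -> 0 < d ->
  exists n0 : R, 0 < n0 /\ forall (V : finType) (P : V -> 'I_q), n0 <= #|V|%:R ->
  (forall j, d * #|V|%:R <= #|part P j|%:R) -> d ^+ k / 2 * #|V|%:R ^+ k <= (copies c (cmg P))%:R.
Proof.
move=> k0 rq d0; have dk : 0 < d ^+ k / 2 by rewrite divr_gt0 // exprn_gt0.
have [n0 [n00 hn]] : exists x : R, 0 < x /\ forall y, x <= y ->
    all (fun p => p.2 <= p.1 * y) [:: (d ^+ k / 2, K ^+ 2); (1, 1)].
  by apply: large_exists; rewrite /= dk ltr01 ler01 exprn_ge0.
exists n0; split=> // V P /hn/and3P[h1 h2 _] hP; rewrite mul1r in h2.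
have nV : 0 < #|V|%:R :> R by apply: lt_le_trans h2.
have [x0 _] : exists x0, x0 \in [set: V].
  by apply/set0Pn; rewrite -card_gt0 cardsT -(ltr0n R).
pose pi l := widen_ord rq l.
have pinj : injective pi by move=> x y /(congr1 val) /= ?; exact: val_inj.
have := @many_copies_exact V _ P pi set0 [ffun=> x0] (fun i => part P (pi (c i))) d pinj (ltW d0) nV.
rewrite setC0 cardsT card_ord => h; apply: le_trans (h _ _ _ _ h1) _ => //.
- by move=> i; rewrite inE.
- by move=> i j; rewrite inE.
- by move=> i x _; rewrite inE => /eqP.
rewrite ler_nat; apply: subset_leq_card; apply/subsetP => f; rewrite !inE.
by move=> /and3P[].
Qed.

Lemma extremal_lower : (0 < k)%N -> (0 < r)%N -> exists cM n0 : R, 0 < cM /\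
  forall (V : finType) M, n0 <= #|V|%:R -> extremal_bound c V M -> cM * #|V|%:R ^+ k <= M%:R.
Proof.
(* A balanced [r]-partite graph is the witness; the factor 2 in [d] absorbs the rounding of the part
   sizes. *)
move=> k0 r0; pose d : R := (2 * r%:R)^-1.
have r0' : 0 < r%:R :> R by rewrite ltr0n.
have d0 : 0 < d by rewrite invr_gt0 mulr_gt0.
have [n0 [n00 hn]] := multipartite_lower k0 (leqnn r) d0.
exists (d ^+ k / 2), (Num.max n0 (2 * r%:R)); split; first by rewrite divr_gt0 // exprn_gt0.
move=> V M; rewrite ge_max => /andP[h1 h2] GM.
have [P hP] := balanced_colouring V r0.
apply: le_trans (hn V P h1 _) _; last by rewrite ler_nat; apply: GM; exact: cmg_sgraph.
move=> j; apply: (@le_trans _ _ (#|V| %/ r)%:R); last by rewrite ler_nat.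
have : (#|V| < (#|V| %/ r).+1 * r)%N by rewrite ltn_ceil.
rewrite -(ltr_nat R) natrM -natr1 => h.
have : d * #|V|%:R * (2 * r%:R) = #|V|%:R by rewrite /d; field; rewrite gt_eqF.
move=> e1; rewrite -(ler_pM2r (_ : 0 < 2 * r%:R)) ?mulr_gt0 // e1.
move: h h2; set x := (#|V| %/ r)%:R; set m := #|V|%:R; set y := r%:R; clear; lra.
Qed.

End Bounds.

(** * Graphs F without parts of size one *)

Definition recolour (V : eqType) (L : Type) (P : V -> L) u (l : L) x := if x == u then l else P x.

Lemma gdiff_colourings (V : finType) (L : eqType) (P P' : V -> L) :
  (#|gdiff (cmg P) (cmg P')| <= 2 * #|V| * #|[set x | P' x != P x]|)%N.
Proof.
set S := [set x | _].
apply: (@leq_trans #|setX S setT :|: setX setT S|).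
  apply: subset_leq_card; apply/subsetP => -[x y]; rewrite in_gdiff !cmgE !inE andbT /=.
  apply: contraR; rewrite negb_or !negbK => /andP[/eqP -> /eqP ->]; by rewrite eqxx.
by apply: leq_trans (leq_card_setU _ _) _; rewrite !cardsX cardsT; lia.
Qed.

Lemma setnb_recolour (V : finType) (L : eqType) (P : V -> L) u j :
  setnb (cmg P) u [set y | P y != j] = cmg (recolour P u j).
Proof.
apply/setP => -[x y]; rewrite cmgE /recolour !inE /=.
have [_|] := eqVneq x u; have [_|] := eqVneq y u => //=; rewrite ?eqxx //.
by move=> _; rewrite eq_sym.
Qed.

Section Through.
Variables (k r : nat) (c : 'I_k -> 'I_r) (R : realFieldType).
Local Notation K := (k%:R : R).

Definition through (V : finType) (G : {set V * V}) (u : V) : nat :=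
  #|[set f | copy c G f && [exists i, f i == u]]|.
Definition avoiding (V : finType) (G : {set V * V}) (u : V) : nat :=
  #|[set f | copy c G f && [forall i, f i != u]]|.

Lemma copies_split (V : finType) (G : {set V * V}) u :
  copies c G = (avoiding G u + through G u)%N.
Proof.
rewrite /copies -(cardsID [set f : {ffun 'I_k -> V} | [exists i, f i == u]]) addnC.
by congr (_ + _)%N; apply: eq_card => f; rewrite !inE // negb_exists andbC.
Qed.

Lemma avoiding_agree (V : finType) (G G' : {set V * V}) u :
  (forall x y, x != u -> y != u -> ((x, y) \in G) = ((x, y) \in G')) ->
  avoiding G u = avoiding G' u.
Proof.
move=> h; apply: eq_card => f; rewrite !inE.
have [/forallP fu|] := boolP [forall i, f i != u]; rewrite ?andbF // !andbT.
by apply/copyP/copyP => -[fi fG]; split=> // i j; rewrite -fG h.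
Qed.

Lemma sum_through (V : finType) (G : {set V * V}) :
  (\sum_u through G u = k * copies c G)%N.
Proof.
transitivity (\sum_(f | copy c G f) \sum_(u | [exists i, f i == u]) 1)%N.
  rewrite (exchange_big_dep predT) //=; apply: eq_bigr => u _.
  by rewrite sum1_card; apply: eq_card => f; rewrite inE.
rewrite (eq_bigr (fun=> k)) => [|f /copyP[fi _]].
  by rewrite sum_nat_const mulnC; congr (_ * _)%N; apply: eq_card => f; rewrite inE.
rewrite sum1_card -[RHS]card_ord -(card_codom fi); apply: eq_card => u.
by rewrite [in LHS]unfold_in; apply/existsP/codomP => [[i /eqP]|[i ->]]; exists i.
Qed.

(** Let [u] become a clone of [v]. The copies through [u] are lost, and each copy through [v] but
    not [u] gives one through the new [u] by exchanging the two vertices. Copies through both are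
    bounded by those through [u], whence the factor 2. *)
Lemma clone_vertex (V : finType) (L : eqType) (P : V -> L) u v :
  (copies c (cmg P) + through (cmg P) v <=
   copies c (cmg (recolour P u (P v))) + 2 * through (cmg P) u)%N.
Proof.
set P' := recolour _ _ _.
have h1 : avoiding (cmg P) u = avoiding (cmg P') u.
  by apply: avoiding_agree => x y xu yu; rewrite !cmgE /P' /recolour (negbTE xu) (negbTE yu).
suff h2 : (through (cmg P) v <= through (cmg P') u + through (cmg P) u)%N.
  by rewrite (copies_split (cmg P) u) (copies_split (cmg P') u); move: h1 h2; lia.
have [->|uv] := eqVneq u v; first exact: leq_addl.
pose sw (f : {ffun 'I_k -> V}) : {ffun 'I_k -> V} := [ffun i => tperm u v (f i)].
have swinj : injective sw.
  by move=> f g /ffunP e; apply/ffunP => i; have := e i; rewrite !ffunE => /perm_inj.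
pose Tv := [set f | copy c (cmg P) f && [exists i, f i == v]]; pose Tu := [set f | copy c (cmg P) f && [exists i, f i == u]].
rewrite /through -/Tv -/Tu -(cardsID Tu Tv) addnC; apply: leq_add; last by rewrite subset_leq_card // subsetIr.
rewrite -(card_imset _ swinj); apply: subset_leq_card; apply/subsetP => g /imsetP[f].
rewrite !inE => /andP[nu /andP[fc /existsP[i0 /eqP fv]]] ->.
have fu i : f i != u by apply: contra nu => h; rewrite fc; apply/existsP; exists i.
have e i : P' (sw f i) = P (f i).
  rewrite /P' /recolour ffunE; have [->|fiv] := eqVneq (f i) v; first by rewrite tpermR eqxx.
  have fui : u != f i by rewrite eq_sym.
  have fvi : v != f i by rewrite eq_sym.
  by rewrite tpermD // (negbTE (fu i)).
apply/andP; split; last by apply/existsP; exists i0; rewrite ffunE fv tpermR.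
move: fc => /copyP[fi fG]; apply/copyP; split=> [i j|i j]; last by rewrite cmgE !e -cmgE fG.
by rewrite !ffunE => /perm_inj /fi.
Qed.

Lemma through_max (V : finType) (G : {set V * V}) : (0 < #|V|)%N ->
  exists v, (k * copies c G <= #|V| * through G v)%N.
Proof.
move=> V0; apply/existsP; rewrite -[[exists _, _]]negbK negb_exists; apply/negP => /forallP h.
have : (\sum_(v : V) #|V| * through G v < \sum_(v : V) k * copies c G)%N.
  have [v0 _] : exists v0, v0 \in [set: V] by apply/set0Pn; rewrite -card_gt0 cardsT.
  rewrite (bigD1 v0) //= [ltnRHS](bigD1 v0) //=; rewrite -addSn leq_add // 1?ltnNge //.
  by apply: leq_sum => v _; rewrite ltnW // ltnNge.
by rewrite -big_distrr /= sum_through sum_nat_const ltnn.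
Qed.

End Through.

Lemma cmg_surjective (V L : finType) (P : V -> L) : exists q (P0 : V -> 'I_q),
  cmg P0 = cmg P /\ forall j, (0 < #|part P0 j|)%N.
Proof.
case: (pickP V) => [x0 _|noV]; last first.
  have P0 (x : V) : 'I_0 by have := noV x.
  by exists 0%N, P0; split=> [|[]//]; apply/setP => -[x]; have := noV x.
pose S := [set P x | x : V].
have memS x : P x \in S by exact: imset_f.
exists #|S|, (fun x => enum_rank_in (memS x0) (P x)); split.
  apply/setP => -[x y]; rewrite !cmgE; congr (~~ _); apply/eqP/eqP => [|-> //].
  by move=> /(congr1 enum_val); rewrite !enum_rankK_in.
move=> j; have /imsetP[x _ ex] := enum_valP j; apply/card_gt0P; exists x.
by rewrite inE -ex enum_valK_in.
Qed.

(** The penalised maximisation of [ekeland], this time over colourings, so that the maximiser stays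
    multipartite and the penalty counts recoloured vertices. *)
Lemma colouring_ekeland (R : realFieldType) (k r : nat) (c : 'I_k -> 'I_r) (V L : finType) (P : V -> L) (w : R) : 0 <= w ->
  exists P' : V -> L,
    (copies c (cmg P))%:R + w * #|[set x | P' x != P x]|%:R <= (copies c (cmg P'))%:R /\
    forall x l, (copies c (cmg (recolour P' x l)))%:R <= (copies c (cmg P'))%:R + w.
Proof.
move=> w0; have [P' [_ hP']] := finite_max (Q := predT) (fun P' : {ffun V -> L} =>
   (copies c (cmg P'))%:R - w * #|[set x | P' x != P x]|%:R) (x0 := finfun P) isT.
exists P'; split=> [|x l].
  have e1 : cmg (finfun P) = cmg P by apply/setP => p; rewrite !inE !ffunE.
  have := hP' (finfun P) isT; rewrite e1 (_ : [set x | finfun P x != P x] = set0); last first.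
    by apply/setP => x; rewrite !inE ffunE eqxx.
  by rewrite cards0 mulr0 subr0 lerBrDr.
have e2 : cmg (finfun (recolour P' x l)) = cmg (recolour P' x l) by apply/setP => p; rewrite !inE !ffunE.
have := hP' (finfun (recolour P' x l)) isT; rewrite e2.
have : w * #|[set y | finfun (recolour P' x l) y != P y]|%:R <= w * (1 + #|[set y | P' y != P y]|%:R).
  rewrite ler_wpM2l // nat1r ler_nat.
  apply: (@leq_trans #|x |: [set y | P' y != P y]|); last by rewrite cardsU1; case: (_ \notin _).
  by apply: subset_leq_card; apply/subsetP => y; rewrite !inE ffunE /recolour; have [|] := eqVneq y x.
rewrite mulrDr mulr1; move: (w * _) (w * _) (copies _ _)%:R (copies _ _)%:R => *; lra.
Qed.

Section NoSingletons.
Variables (k r : nat) (c : 'I_k -> 'I_r) (R : archiRealFieldType).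
Local Notation K := (k%:R : R).
Variables (i1 : 'I_r).
Hypotheses (i1_big : (2 <= #|[set i | c i == i1]|)%N) (csurj : forall j, exists i, c i = j)
  (r2 : (2 <= r)%N) (k2 : (2 < k)%N) (twin : forall i, exists i', i' != i /\ c i' = c i).

(** A universal vertex lies in no copy at all, because every vertex of [F] has a non-adjacent twin.
    As a member of a part it lies in [n ^+ k.-1] copies up to a constant. *)
Lemma nosingle_universal (V : finType) q (P : V -> 'I_q) (d : R) :
  (r <= q)%N -> 0 < d -> (forall j, d * #|V|%:R <= #|part P j|%:R) ->
  2 <= d * #|V|%:R -> K ^+ 2 <= (d / 2) ^+ k.-1 / 2 * #|V|%:R ->
  universal_gap c P ((d / 2) ^+ k.-1 / 2).
Proof.
move=> rq d0 hP dn hK u.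
have [i0 ci0] := csurj i1.
have [pi [pinj pi0]] := inj_through1 i1 (widen_ord rq i1) rq.
pose j := pi i1; exists j.
have n0 : 0 < #|V|%:R :> R by rewrite -(pmulr_rgt0 _ d0); apply: lt_le_trans dn.
have h1 : (copies c (setnb (cmg P) u setT) <= avoiding c (cmg P) u)%N.
  apply: subset_leq_card; apply/subsetP => f; rewrite !inE => fc.
  have fu i : f i != u.
    apply/eqP => fi; have [i' [ii' ci']] := twin i; move/copyP: fc => [finj fG].
    have := fG i i'; rewrite ci' eqxx fi setnb_at inE andbT -fi.
    by rewrite (inj_eq finj) (negbTE ii').
  apply/andP; split; last exact/forallP.
  by move/copyP: fc => [finj fG]; apply/copyP; split=> // i i'; rewrite -fG setnb_off.
rewrite setnb_recolour (copies_split c (cmg (recolour P u j)) u) natrD.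
have -> : avoiding c (cmg (recolour P u j)) u = avoiding c (cmg P) u.
  by apply: avoiding_agree => x y xu yu; rewrite !cmgE /recolour (negbTE xu) (negbTE yu).
apply: lerD; first by rewrite ler_nat.
pose Y i := part P (pi (c i)) :\ u.
have d20 : 0 <= d / 2 by rewrite divr_ge0 // ltW.
have := @many_copies_exact k r c R V _ (recolour P u j) pi [set i0] [ffun=> u] Y (d / 2) pinj d20 n0.
rewrite cardsC1 card_ord => h; apply: le_trans (h _ _ _ _ hK) _ => {h}.
- by move=> i; rewrite inE => /eqP ->; rewrite ffunE /recolour eqxx ci0.
- by move=> i i'; rewrite !inE => /eqP -> /eqP ->; rewrite eqxx.
- move=> i _; have := card_del R (part P (pi (c i))) u; have := hP (pi (c i)).
  rewrite -/(Y i); move: dn (#|Y i|%:R) (#|part _ _|%:R); set m := #|V|%:R => dn x y.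
  rewrite (_ : d / 2 * m = d * m / 2); last by ring.
  by move: (d * m) dn => dm; clear -i1_big csurj r2 k2 twin R; lra.
- by move=> i x _; rewrite !inE /recolour => /andP[/negbTE -> /eqP].
rewrite ler_nat; apply: subset_leq_card; apply/subsetP => f; rewrite !inE.
move=> /and3P[/pinnedP pf _ ->]; apply/existsP; exists i0; by rewrite pf ?inE // ffunE.
Qed.

(** A copy using the new edge [u v] contains a twin of [u], which must lie in the common part of [u]
    and [v] and so is not joined to [v], although its colour requires this. Hence no copy contains
    both ends after the addition; before, there were those with [u] and [v] in class [i1]. *)
Lemma nosingle_edge (V : finType) q (P : V -> 'I_q) (d : R) :
  (r <= q)%N -> 0 < d -> (forall j, d * #|V|%:R <= #|part P j|%:R) ->
  4 <= d * #|V|%:R -> K ^+ 2 <= (d / 2) ^+ k.-2 / 2 * #|V|%:R ->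
  edge_gap c P ((d / 2) ^+ k.-2 / 2).
Proof.
move=> rq d0 hP dn hK u v uv Puv.
have [i0 [i0' [ci0 ci0' ii]]] : exists i i', [/\ c i = i1, c i' = i1 & i != i'].
  by move: i1_big => /card_gt1P[x [y]]; rewrite !inE => -[/eqP ? /eqP ? ?]; exists x, y.
have [pi [pinj pi0]] := inj_through1 i1 (P u) rq.
have n0 : 0 < #|V|%:R :> R by rewrite -(pmulr_rgt0 _ d0); apply: lt_le_trans dn.
pose S := [set f | copy c (cmg P) f & [exists i, f i == u] && [exists i, f i == v]].
have h1 : (copies c (addedge (cmg P) u v) <= #|[set f | copy c (cmg P) f] :\: S|)%N.
  apply: subset_leq_card; apply/subsetP => f; rewrite in_setD !inE => fc.
  have /copyP[finj fG] := fc.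
  have inA x y : ((x, y) \in addedge (cmg P) u v) = (P x != P y) || ((x, y) == (u, v)) || ((x, y) == (v, u)).
    by rewrite !inE orbA.
  have noboth i i' : f i = u -> f i' = v -> False.
    move=> fi fi'; have cc : c i != c i' by rewrite -fG fi fi' inA eqxx orbT.
    have [l [li cl]] := twin i.
    have flu : f l != u by rewrite -fi (inj_eq finj).
    have h3 : (f l, f i') \in addedge (cmg P) u v by rewrite fG cl.
    have h4 : (f l, f i) \in addedge (cmg P) u v = false by rewrite fG cl eqxx.
    move: h4 => /negbT; rewrite inA fi Puv !negb_or negbK => /andP[/andP[/eqP e1 _] _].
    by move: h3; rewrite inA fi' e1 eqxx !xpair_eqE (negbTE flu) [v == u]eq_sym (negbTE uv) andbF.
  have fc' : copy c (cmg P) f.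
    apply/copyP; split=> // i i'; rewrite -fG inA cmgE.
    have [/eqP[e1 e2]|_] := boolP ((f i, f i') == (u, v)); first by case: (noboth i i').
    have [/eqP[e1 e2]|_] := boolP ((f i, f i') == (v, u)); first by case: (noboth i' i).
    by rewrite !orbF.
  rewrite fc' andbT /=; apply/negP => /andP[/existsP[i /eqP fi] /existsP[i' /eqP fi']].
  exact: noboth fi fi'.
have -> : (copies c (cmg P))%:R = #|S|%:R + #|[set f | copy c (cmg P) f] :\: S|%:R :> R.
  rewrite -natrD /copies -(cardsID S); congr ((_ + _)%:R).
  by apply: eq_card => f; rewrite !inE; case: (copy _ _ _).
rewrite addrC; apply: lerD; last by rewrite ler_nat.
pose Y i := part P (pi (c i)) :\ u :\ v.
pose z : {ffun 'I_k -> V} := [ffun i => if i == i0 then u else v].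
have d20 : 0 <= d / 2 by rewrite divr_ge0 // ltW.
have cZ : #|~: [set i0; i0']| = k.-2 by rewrite cardsCs setCK cards2 ii card_ord subn2.
have := @many_copies_exact k r c R V _ P pi [set i0; i0'] z Y (d / 2) pinj d20 n0.
rewrite cZ => h; apply: le_trans (h _ _ _ _ hK) _ => {h}.
- by move=> i; rewrite !inE ffunE => /orP[]/eqP->; rewrite ?eqxx ?ci0 ?ci0' ?pi0 //; case: ifP.
- move=> i i'; rewrite !inE !ffunE => /orP[]/eqP-> /orP[]/eqP->; rewrite ?eqxx //.
    by rewrite eq_sym in ii; rewrite (negbTE ii).
  by rewrite eq_sym in ii; rewrite (negbTE ii) eq_sym.
- move=> i _; have := card_del R (part P (pi (c i)) :\ u) v; have := card_del R (part P (pi (c i))) u.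
  have := hP (pi (c i)); rewrite -/(Y i).
  move: dn (#|Y i|%:R) (#|_ :\ u|%:R) (#|part _ _|%:R); set m := #|V|%:R => dn x y w.
  rewrite (_ : d / 2 * m = d * m / 2); last by ring.
  by move: (d * m) dn => dm; clear -i1_big csurj r2 k2 twin R; lra.
- by move=> i x _; rewrite !inE => /and3P[_ _ /eqP].
rewrite ler_nat; apply: subset_leq_card; apply/subsetP => f; rewrite !inE.
move=> /and3P[/pinnedP pf _ ->] /=; apply/andP; split; apply/existsP; [exists i0|exists i0'].
  by rewrite pf ?inE ?eqxx // ffunE eqxx.
by rewrite pf ?inE ?eqxx ?orbT // ffunE [i0' == _]eq_sym (negbTE ii).
Qed.

(** A copy through [u] places a twin of the index of [u] in the same part, which leaves at most [m]
    choices for it. *)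
Lemma nosingle_through (V : finType) (L : eqType) (P : V -> L) u (m : R) :
  #|part P (P u)|%:R <= m -> (through c (cmg P) u)%:R <= K * (m * #|V|%:R ^+ k.-2).
Proof.
move=> hm; have [tw htw] := fin_all_exists twin.
apply: (@le_trans _ _ (\sum_(i in [set: 'I_k]) #|[set f : {ffun 'I_k -> V} |
   (f i == u) && (f (tw i) \in part P (P u))]|)%:R).
  rewrite ler_nat; apply: card_exists_le => f; rewrite inE => /andP[/copyP[fi fG] /existsP[i /eqP fiu]].
  exists i; rewrite ?inE // fiu eqxx /=; have [ii ci] := htw i.
  by have := fG (tw i) i; rewrite cmgE ci eqxx fiu => /negbT; rewrite negbK.
rewrite natr_sum; apply: (@le_trans _ _ (\sum_(i in [set: 'I_k]) m * #|V|%:R ^+ k.-2)); last first.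
  by rewrite sumr_const cardsT card_ord -[leLHS]mulr_natl.
apply: ler_sum => i _; have [ii _] := htw i.
pose Y l := if l == i then [set u] else if l == tw i then part P (P u) else setT.
apply: (@le_trans _ _ #|[set f : {ffun 'I_k -> V} | [forall l, f l \in Y l]]|%:R).
  rewrite ler_nat; apply: subset_leq_card; apply/subsetP => f; rewrite [in X in X -> _]inE => /andP[/eqP fi ft].
  rewrite inE; apply/forallP => l; rewrite /Y; have [->|_] := eqVneq l i; first by rewrite fi inE.
  by have [->|_] := eqVneq l (tw i); rewrite ?inE //; move: ft; rewrite inE.
rewrite card_box (bigD1 i) //= (bigD1 (tw i)) //= /Y eqxx cards1 mul1n (negbTE ii) eqxx natrM.
rewrite natr_prod (eq_bigr (fun=> #|V|%:R)); last first.
  by move=> l /andP[/negbTE -> /negbTE ->]; rewrite cardsT.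
have -> : \prod_(l | (l != i) && (l != tw i)) (#|V|%:R : R) = #|V|%:R ^+ k.-2.
  rewrite prodr_const; congr (_ ^+ _).
  have -> : k.-2 = #|~: [set i; tw i]| by rewrite cardsCs setCK cards2 eq_sym ii card_ord subn2.
  by apply: eq_card => l; rewrite !inE negb_or.
by rewrite ler_wpM2r ?exprn_ge0.
Qed.

(** Take the penalised maximiser and suppose that one of its parts is small. Each vertex there lies
    in few copies, and turning it into a clone of a vertex with at least the average number of
    copies would gain more than the penalty. *)
Lemma nosingle_structure (V : finType) (L : finType) (M : nat) (P : V -> L) (cM delta : R) :
  0 < cM -> 1 <= #|V|%:R :> R -> extremal_bound c V M -> cM * #|V|%:R ^+ k <= M%:R ->
  near_extremal c M delta (cmg P) -> delta <= cM / 2 ->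
  exists q (P0 : V -> 'I_q), [/\ (r <= q)%N, forall j, cM / 16 * #|V|%:R <= #|part P0 j|%:R &
    #|gdiff (cmg P) (cmg P0)|%:R * (K * cM / 8) <= 2 * delta * #|V|%:R ^+ 2].
Proof.
set n := #|V|%:R => cM0 n1 GM hM hP dM; pose w := K * cM / 8.
have n0 : 0 < n by apply: lt_le_trans n1.
have K0 : 0 < K by rewrite ltr0n (ltn_trans _ k2).
have w0 : 0 < w by rewrite divr_gt0 // mulr_gt0.
have kE1 : n ^+ k = n * n ^+ k.-1 by rewrite -exprS prednK // (ltn_trans _ k2).
have kE2 : n ^+ k.-1 = n * n ^+ k.-2 by rewrite -exprS; congr (_ ^+ _); case: k k2 => [|[|]].
have nk1 : 0 < n ^+ k.-1 by rewrite exprn_gt0.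
have W0 : 0 <= w * n ^+ k.-1 by rewrite mulr_ge0 // ltW.
have [P' [NP hP']] := colouring_ekeland c P W0.
have NM : (copies c (cmg P'))%:R <= M%:R :> R by rewrite ler_nat; apply: GM; exact: cmg_sgraph.
have moved : #|[set x | P' x != P x]|%:R * w <= delta * n.
  rewrite -(ler_pM2r nk1) (_ : delta * n * _ = delta * n ^+ k); last by rewrite kE1; ring.
  rewrite (_ : _ * w * _ = w * n ^+ k.-1 * #|[set x | P' x != P x]|%:R); last by ring.
  by move: NP NM hP; rewrite /near_extremal -/n; clear -i1_big csurj r2 k2 twin R; lra.
have NP'0 : cM / 2 * n ^+ k <= (copies c (cmg P'))%:R.
  have h1 : (copies c (cmg P))%:R <= (copies c (cmg P'))%:R :> R.
    by apply: le_trans NP; rewrite lerDl; apply: mulr_ge0 => //; apply: mulr_ge0; exact: ltW.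
  have h2 : delta * n ^+ k <= cM / 2 * n ^+ k by rewrite ler_wpM2r ?exprn_ge0.
  move: h1 h2 hP hM; rewrite /near_extremal -/n => h1 h2 h3 h4.
  rewrite (_ : cM / 2 * _ = cM * n ^+ k - cM / 2 * n ^+ k); last by field.
  by move: h1 h2 h3 h4; clear -i1_big csurj r2 k2 twin R; lra.
have big x : cM / 16 * n <= #|part P' (P' x)|%:R.
  rewrite leNgt; apply/negP => /ltW small.
  have V0 : (0 < #|V|)%N by apply/card_gt0P; exists x.
  have [v hv] := through_max c (cmg P') V0.
  have h1 := clone_vertex c P' x v.
  have h2 := nosingle_through small.
  have h3 := hP' x (P' v).
  (* In units of [K * cM * n ^+ k.-1]: the vertex [v] lies in at least 1/2, twice the copies through
     [x] make at most 1/8, and the penalty is 1/8. *)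
  have h4 : K * (cM / 2) * n ^+ k.-1 <= (through c (cmg P') v)%:R.
    rewrite -(ler_pM2l n0) -natrM; apply: (@le_trans _ _ (k * copies c (cmg P'))%:R); last by rewrite ler_nat.
    rewrite natrM (_ : n * _ = K * (cM / 2 * n ^+ k)); last by rewrite kE1; ring.
    by rewrite ler_wpM2l // ltW.
  have h5 : K * (cM / 16 * n * n ^+ k.-2) = K * cM * n ^+ k.-1 / 16 by rewrite kE2; field.
  move: h1; rewrite -(ler_nat R) natrD [X in _ <= X -> _]natrD natrM => h1.
  have h6 : 0 < K * cM * n ^+ k.-1 by rewrite !mulr_gt0.
  move: h1 h2 h3 h4 h6; rewrite -/n h5 /w (_ : K * (cM / 2) * _ = K * cM * n ^+ k.-1 / 2); last by field.
  rewrite (_ : K * cM / 8 * _ = K * cM * n ^+ k.-1 / 8); last by field.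
  by move: (K * cM * n ^+ k.-1) => X; clear -i1_big csurj r2 k2 twin R; lra.
have [q [P0 [eP ne]]] := cmg_surjective P'; exists q, P0; rewrite eP; split.
- have : (0 < copies c (cmg P'))%N.
    by rewrite -(ltr0n R); apply: lt_le_trans NP'0; rewrite mulr_gt0 ?divr_gt0 ?exprn_gt0.
  rewrite -eP card_gt0 => /set0Pn[f]; rewrite inE => /copyP[_ fG].
  have [h hh] := fin_all_exists csurj.
  rewrite -[X in (X <= _)%N]card_ord -[X in (_ <= X)%N]card_ord.
  apply: (leq_card (fun j => P0 (f (h j)))) => i j e.
  by apply/eqP; rewrite -[_ == _]negbK -{1}(hh i) -{1}(hh j) -fG cmgE e eqxx.
- move=> j; have /card_gt0P[x] := ne j; rewrite inE => /eqP <-.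
  apply: le_trans (big x) _; rewrite ler_nat; apply: subset_leq_card; apply/subsetP => y.
  by rewrite !inE => yx; rewrite -[_ == _]negbK -cmgE eP cmgE yx.
have : (#|gdiff (cmg P) (cmg P')|%:R : R) <= 2 * n * #|[set x | P' x != P x]|%:R.
  by rewrite -!natrM ler_nat; exact: gdiff_colourings.
move=> h; apply: (@le_trans _ _ (2 * n * #|[set x | P' x != P x]|%:R * w)).
  by rewrite ler_wpM2r // ltW.
rewrite (_ : 2 * delta * _ = 2 * n * (delta * n)); last by ring.
by rewrite -mulrA ler_wpM2l // mulr_ge0 // ltW.
Qed.

End NoSingletons.

Lemma sum_part (V : finType) q (P : V -> 'I_q) : (\sum_j #|part P j| = #|V|)%N.
Proof.
rewrite -[RHS]sum1_card (partition_big P predT) //=.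
by apply: eq_bigr => a _; rewrite -sum1_card; apply: eq_bigl => x; rewrite inE.
Qed.

Lemma part_moved (V : finType) q (P P0 : V -> 'I_q) j :
  (#|part P0 j| <= #|part P j| + #|[set x | P x != P0 x]|)%N.
Proof.
apply: leq_trans (leq_card_setU _ _); apply: subset_leq_card; apply/subsetP => y.
by rewrite !inE => /eqP <-; case: eqP.
Qed.

Section NoSingletonsMain.
Variables (k r : nat) (c : 'I_k -> 'I_r) (R : archiRealFieldType).
Local Notation K := (k%:R : R).
Variables (i1 : 'I_r).
Hypotheses (i1_big : (2 <= #|[set i | c i == i1]|)%N) (csurj : forall j, exists i, c i = j)
  (r2 : (2 <= r)%N) (k2 : (2 < k)%N) (twin : forall i, exists i', i' != i /\ c i' = c i).

Lemma nosingle_main : exists C n0 : R, 0 < C /\ forall (V : finType) M (G : {set V * V}), n0 <= #|V|%:R ->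
    extremal_bound c V M -> sgraph G -> exists P : V -> V,
      #|gdiff G (cmg P)|%:R * #|V|%:R ^+ k.-2 <= C * (M%:R - (copies c G)%:R).
Proof.
have k0 : (0 < k)%N by rewrite (ltn_trans _ k2).
have r0 : (0 < r)%N by rewrite (ltn_trans _ r2).
have [cM [nM [cM0 hM]]] := extremal_lower c R k0 r0.
pose d := cM / 16; have d0 : 0 < d by rewrite divr_gt0.
have d20 : 0 < d / 2 by rewrite divr_gt0.
have d40 : 0 < d / 2 / 2 by rewrite divr_gt0.
pose good (V : finType) q (P0 : V -> 'I_q) := (r <= q)%N /\ forall j, d * #|V|%:R <= #|part P0 j|%:R.
pose cV := (d / 2) ^+ k.-1 / 2; pose c2 := (d / 2 / 2) ^+ k.-2 / 2.
have cV0 : 0 < cV by rewrite divr_gt0 ?exprn_gt0.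
have c20 : 0 < c2 by rewrite divr_gt0 ?exprn_gt0.
have [n1 [n10 hn]] : exists x : R, 0 < x /\ forall y, x <= y ->
    all (fun p => p.2 <= p.1 * y) [:: (1, 1); (d, 2); (cV, K ^+ 2); (d / 2, 4); (c2, K ^+ 2)].
  by apply: large_exists; rewrite /= ltr01 ler01 d0 cV0 d20 c20 !ler0n exprn_ge0.
(* Parts of size at least [d * n] number at most [d^-1]. *)
pose Q := Num.bound (d^-1).
have w0 : 0 < K * cM / 8 by rewrite divr_gt0 // mulr_gt0 // ltr0n.
have close (eps : R) : 0 < eps -> exists delta n0 : R, 0 < delta /\
    forall (V : finType) (L : finType) M (P : V -> L), n0 <= #|V|%:R -> extremal_bound c V M ->
      near_extremal c M delta (cmg P) -> close_to_good good eps (cmg P).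
  move=> eps0.
  have [delta [delta0 /and3P[e1 e2 _]]] : exists x : R, 0 < x /\
      all (fun p => p.1 * x <= p.2) [:: (1, cM / 2); (2, eps * (K * cM / 8))].
    by apply: small_exists; rewrite /= ler01 ler0n divr_gt0 //= mulr_gt0.
  exists delta, (Num.max nM 1); split=> // V L M P; rewrite ge_max => /andP[h1 h2] GM hP.
  rewrite mul1r in e1.
  have [q [P0 [rq hP0 hd]]] := nosingle_structure csurj k2 twin cM0 h2 GM (hM V M h1 GM) hP e1.
  exists q, P0; split; first by split.
  rewrite -(ler_pM2r w0); apply: le_trans hd _.
  rewrite (_ : eps * _ * _ = eps * (K * cM / 8) * #|V|%:R ^+ 2); last by ring.
  by rewrite ler_wpM2r ?exprn_ge0.
apply: (@stability_criterion k r c R i1 i1_big csurj r2 k2 good d cV c2 (d / 2) n1 Q) => //.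
- move=> V q P0 /hn/and5P[h1 h2 h3 h4 /andP[h5 _]] [rq hP0]; rewrite mul1r in h1.
  have n0 : 0 < #|V|%:R :> R by apply: lt_le_trans h1.
  split=> //.
  + have h6 : q%:R * (d * #|V|%:R) <= #|V|%:R.
      rewrite -{2}(sum_part P0) natr_sum mulr_natl -[X in _ *+ X]card_ord -sumr_const.
      exact: ler_sum.
    have h7 : q%:R <= d^-1.
      by rewrite -[leRHS]mul1r ler_pdivlMr // -(ler_pM2r n0) mul1r -mulrA.
    by rewrite -(ler_nat R); apply: le_trans h7 _; rewrite ltW // archi_boundP // invr_ge0 ltW.
  + exact: nosingle_universal.
  + move=> P hP; apply: (nosingle_edge (i1 := i1)) => // j.
    have := part_moved P P0 j; rewrite -(ler_nat R) natrD => h6.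
    have h7 := hP0 j; rewrite (_ : d * _ = d / 2 * #|V|%:R + d / 2 * #|V|%:R) in h7; last by field.
    by move: h6 h7 hP; clear -i1_big csurj r2 k2 twin R; lra.
- move=> eps /close[delta [n0 [delta0 h]]]; exists delta, n0; split=> // V M P h1 h2 h3; left; exact: h h3.
- move=> eps /close[delta [n0 [delta0 h]]]; exists delta, n0; split=> // V M q P0 P h1 h2 _ _ h3; exact: h h3.
Qed.
End NoSingletonsMain.

Local Close Scope ring_scope.

(** * Graphs F with parts of size one and two *)

Section Embeddings.
Variables (k r : nat) (c : 'I_k -> 'I_r).
Hypotheses (csurj : forall j, exists i, c i = j) (k0 : (0 < k)%N).

Definition csize j := #|[set i | c i == j]|.

(** The number of copies in a complete multipartite graph as a polynomial in its part sizes [x];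
    [pi] sends the parts of [F] to distinct parts of the graph. *)
Definition embeddings (L : finType) (x : L -> nat) : nat :=
  \sum_(pi : {ffun 'I_r -> L} | injectiveb pi) \prod_j (x (pi j)) ^_ (csize j).

Lemma copy_cmgP (V : finType) (L : eqType) (P : V -> L) (f : {ffun 'I_k -> V}) :
  copy c (cmg P) f <-> injective f /\ forall i i', (P (f i) == P (f i')) = (c i == c i').
Proof.
split=> [/copyP[fi fG]|[fi fG]]; last by apply/copyP; split=> // i i'; rewrite cmgE fG.
by split=> // i i'; apply/negb_inj; rewrite -fG cmgE.
Qed.

Lemma copies_cmg (V L : finType) (P : V -> L) :
  copies c (cmg P) = embeddings (fun l => #|part P l|).
Proof.
have [h hh] := fin_all_exists csurj.
pose phi (f : {ffun 'I_k -> V}) : {ffun 'I_r -> L} := [ffun j => P (f (h j))].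
rewrite /copies -sum1_card (partition_big phi (fun pi : {ffun 'I_r -> L} => injectiveb pi)) /=; last first.
  move=> f; rewrite inE => /copy_cmgP[_ fP]; apply/injectiveP => i j; rewrite !ffunE => /eqP.
  by rewrite fP !hh => /eqP.
apply: eq_bigr => pi /injectiveP pinj; rewrite sum1_card.
pose i0 := Ordinal k0.
case: (pickP V) => [v0 _|noV]; last first.
  rewrite eq_card0; last by move=> f; have := noV (f i0).
  rewrite (bigD1 (c i0)) //= (_ : #|part P _| = 0); last by apply: eq_card0 => v; have := noV v.
  by rewrite ffact0n (_ : csize _ == 0 = false) ?mul0n //; apply/negbTE; rewrite -lt0n; apply/card_gt0P;
    exists i0; rewrite inE.
have disj a b : a != b -> [disjoint part P (pi a) & part P (pi b)].
  move=> ab; apply/pred0P => v /=; rewrite !inE; apply/negP => /andP[/eqP -> /eqP /pinj e].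
  by rewrite e eqxx in ab.
have := @card_ffset _ _ V c [ffun=> v0] (fun j => part P (pi j)) setT disj.
have -> : \prod_j #|part P (pi j)| ^_ #|[set i in setT | c i == j]| =
   \prod_j #|part P (pi j)| ^_ csize j.
  by apply: eq_bigr => j _; congr (_ ^_ _); apply: eq_card => i; rewrite !inE.
move=> <-; apply: eq_card => f; rewrite unfold_in inE; apply/andP/ffsetP => [[]|[_ h2 h3]].
  move=> /copy_cmgP[fi fP] /eqP e; split=> [i|i _|i j _ _ /fi //]; first by rewrite inE.
  by rewrite inE -e ffunE fP hh.
have e i : P (f i) = pi (c i) by have := h2 i; rewrite !inE => /(_ isT)/eqP.
split; last by apply/eqP/ffunP => j; rewrite ffunE e hh.
apply/copy_cmgP; split=> [i j fij|i j]; last by rewrite !e (inj_eq pinj).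
by apply: h3; rewrite ?inE.
Qed.

Variable R : realFieldType.
Local Open Scope ring_scope.

Definition load (L : eqType) (pi : 'I_r -> L) l : nat := (\sum_(j | pi j == l) csize j)%N.

(* Average the weight over pi and its swap of a and b, with loads A and B of parts of sizes
   X and Y: moving a vertex from a to b adds (X - Y - 1) / 2 * slope A B X Y. *)
Definition slope (A B : nat) (X Y : R) : R :=
  match A, B with
  | 0, 2 => - 2 | 2, 0 => - 2 | 1, 1 => 2
  | 1, 2 => X + Y - 2 | 2, 1 => X + Y - 2
  | 2, 2 => 4 * (X - 1) * Y
  | _, _ => 0
  end.

Definition outer_weight (L : finType) (pi : 'I_r -> L) (x : L -> nat) (a b : L) : R :=
  \prod_(j | (pi j != a) && (pi j != b)) ((x (pi j)) ^_ (csize j))%:R.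

Definition transfer (L : eqType) (x : L -> nat) (a b l : L) : nat :=
  if l == a then (x a).-1 else if l == b then (x b).+1 else x l.

Hypothesis csize2 : forall j, (csize j <= 2)%N.

Lemma ffact1_2 (m a : nat) : (a <= 2)%N -> ((m ^_ a)%:R : R) =
  match a with 0 => 1 | 1 => m%:R | _ => m%:R * (m%:R - 1) end.
Proof.
case: a => [|[|[|]]] // _; rewrite ?ffactn0 ?ffactn1 //.
rewrite ffactnS ffactn1; case: m => [|m]; first by rewrite mul0n mul0r.
by rewrite natrM /= -natr1 addrK.
Qed.

Lemma prod_load (L : eqType) (pi : 'I_r -> L) (m : nat) l : injective pi ->
  (\prod_(j | pi j == l) m ^_ csize j = m ^_ load pi l)%N /\ (load pi l <= 2)%N.
Proof.
move=> pinj; rewrite /load; case: (pickP (fun j => pi j == l)) => [j0 /eqP e|no]; last first.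
  by rewrite !big_pred0.
by rewrite !(big_pred1 j0) // => j; rewrite -e (inj_eq pinj).
Qed.

Lemma weight_split (L : finType) (pi : 'I_r -> L) (x : L -> nat) a b : injective pi -> a != b ->
  ((\prod_j (x (pi j)) ^_ csize j)%N%:R : R) =
  outer_weight pi x a b * ((x a) ^_ load pi a)%:R * ((x b) ^_ load pi b)%:R.
Proof.
move=> pinj ab; rewrite (bigID (fun j => pi j == a)) /= natrM.
rewrite (eq_bigr (fun j => (x a) ^_ csize j)%N); last by move=> j /eqP ->.
rewrite (prod_load _ _ pinj).1 (bigID (fun j => pi j == b)) /= natrM.
rewrite (eq_bigl (fun j => pi j == b)); last first.
  by move=> j; have [->|] := eqVneq (pi j) b; rewrite ?andbF // andbT eq_sym ab.
rewrite (eq_bigr (fun j => (x b) ^_ csize j)%N); last by move=> j /eqP ->.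
by rewrite (prod_load _ _ pinj).1 /outer_weight natr_prod; ring.
Qed.

(** Exchanging [a] and [b] in [pi] permutes the summands, so the weight may be symmetrized. The
    factor of the other parts is unchanged by the transfer, and for each pair of loads the
    symmetrized difference is divisible by [X - Y - 1]. Thus one slope governs moves in either
    direction. *)
Lemma embeddings_transfer (L : finType) (x : L -> nat) a b : a != b -> (0 < x a)%N ->
  2 * ((embeddings (transfer x a b))%:R - (embeddings x)%:R) =
  ((x a)%:R - (x b)%:R - 1) *
  \sum_(pi : {ffun 'I_r -> L} | injectiveb pi)
     outer_weight pi x a b * slope (load pi a) (load pi b) (x a)%:R (x b)%:R :> R.
Proof.
move=> ab xa.
pose tau (pi : {ffun 'I_r -> L}) : {ffun 'I_r -> L} := [ffun j => tperm a b (pi j)].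
have tauK : involutive tau by move=> pi; apply/ffunP => j; rewrite !ffunE tpermK.
have tau_inj (pi : {ffun 'I_r -> L}) : injectiveb (tau pi) = injectiveb pi.
  apply/injectiveP/injectiveP => h i j; last by rewrite !ffunE => /perm_inj /h.
  by move=> e; apply: h; rewrite !ffunE e.
have tauE (pi : {ffun 'I_r -> L}) j l : (tau pi j == l) = (pi j == tperm a b l).
  by rewrite ffunE -{1}(tpermK a b l) (inj_eq perm_inj).
have load_tau (pi : {ffun 'I_r -> L}) l : load (tau pi) l = load pi (tperm a b l).
  by apply: eq_bigl => j; exact: tauE.
have rest_tau (pi : {ffun 'I_r -> L}) y : outer_weight (tau pi) y a b = outer_weight pi y a b.
  apply: eq_big => [j|j]; rewrite !tauE tpermL tpermR; first by rewrite andbC.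
  by move=> /andP[ja jb]; rewrite ffunE tpermD // eq_sym.
pose u y (pi : {ffun 'I_r -> L}) : R := ((y a) ^_ load pi a)%:R * ((y b) ^_ load pi b)%:R
   + ((y a) ^_ load pi b)%:R * ((y b) ^_ load pi a)%:R.
have sym y : 2 * (embeddings y)%:R = \sum_(pi : {ffun 'I_r -> L} | injectiveb pi) outer_weight pi y a b * u y pi.
  rewrite mulr_natl mulr2n /embeddings natr_sum.
  rewrite [X in _ + X](reindex_inj (inv_inj tauK)) /=.
  rewrite [X in _ + X](eq_bigl (fun pi : {ffun 'I_r -> L} => injectiveb pi)) // -big_split /=.
  apply: eq_bigr => pi /injectiveP pinj.
  have tpinj : injective (tau pi) by apply/injectiveP; rewrite tau_inj; apply/injectiveP.
  rewrite (weight_split _ pinj ab) (weight_split _ tpinj ab) rest_tau !load_tau tpermL tpermR /u.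
  by ring.
have restm pi : outer_weight pi (transfer x a b) a b = outer_weight pi x a b.
  by apply: eq_bigr => j /andP[ja jb]; rewrite /transfer (negbTE ja) (negbTE jb).
rewrite mulrBr !sym -sumrB mulr_sumr; apply: eq_bigr => pi /injectiveP pinj.
rewrite restm -mulrBr mulrCA; congr (_ * _); rewrite /u /transfer eqxx [b == a]eq_sym (negbTE ab) eqxx.
have [_ la] := prod_load 0 a pinj; have [_ lb] := prod_load 0 b pinj.
rewrite !ffact1_2 //; have e1 : ((x a).-1%:R : R) = (x a)%:R - 1 by rewrite -subn1 natrB.
rewrite e1 -!natr1; move: (load pi a) (load pi b) la lb (x a)%:R (x b)%:R => A B + + X Y.
by case: A => [|[|[|]]] //; case: B => [|[|[|]]] // _ _; rewrite /slope /=; ring.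
Qed.

End Embeddings.

(** * Counting types and the copies of a given type *)

Section Injections.
Variables (r : nat) (L : finType).
Implicit Type pi : {ffun 'I_r -> L}.

Lemma card_injections : #|[set pi : {ffun 'I_r -> L} | injectiveb pi]| = #|L| ^_ r.
Proof. by rewrite card_inj_ffuns card_ord. Qed.

(** Permutations of the parts act on injections. Transitivity on points and on ordered pairs makes
    the counts [through1] and [through2] independent of the prescribed images. *)
Lemma card_injections_perm (s : {perm L}) (A : pred {ffun 'I_r -> L}) :
  #|[set pi : {ffun 'I_r -> L} | injectiveb pi & A [ffun j => s (pi j)]]| =
  #|[set pi : {ffun 'I_r -> L} | injectiveb pi & A pi]|.
Proof.
pose T pi : {ffun 'I_r -> L} := [ffun j => s (pi j)].
have Tinj : injective T.
  by move=> p p' /ffunP e; apply/ffunP => j; have := e j; rewrite !ffunE => /perm_inj.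
rewrite -(card_imset _ Tinj); apply: eq_card => pi; rewrite inE.
apply/imsetP/andP => [[p]|[pinj Api]].
  rewrite inE => /andP[/injectiveP pinj Ap] ->; split=> //.
  by apply/injectiveP => i j; rewrite !ffunE => /perm_inj /pinj.
have e : pi = T [ffun j => (s^-1)%g (pi j)] by apply/ffunP => j; rewrite !ffunE permKV.
exists [ffun j => (s^-1)%g (pi j)] => //; rewrite inE -/(T _) -e Api andbT.
by apply/injectiveP => i j; rewrite !ffunE => /perm_inj /(injectiveP _ pinj).
Qed.

Definition through1 j l := #|[set pi : {ffun 'I_r -> L} | injectiveb pi & pi j == l]|.
Definition through2 j j' l l' :=
  #|[set pi : {ffun 'I_r -> L} | injectiveb pi & (pi j == l) && (pi j' == l')]|.

Lemma through1P j l : through1 j l * #|L| = #|L| ^_ r.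
Proof.
rewrite -card_injections -sum1_card (partition_big (fun pi : {ffun 'I_r -> L} => pi j) predT) //=.
rewrite mulnC -sum_nat_const; apply: eq_bigr => l' _; rewrite sum1_card.
rewrite /through1 -(card_injections_perm (tperm l l')) /=; apply: eq_card => pi.
rewrite inE [RHS]unfold_in inE ffunE -[_ == l'](inj_eq (@perm_inj _ (tperm l l'))).
by rewrite tpermR.
Qed.

Lemma through2P j j' l l' : j != j' -> l != l' ->
  through2 j j' l l' * (#|L| * #|L|.-1) = #|L| ^_ r.
Proof.
move=> jj ll.
have sym m m' : m != m' -> through2 j j' m m' = through2 j j' l l'.
  move=> mm; pose s1 := tperm l m; pose s := (s1 * tperm (s1 l') m')%g.
  have sl : s l = m.
    rewrite permM tpermL tpermD //; last by rewrite eq_sym.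
    by rewrite -[X in _ != X](tpermL l m) -/s1 (inj_eq perm_inj) eq_sym.
  have sl' : s l' = m' by rewrite permM tpermL.
  rewrite /through2 -(card_injections_perm s) /=; apply: eq_card => pi.
  by rewrite !inE !ffunE -sl -sl' !(inj_eq perm_inj).
rewrite -card_injections -sum1_card.
rewrite (partition_big (fun pi : {ffun 'I_r -> L} => (pi j, pi j')) (mem [set p : L * L | p.1 != p.2])) /=; last first.
  move=> pi; rewrite !inE => /injectiveP pinj; apply: contra jj => /eqP /pinj ->; exact: eqxx.
rewrite (eq_bigr (fun=> through2 j j' l l')) => [|[m m']]; last first.
  rewrite inE /= => /sym <-; rewrite sum1_card; apply: eq_card => pi.
  by rewrite unfold_in !inE.
rewrite sum_nat_const mulnC; congr (_ * _).
have diag : #|[set p : L * L | p.1 == p.2]| = #|L|.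
  rewrite -[RHS](card_imset (mem L) (f := fun x => (x, x))); last by move=> x y [].
  apply: eq_card => -[x y]; rewrite inE /=; apply/eqP/imsetP => [->|[z _ [-> ->]]] //.
  by exists y.
have -> : [set p : L * L | p.1 != p.2] = ~: [set p | p.1 == p.2] by apply/setP => p; rewrite !inE.
by rewrite cardsCs setCK card_prod diag; case: #|L| => // m; rewrite mulnS addKn.
Qed.

End Injections.

Section Counting.
Variables (k r : nat) (c : 'I_k -> 'I_r) (R : realFieldType).
Hypotheses (csurj : forall j, exists i, c i = j).
Local Notation K := (k%:R%R : R).

Definition pinned_types (V L : finType) (P : V -> L) (Z : {set 'I_k}) (z : {ffun 'I_k -> V}) :=
  [set pi : {ffun 'I_r -> L} | injectiveb pi & [forall i, (i \in Z) ==> (pi (c i) == P (z i))]].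

Local Open Scope ring_scope.

(** Each copy has a type [pi], and once the type is fixed every free index has at most [H] choices.
    The lower bound below is dual; its term [K ^+ 2 / n] pays for injectivity. *)
Lemma pinned_upper (V L : finType) (P : V -> L) (Z : {set 'I_k}) (z : {ffun 'I_k -> V}) (H : R) :
  0 <= H -> (forall l, #|part P l|%:R <= H) ->
  #|[set f | pinned Z z f && copy c (cmg P) f]|%:R <= #|pinned_types P Z z|%:R * H ^+ #|~: Z|.
Proof.
move=> H0 hH; have [h hh] := fin_all_exists csurj.
pose phi (f : {ffun 'I_k -> V}) : {ffun 'I_r -> L} := [ffun j => P (f (h j))].
rewrite -sum1_card (partition_big phi (mem (pinned_types P Z z))) /=; last first.
  move=> f; rewrite !inE => /andP[/pinnedP pf /copy_cmgP[_ fP]]; apply/andP; split.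
    by apply/injectiveP => i j; rewrite !ffunE => /eqP; rewrite fP !hh => /eqP.
  by apply/forallP => i; apply/implyP => iZ; rewrite ffunE -pf // fP hh.
rewrite mulr_natl -sumr_const natr_sum; apply: ler_sum => pi _; rewrite sum1_card.
pose Y i := if i \in Z then [set z i] else part P (pi (c i)).
apply: (@le_trans _ _ #|[set f : {ffun 'I_k -> V} | [forall i, f i \in Y i]]|%:R).
  rewrite ler_nat; apply: subset_leq_card; apply/subsetP => f; rewrite unfold_in !inE.
  move=> /andP[/andP[/pinnedP pf /copy_cmgP[_ fP]] /eqP e]; apply/forallP => i; rewrite /Y.
  have [iZ|iZ] := boolP (i \in Z); first by rewrite pf // inE.
  by rewrite inE -e ffunE fP hh.
rewrite card_box (bigID (mem Z)) /= big1 ?mul1n => [|i iZ]; last by rewrite /Y iZ cards1.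
rewrite natr_prod -prodr_const [leRHS](eq_bigl (fun i => i \notin Z)); last by move=> i; rewrite inE.
by apply: ler_prod => i iZ; rewrite ler0n /Y (negbTE iZ) hH.
Qed.

Lemma pinned_lower (V L : finType) (P : V -> L) (Z : {set 'I_k}) (z : {ffun 'I_k -> V}) (lo : R) :
  0 <= lo -> 0 < #|V|%:R :> R -> (forall l, lo * #|V|%:R <= #|part P l|%:R) ->
  (forall i j, i \in Z -> j \in Z -> i != j -> z i != z j) ->
  #|pinned_types P Z z|%:R * ((lo ^+ #|~: Z| - K ^+ 2 / #|V|%:R) * #|V|%:R ^+ #|~: Z|) <=
  #|[set f | pinned Z z f && copy c (cmg P) f]|%:R.
Proof.
move=> lo0 n0 hlo hz; have [h hh] := fin_all_exists csurj.
pose phi (f : {ffun 'I_k -> V}) : {ffun 'I_r -> L} := [ffun j => P (f (h j))].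
pose S pi := [set f | [&& pinned Z z f, copy c (cmg P) f & phi f == pi]].
have hS pi : pi \in pinned_types P Z z ->
    (lo ^+ #|~: Z| - K ^+ 2 / #|V|%:R) * #|V|%:R ^+ #|~: Z| <= #|S pi|%:R.
  rewrite inE => /andP[/injectiveP pinj /forallP pz].
  have := @many_copies k r c V R L (cmg P) set0 setT P pi Z z (fun i => part P (pi (c i))) (#|V|%:R)^-1 lo
    (cmg_sgraph P) pinj.
  rewrite ltW ?invr_gt0 // => hm; apply: le_trans (hm isT lo0 _ _ _ _ _ _ _ _) _ => {hm}.
  - by move=> x y _ _ _ _; rewrite cmgE.
  - by rewrite cards0 add0r expr2 mulrA mulVf ?mul1r // gt_eqF.
  - move=> i _; rewrite (_ : [set y | _] = set0) ?cards0 ?add0r ?mulVf // ?gt_eqF //.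
    by apply/setP => y; rewrite !inE.
  - move=> i _; rewrite (_ : [set y | _] = set0) ?cards0 ?add0r ?mulVf // ?gt_eqF //.
    by apply/setP => y; rewrite !inE.
  - by move=> i iZ; rewrite inE; have := pz i; rewrite iZ => /eqP.
  - by move=> i j iZ jZ ij; rewrite hz // inE.
  - by move=> i _; exact: hlo.
  - by move=> i x _; rewrite !inE => /eqP.
  rewrite ler_nat; apply: subset_leq_card; apply/subsetP => f; rewrite !inE.
  move=> /and3P[pf /forallP fY fc]; rewrite pf fc /=; apply/eqP/ffunP => j; rewrite ffunE.
  have [hZ|hZ] := boolP (h j \in Z).
    by rewrite (pinnedP _ _ _ pf) //; have := pz (h j); rewrite hZ hh => /eqP.
  by have := fY (h j); rewrite hZ inE hh => /eqP.
rewrite mulr_natl -sumr_const; apply: le_trans (ler_sum _ hS) _.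
rewrite -natr_sum ler_nat -[leqRHS]sum1_card (partition_big phi predT) //=.
rewrite big_mkcond /=; apply: leq_sum => pi _; case: ifP => // _; rewrite sum1_card.
by apply: subset_leq_card; apply/subsetP => f; rewrite inE andbA => h1; rewrite unfold_in inE.
Qed.

End Counting.

Local Open Scope ring_scope.

(** * Inequalities for changing the number of parts *)

Section Numbers.
Variable R : realFieldType.

Lemma expr_le_add (y t : R) m : 0 <= y -> 0 <= t -> y + t <= 1 -> (y + t) ^+ m <= y ^+ m + m%:R * t.
Proof.
move=> y0 t0 yt; elim: m => [|m IH]; first by rewrite !expr0 mul0r addr0.
have y1 : y ^+ m <= 1 by rewrite exprn_ile1 //; move: yt t0; clear; lra.
rewrite exprS; apply: (@le_trans _ _ ((y + t) * (y ^+ m + m%:R * t))).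
  by rewrite ler_wpM2l // addr_ge0.
rewrite exprS mulrDl -natr1 !mulrDr mulrDl mul1r.
have h1 : t * y ^+ m <= t by rewrite ler_piMr.
have h2 : (y + t) * (m%:R * t) <= m%:R * t by rewrite ler_piMl // mulr_ge0.
by move: h1; rewrite mulrDl in h2; move: h2; set a := y * y ^+ m; set b := y * _; set b' := t * (_ * _);
  set d := m%:R * t; set e := t * y ^+ m; clear; lra.
Qed.

Lemma expr_ge_sub (y t : R) m : 0 <= t -> t <= y -> y <= 1 -> y ^+ m - m%:R * t <= (y - t) ^+ m.
Proof.
move=> t0 ty y1; have y0 : 0 <= y by apply: le_trans t0 ty.
elim: m => [|m IH]; first by rewrite !expr0 mul0r subr0.
have ym : y ^+ m <= 1 by rewrite exprn_ile1.
have yt : 0 <= y - t by rewrite subr_ge0.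
rewrite [leRHS]exprS; apply: (@le_trans _ _ ((y - t) * (y ^+ m - m%:R * t))); last by rewrite ler_wpM2l.
have h1 : t * y ^+ m <= t by rewrite ler_piMr.
have h2 : (y - t) * (m%:R * t) <= m%:R * t.
  by rewrite ler_piMl ?mulr_ge0 //; move: t0 y1; clear; lra.
rewrite exprS mulrBr -natr1 mulrDl mul1r [(y - t) * y ^+ m]mulrBl.
by move: h1 h2; set a := y * y ^+ m; set b := (y - t) * _; set d := m%:R * t; set e := t * y ^+ m; clear; lra.
Qed.

(** With [x = 1 / (2 * b + 1)] this reads [((1 + x) / (1 - x)) ^+ m < (1 + m * x) / (1 - m * x)],
    that is, [m * artanh x < artanh (m * x)], as long as [m * x < 1]; beyond that the left side is
    not positive. *)
Lemma expr_skew (b : R) m : 0 < b -> (2 <= m)%N ->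
  (b + 1) ^+ m * (2 * b + 1 - m%:R) < b ^+ m * (2 * b + 1 + m%:R).
Proof.
move=> b0; elim: m => // -[//|m] IH _.
have [->|m0] := posnP m; first by rewrite -[2%:R]/(2 : R) !expr2; nra.
have {IH} IH := IH m0; have M1 : 1 <= m%:R :> R by rewrite ler1n.
have X0 : 0 < b ^+ m.+1 by rewrite exprn_gt0.
have Y0 : 0 < (b + 1) ^+ m.+1 by rewrite exprn_gt0 // addr_gt0.
rewrite [(b + 1) ^+ m.+2]exprS [b ^+ m.+2]exprS.
have e1 : m.+1%:R = m%:R + 1 :> R by rewrite -natr1.
have e2 : m.+2%:R = m%:R + 2 :> R by rewrite -addn2 natrD.
move: IH; rewrite e1 e2; move: X0 Y0; set X := b ^+ m.+1; set Y := (b + 1) ^+ m.+1.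
move: M1; set M := m%:R; move: b0; clearbody X Y M; clear=> b0 M1 X0 Y0 IH.
have [neg|pos] := lerP (2 * b + 1 - (M + 2)) 0.
  apply: (@le_lt_trans _ _ 0); first by rewrite mulr_ge0_le0 // mulr_ge0 ?ltW //; lra.
  by rewrite !mulr_gt0 //; lra.
have S0 : 0 < 2 * b + 1 + (M + 1) by lra.
rewrite -(ltr_pM2r S0).
apply: (@le_lt_trans _ _ (b * (2 * b + 1 + (M + 2)) * (Y * (2 * b + 1 - (M + 1))))).
  rewrite (_ : b * _ * _ = Y * (b * (2 * b + 1 + (M + 2)) * (2 * b + 1 - (M + 1)))); last by ring.
  rewrite (_ : (b + 1) * Y * _ * _ = Y * ((b + 1) * (2 * b + 1 - (M + 2)) * (2 * b + 1 + (M + 1)))); last by ring.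
  by rewrite ler_pM2l //; nra.
rewrite (_ : b * X * _ * _ = b * (2 * b + 1 + (M + 2)) * (X * (2 * b + 1 + (M + 1)))); last by ring.
by rewrite ltr_pM2l // mulr_gt0 //; lra.
Qed.

(** The second Bonferroni bound with [z ^+ 3] to spare; this term makes the inequality in
    [turan_fewer_parts] strict. *)
Lemma bonferroni (z : R) m : 0 < z -> z <= 1 -> (3 <= m)%N ->
  (1 - z) ^+ m <= 1 - m%:R * z + m%:R * (m%:R - 1) / 2 * z ^+ 2 - z ^+ 3.
Proof.
move=> z0 z1; elim: m => // m IH; rewrite ltnS leq_eqVlt => /orP[/eqP <-|m3].
  by rewrite !exprS !expr0 -[3%:R]/(3 : R); nra.
have {}IH := IH m3; have M3 : 3 <= m%:R :> R by rewrite ler_nat.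
rewrite exprS -natr1; apply: (@le_trans _ _ ((1 - z) * (1 - m%:R * z + m%:R * (m%:R - 1) / 2 * z ^+ 2 - z ^+ 3))).
  by rewrite ler_wpM2l // subr_ge0.
move: M3; set M := m%:R; clearbody M; move: z0 z1; clear => z0 z1 M3.
rewrite -subr_ge0 (_ : _ - _ = z ^+ 3 * (M * (M - 1) / 2 - z)); last by field.
by rewrite mulr_ge0 ?exprn_ge0 ?ltW //; nra.
Qed.

(* Up to a constant factor, the density of copies in the balanced q-partite graph. *)
Definition turan_density (k r q : nat) : R := (q ^_ r)%:R / q%:R ^+ k.

(** The quotient of the two densities exceeds 1 if [((q + 1) / q) ^+ k.-1 < q / (q + 1 - r)]. By
    [expr_skew] the left side is below [(2 * q + k) / (2 * q + 2 - k)] when that denominator is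
    positive, and comparing the fractions gives exactly the hypothesis. For parts of sizes 1 and 2,
    [2 * r - k] is the number of singletons. *)
Lemma turan_more_parts k r q : (2 < k)%N -> (0 < r)%N -> (r <= q)%N ->
  (k%:R * (q%:R - r%:R + 1) <= (2 * r%:R - k%:R) * q%:R :> R) ->
  turan_density k r q < turan_density k r q.+1.
Proof.
move=> k2 r0 rq h.
have q0 : 0 < q%:R :> R by rewrite ltr0n (leq_trans r0).
have F0 : 0 < (q ^_ r)%:R :> R by rewrite ltr0n ffact_gt0.
have e : (q.+1 ^_ r)%:R * (q%:R + 1 - r%:R) = (q%:R + 1) * (q ^_ r)%:R :> R.
  have := congr1 (fun m => m%:R : R) (ffactnSr q.+1 r); rewrite ffactSS !natrM natrB ?leqW // -natr1.
  by move=> ->.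
have sk := @expr_skew q%:R k.-1 q0 _.
have k1 : k.-1%:R = k%:R - 1 :> R by rewrite -subn1 natrB // (ltn_trans _ k2).
have kE (x : R) : x ^+ k = x * x ^+ k.-1 by rewrite -exprS prednK // (ltn_trans _ k2).
have {}sk : (q%:R + 1) ^+ k.-1 * (2 * q%:R + 2 - k%:R) < q%:R ^+ k.-1 * (2 * q%:R + k%:R) :> R.
  have k3 : (1 < k.-1)%N by rewrite -ltnS prednK // (ltn_trans _ k2).
  have := sk k3; rewrite k1.
  rewrite (_ : 2 * q%:R + 1 - (k%:R - 1) = 2 * q%:R + 2 - k%:R); last by ring.
  by rewrite (_ : 2 * q%:R + 1 + (k%:R - 1) = 2 * q%:R + k%:R); last by ring.
have A0 : 0 < (q%:R + 1) ^+ k.-1 :> R by rewrite exprn_gt0 // addr_gt0.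
have B0 : 0 < q%:R ^+ k.-1 :> R by rewrite exprn_gt0.
have rq' : r%:R <= q%:R :> R by rewrite ler_nat.
have K0 : 0 <= k%:R :> R by rewrite ler0n.
rewrite /turan_density !kE -[in q.+1%:R]natr1 ltr_pdivrMr ?mulr_gt0 //.
rewrite mulrAC ltr_pdivlMr ?mulr_gt0 // ?addr_gt0 //.
move: sk e h; set A := (q%:R + 1) ^+ _ in A0 *; set B := q%:R ^+ k.-1 in B0 *.
set a := (q ^_ r)%:R in F0 *; set b := (_ ^_ r)%:R.
move: q0 F0 A0 B0 rq' K0; set x := q%:R; set y := r%:R; set z := k%:R; clear=> q0 F0 A0 B0 rq K0 sk e h.
have d0 : 0 < x + 1 - y by lra.
rewrite -(ltr_pM2r d0) (_ : b * _ * _ = (b * (x + 1 - y)) * (x * B)); last by ring.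
rewrite e (_ : a * ((x + 1) * A) * _ = ((x + 1) * a) * ((x + 1 - y) * A)); last by ring.
rewrite ltr_pM2l ?mulr_gt0 ?addr_gt0 //.
have s0 : 0 < 2 * x + z by lra.
rewrite -(ltr_pM2r s0); apply: (@le_lt_trans _ _ (A * (x * (2 * x + 2 - z)))).
  by rewrite -mulrA [A * _]mulrC mulrCA mulrC ler_pM2l //; nra.
by rewrite mulrCA -[ltRHS]mulrA ltr_pM2l.
Qed.

(** With [z = 1 / q] the quotient is [(1 - r * z) / (1 - z) ^+ k]. By [bonferroni] it exceeds 1 if
    [k * (k - 1) / 2 * z <= k - r]. *)
Lemma turan_fewer_parts k r q : (2 < k)%N -> (1 < q)%N -> (r <= q)%N ->
  (k%:R * (k%:R - 1) <= 2 * (k%:R - r%:R) * q%:R :> R) ->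
  turan_density k r q < turan_density k r q.-1.
Proof.
move=> k2 q1 rq h.
have q0 : 0 < q%:R :> R by rewrite ltr0n (ltn_trans _ q1).
have qE : q.-1%:R = q%:R - 1 :> R by rewrite -subn1 natrB // ltnW.
have p0 : 0 < q%:R - 1 :> R by rewrite -qE ltr0n -ltnS prednK // ltnW.
have F0 : 0 < (q ^_ r)%:R :> R by rewrite ltr0n ffact_gt0.
have e : (q ^_ r)%:R * (q%:R - r%:R) = q%:R * (q.-1 ^_ r)%:R :> R.
  have := congr1 (fun m => m%:R : R) (ffactnSr q r); rewrite ffactnS !natrM natrB //.
rewrite /turan_density ltr_pdivrMr ?exprn_gt0 // mulrAC ltr_pdivlMr ?qE ?exprn_gt0 //.
pose z := q%:R^-1 : R; have z0 : 0 < z by rewrite invr_gt0.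
have zq : q%:R * z = 1 by rewrite mulfV // gt_eqF.
have z1 : z <= 1 by rewrite invf_le1 // ler1n ltnW.
have bf := bonferroni z0 z1 k2.
have -> : (q.-1 ^_ r)%:R = (q ^_ r)%:R * (1 - r%:R * z) :> R.
  have qn0 : q%:R != 0 :> R by rewrite gt_eqF.
  apply: (mulfI qn0); rewrite -e mulrCA; congr (_ * _).
  by rewrite mulrBr mulr1 mulrCA zq mulr1.
rewrite -mulrA ltr_pM2l // (_ : q%:R - 1 = (1 - z) * q%:R); last first.
  by rewrite mulrBl mul1r [z * _]mulrC zq.
rewrite exprMn ltr_pM2r ?exprn_gt0 //; apply: le_lt_trans bf _.
have := ler_wpM2r (ltW z0) h; rewrite -[leRHS]mulrA zq mulr1 => {}h.
have := ler_wpM2r (ltW z0) h.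
have : 0 < z ^+ 3 by rewrite exprn_gt0.
rewrite (_ : _ * z * z = 2 * (k%:R * (k%:R - 1) / 2 * z ^+ 2)); last by field.
by set u := z ^+ 3; set v := _ / 2 * _; clear; lra.
Qed.

(** Turns the strict comparisons of densities into a margin that is uniform in [q]. *)
Lemma finite_gap (F : nat -> R) Q : exists d, 0 < d /\ forall q, (q <= Q)%N -> 0 < F q -> d <= F q.
Proof.
elim: Q => [|Q [d [d0 hd]]].
  have [F0|F0] := ltrP 0 (F 0); first by exists (F 0); split=> // q; rewrite leqn0 => /eqP ->.
  by exists 1; split=> // q; rewrite leqn0 => /eqP ->; rewrite ltNge F0.
exists (if 0 < F Q.+1 then Num.min d (F Q.+1) else d); split.
  by case: ifP => // F1; rewrite lt_min d0.
move=> q; rewrite leq_eqVlt ltnS => /orP[/eqP -> F1|qQ F1]; first by rewrite F1 ge_min lexx orbT.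
by case: ifP => _; rewrite ?ge_min hd.
Qed.

End Numbers.

(** * Rigidity of nearly balanced graphs *)

Definition isolate (V L : eqType) (P : V -> L) u x : option L := if x == u then None else Some (P x).

(** A universal vertex is a part by itself, so the counts for multipartite graphs apply with one
    part more. *)
Lemma setnb_isolate (V : finType) (L : eqType) (P : V -> L) u :
  setnb (cmg P) u setT = cmg (isolate P u).
Proof.
apply/setP => -[x y]; rewrite cmgE /isolate !inE /=.
by have [_|] := eqVneq x u; have [_|] := eqVneq y u.
Qed.

Lemma part_isolate (R : numDomainType) (V : finType) (L : eqType) (P : V -> L) u (H : R) :
  1 <= H -> (forall l, #|part P l|%:R <= H) -> forall l, #|part (isolate P u) l|%:R <= H.
Proof.
move=> H1 hP [l|].
  apply: le_trans (hP l); rewrite ler_nat; apply: subset_leq_card; apply/subsetP => x.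
  by rewrite !inE /isolate; case: ifP.
rewrite (_ : part _ None = [set u]) ?cards1 //.
by apply/setP => x; rewrite !inE /isolate; case: ifP.
Qed.

Section Types.
Variables (k r : nat) (c : 'I_k -> 'I_r).

Lemma through_pinned (V : finType) (G : {set V * V}) u :
  (through c G u = \sum_i #|[set f | pinned [set i] [ffun=> u] f && copy c G f]|)%N.
Proof.
rewrite /through -sum1_card.
transitivity (\sum_(f in [set f | copy c G f && [exists i, f i == u]]) \sum_(i | f i == u) 1)%N.
  apply: eq_bigr => f; rewrite inE => /andP[/copyP[fi _] /existsP[i /eqP fiu]].
  by rewrite (big_pred1 i) // => j; rewrite /= -fiu (inj_eq fi).
rewrite (exchange_big_dep predT) //=; apply: eq_bigr => i _; rewrite sum1_card.
apply: eq_card => f; rewrite [LHS]unfold_in !inE.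
have -> : pinned [set i] [ffun=> u] f = (f i == u).
  apply/pinnedP/eqP => [h|<- j]; first by rewrite h ?inE // ffunE.
  by rewrite inE => /eqP ->; rewrite ffunE.
have [e|] := eqVneq (f i) u; rewrite ?andbF // andbT.
by rewrite (_ : [exists j, _]) ?andbT //; apply/existsP; exists i; rewrite e.
Qed.

Lemma pinned_types1 (V L : finType) (P : V -> L) i (z : {ffun 'I_k -> V}) :
  #|pinned_types c P [set i] z| = through1 (c i) (P (z i)).
Proof.
apply: eq_card => pi; rewrite !inE; congr (_ && _).
apply/forallP/idP => [/(_ i)|h j]; first by rewrite inE eqxx.
by rewrite inE; apply/implyP => /eqP ->.
Qed.

Lemma pinned_types_same (V L : finType) (P : V -> L) i i' (z : {ffun 'I_k -> V}) : c i = c i' -> P (z i) = P (z i') ->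
  #|pinned_types c P [set i; i'] z| = through1 (c i) (P (z i)).
Proof.
move=> ci Pz; apply: eq_card => pi; rewrite !inE; congr (_ && _).
apply/forallP/idP => [/(_ i)|h j]; first by rewrite !inE eqxx.
by rewrite !inE; apply/implyP => /orP[]/eqP -> //; rewrite -ci -Pz.
Qed.

Lemma pinned_types2 (V L : finType) (P : V -> L) i i' (z : {ffun 'I_k -> V}) :
  #|pinned_types c P [set i; i'] z| = through2 (c i) (c i') (P (z i)) (P (z i')).
Proof.
apply: eq_card => pi; rewrite !inE; congr (_ && _).
apply/forallP/andP => [h|[h h'] j]; first by have := h i; have := h i'; rewrite !inE !eqxx orbT.
by rewrite !inE; apply/implyP => /orP[]/eqP ->.
Qed.

End Types.

Section Singletons.
Variables (k r : nat) (c : 'I_k -> 'I_r).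
Hypotheses (csurj : forall j, exists i, c i = j) (csize2 : forall j, (csize c j <= 2)%N).

Definition singles := #|[set i | csize c (c i) == 1%N]|.

Lemma csize_gt0 j : (0 < csize c j)%N.
Proof. by have [i <-] := csurj j; apply/card_gt0P; exists i; rewrite inE. Qed.

Lemma sum_csize : (\sum_j csize c j = k)%N.
Proof. by rewrite -[RHS]card_ord -(sum_part c). Qed.

Lemma singles_parts : (k + singles = 2 * r)%N.
Proof.
have -> : singles = (\sum_j (csize c j == 1%N))%N.
  rewrite /singles -sum1_card (partition_big c predT) //=; apply: eq_bigr => j _.
  transitivity (\sum_(i | c i == j) (csize c j == 1))%N; last first.
    rewrite sum_nat_const (_ : #|_| = csize c j); last by apply: eq_card => i; rewrite inE.
    by have := csize2 j; case: (csize c j) => [|[|[|]]].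
  rewrite big_mkcond [RHS]big_mkcond /=; apply: eq_bigr => i _; rewrite inE.
  by have [->|] := eqVneq (c i) j; rewrite ?andbF // andbT; case: eqP.
rewrite -[X in (X + _)%N]sum_csize -big_split /= (eq_bigr (fun=> 2%N)) => [|j _].
  by rewrite sum_nat_const card_ord mulnC.
by have := csize2 j; have := csize_gt0 j; case: (csize c j) => [|[|[|]]].
Qed.

End Singletons.

(** A common upper bound for all weighted numbers of types that are compared by [gap_bound]. *)
Definition scale_bound (k r q : nat) : nat := 2 * k ^ 2 * q.+1 ^ r.

(** The tolerance [t] on the part densities and the size [n] are such that the accumulated errors
    stay below half of the smallest possible gap. *)
Definition admissible (R : realFieldType) (k r q : nat) (t n : R) :=
  [/\ 0 < t, t <= q%:R^-1, q%:R^-1 + t <= 1, 1 <= t / 2 * n &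
     (scale_bound k r q)%:R * (2 * k%:R * t + k%:R ^+ 2 / n) <= (q%:R^-1) ^+ k / 2].

(** [A] and [B] are integers, so their difference contributes at least one full term [z ^+ m], which
    is at least [z ^+ k]. Admissibility bounds all errors by half of that. *)
Lemma gap_bound (R : realFieldType) (k r A B q m : nat) (t n : R) : (B < A)%N -> (A <= scale_bound k r q)%N -> (m <= k)%N ->
  (0 < q)%N -> admissible k r q t n ->
  B%:R * (q%:R^-1 + t) ^+ m + (q%:R^-1) ^+ k / 2 <= A%:R * ((q%:R^-1 - t) ^+ m - k%:R ^+ 2 / n).
Proof.
move=> BA AW mk q0 [t0 tq q1 tn err]; set z := q%:R^-1 in tq q1 err *.
have z0 : 0 < z by rewrite invr_gt0 ltr0n.
have n0 : 0 < n by rewrite -(pmulr_rgt0 _ (_ : 0 < t / 2)) ?divr_gt0 //; apply: lt_le_trans tn.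
have z1 : z <= 1 by rewrite (le_trans _ q1) // lerDl ltW.
have hi := expr_le_add m (ltW z0) (ltW t0) q1.
have lo := expr_ge_sub m (ltW t0) tq z1.
have zm : z ^+ k <= z ^+ m by rewrite ler_wiXn2l // ltW.
have mK : m%:R <= k%:R :> R by rewrite ler_nat.
have A1 : B%:R + 1 <= A%:R :> R by rewrite natr1 ler_nat.
have AW' : A%:R <= (scale_bound k r q)%:R :> R by rewrite ler_nat.
set e := k%:R ^+ 2 / n in err *; have e0 : 0 <= e by rewrite divr_ge0 ?exprn_ge0 // ltW.
set zt := (z + t) ^+ m in hi *; set zt' := (z - t) ^+ m in lo *.
set zk := z ^+ k in zm err *; set y := z ^+ m in zm lo hi.
have zk0 : 0 < zk by rewrite exprn_gt0.
have mt : m%:R * t <= k%:R * t by rewrite ler_wpM2r // ltW.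
have Kt : 0 <= k%:R * t by rewrite mulr_ge0 // ltW.
have h1 : B%:R * zt <= B%:R * (y + k%:R * t).
  by rewrite ler_wpM2l //; move: hi mt; clear; lra.
have h2 : A%:R * (y - k%:R * t - e) <= A%:R * (zt' - e).
  by rewrite ler_wpM2l //; move: lo mt; clear; lra.
have h3 : A%:R * (2 * k%:R * t + e) <= zk / 2.
  apply: le_trans err; rewrite ler_wpM2r // addr_ge0 //.
  by rewrite -mulrA mulr_ge0.
have h4 : y <= (A%:R - B%:R) * y.
  by rewrite ler_peMl //; [exact: le_trans (ltW zk0) zm | move: A1; clear; lra].
have h5 : B%:R * (k%:R * t) <= A%:R * (k%:R * t).
  by rewrite ler_wpM2r //; move: A1; clear; lra.
apply: le_trans (_ : _ <= B%:R * (y + k%:R * t) + zk / 2) _; first by rewrite lerD2r.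
apply: le_trans h2.
by move: h3 h4 h5 zm; clear; lra.
Qed.

Definition nearly_balanced (R : realFieldType) (V : finType) q (P : V -> 'I_q) (t : R) := forall j,
  (q%:R^-1 - t) * #|V|%:R <= #|part P j|%:R <= (q%:R^-1 + t) * #|V|%:R.

Lemma through1E r (L : finType) (j : 'I_r) (l : L) : (through1 j l = #|L|.-1 ^_ r.-1)%N.
Proof.
have L0 : (0 < #|L|)%N by apply/card_gt0P; exists l.
have r0 : (0 < r)%N by apply: leq_ltn_trans (ltn_ord j).
have e n m : (0 < n)%N -> (0 < m)%N -> (n ^_ m = n.-1 ^_ m.-1 * n)%N.
  by case: n m => [|n] [|m] // _ _; rewrite ffactSS mulnC.
by apply/eqP; rewrite -(eqn_pmul2r L0) through1P e.
Qed.

Lemma through2E r (L : finType) (j j' : 'I_r) (l l' : L) : j != j' -> l != l' ->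
  (through2 j j' l l' = #|L|.-2 ^_ r.-2)%N.
Proof.
move=> jj ll.
have L2 : (1 < #|L|)%N by apply/card_gt1P; exists l, l'.
have r2 : (1 < r)%N by rewrite -[r]card_ord; apply/card_gt1P; exists j, j'.
have e n m : (1 < n)%N -> (1 < m)%N -> (n ^_ m = n.-2 ^_ m.-2 * (n * n.-1))%N.
  by case: n m => [|[|n]] [|[|m]] // _ _; rewrite !ffactSS [RHS]mulnC mulnA.
have L20 : (0 < #|L| * #|L|.-1)%N by case: #|L| L2 => [|[]].
by apply/eqP; rewrite -(eqn_pmul2r L20) through2P // e.
Qed.

Lemma ffact_le_exp n m : (n ^_ m <= n ^ m)%N.
Proof.
elim: m => // m IH; rewrite ffactnSr expnSr leq_mul //; exact: leq_subr.
Qed.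

Lemma scale_bound_le k r q m q' r' : (m <= 2 * k ^ 2)%N -> (q' <= q)%N -> (r' <= r)%N ->
  (m * q' ^_ r' <= scale_bound k r q)%N.
Proof.
move=> hm hq hr; apply: leq_mul => //; apply: leq_trans (ffact_le_exp _ _) _.
apply: leq_trans (leq_pexp2l _ hr) => //; case: r' hr => // r' _.
by rewrite leq_exp2r // leqW.
Qed.

Lemma pairs_pinned k r (c : 'I_k -> 'I_r) (V : finType) (G : {set V * V}) u v : u != v ->
  (#|[set f | copy c G f && ([exists i, f i == u] && [exists i, f i == v])]| =
   \sum_(p : 'I_k * 'I_k | p.1 != p.2)
     #|[set f | pinned [set p.1; p.2] [ffun i => if i == p.1 then u else v] f && copy c G f]|)%N.
Proof.
move=> uv; rewrite -sum1_card.
set S := [set f | _].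
transitivity (\sum_(f in S) \sum_(p : 'I_k * 'I_k | (p.1 != p.2) && ((f p.1 == u) && (f p.2 == v))) 1)%N.
  apply: eq_bigr => f; rewrite inE => /andP[/copyP[fi _] /andP[/existsP[i /eqP fu] /existsP[i' /eqP fv]]].
  rewrite (big_pred1 (i, i')) // => -[j j'] /=.
  rewrite -fu -fv !(inj_eq fi) xpair_eqE andbC; have [->|//] := eqVneq j i.
  by have [->|//] := eqVneq j' i'; rewrite -(inj_eq fi) fu fv uv.
rewrite (exchange_big_dep (fun p : 'I_k * 'I_k => p.1 != p.2)) /=; last by move=> ? ? _ /andP[].
apply: eq_bigr => -[i i'] /= ii; rewrite sum1_card; apply: eq_card => f; rewrite [LHS]unfold_in !inE ii /=.
have -> : pinned [set i; i'] [ffun j => if j == i then u else v] f = (f i == u) && (f i' == v).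
  have ii' : i' != i by rewrite eq_sym.
  apply/pinnedP/andP => [h|[/eqP h /eqP h'] j].
    by rewrite !h ?inE ?eqxx ?orbT // !ffunE eqxx (negbTE ii') !eqxx.
  by rewrite !inE ffunE => /orP[]/eqP ->; rewrite ?eqxx // (negbTE ii').
rewrite andbC; apply/idP/idP => [/andP[-> /andP[-> _]] //|/andP[/andP[e e'] ->]].
by rewrite e e' !andTb; apply/andP; split; apply/existsP; [exists i|exists i'].
Qed.

Section Gaps.
Variables (k r : nat) (c : 'I_k -> 'I_r) (R : realFieldType).
Local Notation K := (k%:R : R).
Hypotheses (csurj : forall j, exists i, c i = j) (csize2 : forall j, (csize c j <= 2)%N)
  (r2 : (2 <= r)%N) (k2 : (2 < k)%N).

Lemma twin_of i : csize c (c i) != 1%N -> exists i', i' != i /\ c i' = c i.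
Proof.
move=> h; have : (1 < csize c (c i))%N by move: (csize_gt0 csurj (c i)) h; case: csize => [|[]].
move=> /card_gt1P[x [y]]; rewrite !inE => -[/eqP cx /eqP cy xy].
have [e|] := eqVneq x i; last by exists x.
by exists y; split=> //; rewrite -e eq_sym.
Qed.

(** A universal [u] can only play a singleton of [F], in [singles c * q ^_ r.-1] ways. Inside a part
    it can play any vertex, in [k * q.-1 ^_ r.-1] ways. As [q * q.-1 ^_ r.-1 = q ^_ r.-1 * (q -
    r).+1], the second hypothesis is the comparison of the two. *)
Lemma universal_balanced (V : finType) q (P : V -> 'I_q) (t : R) :
  (r <= q)%N -> (singles c * q < k * (q - r).+1)%N -> nearly_balanced P (t / 2) ->
  admissible k r q t #|V|%:R -> universal_gap c P ((q%:R^-1) ^+ k / 2 : R).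
Proof.
move=> rq hA hP adm u; have q0 : (0 < q)%N by apply: leq_trans rq; rewrite ltnW.
pose j := Ordinal q0; exists j.
rewrite setnb_isolate setnb_recolour; set Pu := isolate P u; set Pj := recolour P u j.
rewrite (copies_split c (cmg Pu) u) (copies_split c (cmg Pj) u) !natrD.
have -> : avoiding c (cmg Pu) u = avoiding c (cmg Pj) u.
  by apply: avoiding_agree => x y xu yu; rewrite !cmgE /Pu /Pj /recolour /isolate (negbTE xu) (negbTE yu).
rewrite -addrA lerD2l !through_pinned !natr_sum.
have [t0 tq q1 tn _] := adm; set n := #|V|%:R in tn adm *.
have n0 : 0 < n by rewrite -(pmulr_rgt0 _ (_ : 0 < t / 2)) ?divr_gt0 //; apply: lt_le_trans tn.
have z0 : 0 < q%:R^-1 :> R by rewrite invr_gt0 ltr0n.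
have tn2 : t / 2 * n + t / 2 * n = t * n by field.
have zn0 : 0 < q%:R^-1 * n by rewrite mulr_gt0.
have H0 : 0 <= (q%:R^-1 + t) * n by rewrite mulr_ge0 ?addr_ge0 // ltW.
have lo0 : 0 <= q%:R^-1 - t by rewrite subr_ge0.
have cZ i : #|~: [set i : 'I_k]| = k.-1 by rewrite cardsC1 card_ord.
have hPu : forall l, #|part Pu l|%:R <= (q%:R^-1 + t) * n.
  apply: part_isolate => [|l].
    by rewrite mulrDl; move: tn2 zn0 tn; set a := _ * n; set b := _ * n; set d := t * n;
    clear -csurj csize2 r2 k2 R; lra.
  have /andP[_ h] := hP l; apply: le_trans h _; rewrite ler_wpM2r ?(ltW n0) //.
  by rewrite lerD2l ler_pdivrMr // ler_peMr ?(ltW t0) // ler1n.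
have hPj l : (q%:R^-1 - t) * n <= #|part Pj l|%:R.
  have h1 : (#|part P l| <= #|part Pj l| + 1)%N.
    rewrite -(cards1 u); apply: leq_trans (leq_card_setU _ _); apply: subset_leq_card.
    apply/subsetP => x; rewrite !inE /Pj /recolour; have [_|_] := eqVneq x u; by rewrite ?orbT ?orbF.
  have /andP[h2 _] := hP l; move: h1; rewrite -(ler_nat R) natrD => h1.
  move: h1 h2 tn tn2; rewrite !mulrBl; set a := _ * n; set b := _ * n; set d := t * n.
  by clear -csurj csize2 r2 k2 R; lra.
have up i : #|[set f | pinned [set i] [ffun=> u] f && copy c (cmg Pu) f]|%:R <=
    (csize c (c i) == 1%N)%:R * ((q ^_ r.-1)%:R * ((q%:R^-1 + t) * n) ^+ k.-1).
  have [e|nsg] := eqVneq (csize c (c i)) 1%N.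
    rewrite mul1r; apply: le_trans (pinned_upper csurj _ _ H0 hPu) _.
    by rewrite pinned_types1 through1E card_option card_ord cZ.
  have [i' [ii' ci']] := twin_of nsg.
  rewrite mul0r (eq_card0 (A := [set f | _ & _])) // => f; rewrite !inE; apply/negP => /andP[/pinnedP pf].
  move=> /copyP[fi fG]; have := fG i i'; rewrite ci' eqxx cmgE pf ?inE // ffunE /Pu /isolate eqxx.
  have -> : f i' == u = false.
    apply/negbTE; apply: contra ii' => /eqP e; apply/eqP/fi; by rewrite e pf ?inE // ffunE.
  by [].
have low i : (q.-1 ^_ r.-1)%:R * (((q%:R^-1 - t) ^+ k.-1 - K ^+ 2 / n) * n ^+ k.-1) <=
    #|[set f | pinned [set i] [ffun=> u] f && copy c (cmg Pj) f]|%:R.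
  apply: le_trans (pinned_lower csurj lo0 n0 hPj _); first by rewrite pinned_types1 through1E card_ord cZ.
  by move=> i' i''; rewrite !inE => /eqP -> /eqP ->; rewrite eqxx.
apply: (@le_trans _ _ ((singles c * q ^_ r.-1)%:R * ((q%:R^-1 + t) * n) ^+ k.-1 +
    q%:R^-1 ^+ k / 2 * n ^+ k.-1)).
  rewrite lerD2r; apply: le_trans (ler_sum _ (fun i _ => up i)) _.
  rewrite -mulr_suml -natr_sum natrM -mulrA; apply: ler_wpM2r.
    by rewrite mulr_ge0 // exprn_ge0.
  rewrite ler_nat /singles -sum1_card [leqRHS]big_mkcond /=; apply: leq_sum => i _.
  by rewrite inE; case: eqP.
apply: le_trans (ler_sum _ (fun i _ => low i)).
rewrite sumr_const card_ord -[leRHS]mulr_natl !mulrA -natrM exprMn !mulrA -!mulrDl.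
rewrite ler_wpM2r ?exprn_ge0 ?(ltW n0) //; apply: (@gap_bound R k r) => //; [| |exact: leq_pred].
  have e : (q * q.-1 ^_ r.-1 = q ^_ r.-1 * (q - r).+1)%N.
    have := ffactnSr q r.-1; rewrite ffactnS => ->.
    by congr (_ * _)%N; move: r2 rq; clear -r q; lia.
  have F0 : (0 < q ^_ r.-1)%N by rewrite ffact_gt0 (leq_trans (leq_pred r)).
  move: hA; rewrite -(ltn_pmul2l F0) -[in X in _ -> X](ltn_pmul2l q0) [X in _ -> (_ < X)%N]mulnCA e.
  by rewrite [X in _ -> (_ < X)%N]mulnCA [X in _ -> (X < _)%N]mulnCA [X in _ -> (X < _)%N]mulnA [X in _ -> (X < _)%N]mulnC.
apply: scale_bound_le; rewrite ?leq_pred //; apply: leq_trans (leq_pmull _ (isT : 0 < 2)%N).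
by rewrite -mulnn leq_pmulr // (ltn_trans _ k2).
Qed.

Lemma card_twin_pairs :
  #|[set p : 'I_k * 'I_k | (p.1 != p.2) && (c p.1 == c p.2)]| = (k - singles c)%N.
Proof.
rewrite card_pairs (eq_bigr (fun i => ~~ (csize c (c i) == 1) : nat)%N) => [|i _].
  have := cardsC [set i | csize c (c i) == 1%N]; rewrite card_ord /singles => e.
  rewrite -[X in (X - _)%N]e addKn -sum1_card.
  by rewrite [RHS]big_mkcond /=; apply: eq_bigr => i _; rewrite !inE; case: (_ == _).
have h : #|[set j | c i == c j]| = csize c (c i) by apply: eq_card => j; rewrite !inE eq_sym.
have := cardsD1 i [set j | c i == c j]; rewrite h inE eqxx => e.
rewrite (eq_card (B := [set j | c i == c j] :\ i)); last by move=> j; rewrite !inE eq_sym.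
by have := csize2 (c i); rewrite e; case: #|_| => [|[]].
Qed.

Lemma card_single_pairs :
  #|[set p : 'I_k * 'I_k | (p.1 != p.2) && (csize c (c p.1) == 1) && (csize c (c p.2) == 1)]|%N =
  (singles c * (singles c).-1)%N.
Proof.
rewrite card_pairs /singles; set S := [set i | _].
rewrite (bigID (mem S)) /= [X in (_ + X)%N]big1 ?addn0 => [|i]; last first.
  by rewrite inE => h; apply: eq_card0 => j; rewrite !inE (negbTE h) andbF.
rewrite (eq_bigr (fun=> #|S|.-1)) ?sum_nat_const // => i iS.
rewrite (cardsD1 i S) iS; apply: eq_card => j; move: iS.
by rewrite !inE => ->; rewrite andbT eq_sym.
Qed.

(** Let [s] be the number of singletons of [F]. Joined inside a part, [u] and [v] must play two
    singletons, with [q.-1 ^_ r.-2] types for each of the [s * (s - 1)] ordered pairs. Not joined,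
    they play two twins, with [q.-1 ^_ r.-1] types for each of [k - s] ordered pairs. The claim
    reduces to [s * (s - 1) < (k - s) * (q - r + 1)]. *)
Lemma edge_balanced (V : finType) q (P : V -> 'I_q) (t : R) :
  (r <= q)%N -> (singles c * q < k * (q - r).+1)%N -> nearly_balanced P (t / 2) ->
  admissible k r q t #|V|%:R -> edge_gap c P ((q%:R^-1) ^+ k / 2 : R).
Proof.
move=> rq hA hP adm u v uv Puv; have q0 : (0 < q)%N by apply: leq_trans rq; rewrite ltnW.
set G := cmg P; set G' := addedge G u v.
pose both (f : {ffun 'I_k -> V}) := [exists i, f i == u] && [exists i, f i == v].
have split_both H : copies c H =
    (#|[set f | copy c H f && both f]| + #|[set f | copy c H f && ~~ both f]|)%N.
  rewrite /copies -(cardsID [set f | both f]).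
  by congr (_ + _)%N; apply: eq_card => f; rewrite !inE // andbC.
have inA x y : ((x, y) \in G') = (P x != P y) || ((x, y) == (u, v)) || ((x, y) == (v, u)).
  by rewrite !inE orbA.
have -> : copies c G' = (#|[set f | copy c G' f && both f]| + #|[set f | copy c G f && ~~ both f]|)%N.
  rewrite split_both; congr (_ + _)%N; apply: eq_card => f; rewrite !inE.
  have [_|nb] := boolP (both f); rewrite ?andbF // !andbT.
  have e i j : ((f i, f j) \in G') = ((f i, f j) \in G).
    rewrite inA cmgE !xpair_eqE; apply/orP/idP => [[/orP[//|/andP[e1 e2]]|/andP[e1 e2]]|->]; last by left.
      by case/negP: nb; apply/andP; split; apply/existsP; [exists i|exists j].
    by case/negP: nb; apply/andP; split; apply/existsP; [exists j|exists i].
  by apply/copyP/copyP => -[fi fG]; split=> // i j; rewrite -fG e.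
rewrite (split_both G) !natrD addrAC lerD2r !(pairs_pinned _ _ uv) !natr_sum.
set z := fun p : 'I_k * 'I_k => [ffun i => if i == p.1 then u else v].
have [t0 tq q1 tn _] := adm; set n := #|V|%:R in tn adm *.
have n0 : 0 < n by rewrite -(pmulr_rgt0 _ (_ : 0 < t / 2)) ?divr_gt0 //; apply: lt_le_trans tn.
have z0 : 0 < q%:R^-1 :> R by rewrite invr_gt0 ltr0n.
have tn2 : t / 2 * n + t / 2 * n = t * n by field.
have zn0 : 0 < q%:R^-1 * n by rewrite mulr_gt0.
have H0 : 0 <= (q%:R^-1 + t) * n by rewrite mulr_ge0 ?addr_ge0 // ltW.
have lo0 : 0 <= q%:R^-1 - t by rewrite subr_ge0.
have cZ (p : 'I_k * 'I_k) : p.1 != p.2 -> #|~: [set p.1; p.2]| = k.-2.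
  by move=> pp; rewrite cardsCs setCK cards2 pp card_ord subn2.
have t2 : t / 2 <= t by rewrite ler_pdivrMr // ler_peMr ?(ltW t0) // ler1n.
have hPu : forall l, #|part (isolate P u) l|%:R <= (q%:R^-1 + t) * n.
  apply: part_isolate => [|l].
    by rewrite mulrDl; move: tn2 zn0 tn; set a := _ * n; set b := _ * n; set d := t * n;
    clear -csurj csize2 r2 k2 R; lra.
  by have /andP[_ h] := hP l; apply: le_trans h _; rewrite ler_wpM2r ?(ltW n0) // lerD2l.
have hPl l : (q%:R^-1 - t) * n <= #|part P l|%:R.
  have /andP[h _] := hP l; apply: le_trans h; rewrite ler_wpM2r ?(ltW n0) //.
  by rewrite lerD2l lerN2.
have up (p : 'I_k * 'I_k) : p.1 != p.2 ->
    #|[set f | pinned [set p.1; p.2] (z p) f && copy c G' f]|%:R <=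
    ((csize c (c p.1) == 1%N) && (csize c (c p.2) == 1%N))%:R *
      ((q.-1 ^_ r.-2)%:R * ((q%:R^-1 + t) * n) ^+ k.-2).
  move=> pp; have ppS : p.2 != p.1 by rewrite eq_sym.
  have fp f : pinned [set p.1; p.2] (z p) f -> f p.1 = u /\ f p.2 = v.
    move=> /pinnedP pf; rewrite !pf ?inE ?eqxx ?orbT // !ffunE eqxx.
    by rewrite (negbTE ppS).
  have [cpp|cpp] := eqVneq (c p.1) (c p.2).
    rewrite (eq_card0 (A := [set f | _ & _])) ?mulr_ge0 ?exprn_ge0 // => f.
    rewrite inE; apply/negP => /andP[/fp[f1 f2] /copyP[_ fG]].
    by have := fG p.1 p.2; rewrite cpp eqxx f1 f2 inA eqxx orbT.
  (* The remaining vertices of such a copy see [u] and [v] alike. If one of them lay in the common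
     part, its colour would equal those of both [p.1] and [p.2], which differ. Hence the copy
     survives when [u] is made a part of its own. *)
  have key f : pinned [set p.1; p.2] (z p) f && copy c G' f ->
     [/\ csize c (c p.1) == 1%N, csize c (c p.2) == 1%N & copy c (cmg (isolate P u)) f].
    move=> /andP[/fp[f1 f2] /copyP[fi fG]].
    have off j : j != p.1 -> j != p.2 -> (c j != c p.1) && (c j != c p.2).
      move=> j1 j2; have fu : f j != u by rewrite -f1 (inj_eq fi).
      have fv : f j != v by rewrite -f2 (inj_eq fi).
      have e1 : (c j != c p.1) = (P (f j) != P u).
        by rewrite -fG inA f1 !xpair_eqE (negbTE fu) (negbTE fv) !orbF.
      have e2 : (c j != c p.2) = (P (f j) != P u).
        by rewrite -fG inA f2 !xpair_eqE (negbTE fu) (negbTE fv) !orbF Puv.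
      rewrite e1 e2 andbb -e1; apply/eqP => h1; move: e2; rewrite -e1 h1 eqxx.
      by rewrite (negbTE cpp).
    have sing j : j != p.1 -> c j != c p.1.
      have [->|j2] := eqVneq j p.2; first by move=> _; rewrite eq_sym.
      by move=> /off/(_ j2)/andP[].
    have sing2 j : j != p.2 -> c j != c p.2.
      by have [->|j1] := eqVneq j p.1 => // /(off _ j1)/andP[].
    split.
    - apply/cards1P; exists p.1; apply/setP => j; rewrite !inE; apply/eqP/eqP => [h|-> //].
      by apply/eqP; apply: contraT => /sing; rewrite h eqxx.
    - apply/cards1P; exists p.2; apply/setP => j; rewrite !inE; apply/eqP/eqP => [h|-> //].
      by apply/eqP; apply: contraT => /sing2; rewrite h eqxx.
    apply/copyP; split=> // i i'; rewrite cmgE /isolate -f1 !(inj_eq fi).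
    have [->|i1] := eqVneq i p.1.
      have [->|i'1] := eqVneq i' p.1; first by rewrite !eqxx.
      by rewrite [c p.1 == _]eq_sym sing.
    have [->|i'1] := eqVneq i' p.1; first by rewrite sing.
    rewrite -fG inA !xpair_eqE -f1 !(inj_eq fi) (negbTE i1) (negbTE i'1) andbF !orbF.
    by [].
  have [/andP[s1 s2]|nsg] := boolP (_ && _); last first.
    rewrite mul0r (eq_card0 (A := [set f | _ & _])) // => f; rewrite inE; apply: contraNF nsg.
    by move=> /key[-> ->].
  rewrite mul1r; apply: (@le_trans _ _
      #|[set f | pinned [set p.1; p.2] (z p) f && copy c (cmg (isolate P u)) f]|%:R).
    rewrite ler_nat; apply: subset_leq_card; apply/subsetP => f; rewrite !inE => h.
    by have [_ _ ->] := key f h; have /andP[->] := h.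
  apply: le_trans (pinned_upper csurj _ _ H0 hPu) _.
  rewrite pinned_types2 through2E //; first by rewrite card_option card_ord cZ.
  by rewrite !ffunE eqxx (negbTE ppS) /isolate eqxx [v == u]eq_sym (negbTE uv).
have low (p : 'I_k * 'I_k) : p.1 != p.2 ->
    (c p.1 == c p.2)%:R * ((q.-1 ^_ r.-1)%:R * (((q%:R^-1 - t) ^+ k.-2 - K ^+ 2 / n) * n ^+ k.-2)) <=
    #|[set f | pinned [set p.1; p.2] (z p) f && copy c G f]|%:R.
  move=> pp; have ppS : p.2 != p.1 by rewrite eq_sym.
  have [cpp|_] := eqVneq (c p.1) (c p.2); last by rewrite mul0r.
  rewrite mul1r; apply: le_trans (pinned_lower csurj lo0 n0 hPl _).
    rewrite pinned_types_same // ?through1E ?card_ord ?cZ //.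
    by rewrite !ffunE eqxx (negbTE ppS).
  move=> i i'; rewrite !inE !ffunE => /orP[]/eqP-> /orP[]/eqP->; rewrite ?eqxx // ?(negbTE ppS) //.
  by rewrite eq_sym.
apply: (@le_trans _ _ ((singles c * (singles c).-1 * q.-1 ^_ r.-2)%:R * ((q%:R^-1 + t) * n) ^+ k.-2 +
    q%:R^-1 ^+ k / 2 * n ^+ k.-2)).
  rewrite lerD2r; apply: le_trans (ler_sum _ (fun p h => up p h)) _.
  rewrite -mulr_suml -natr_sum natrM -mulrA; apply: ler_wpM2r.
    by rewrite mulr_ge0 // exprn_ge0.
  rewrite ler_nat -card_single_pairs -sum1_card big_mkcond [leqRHS]big_mkcond /=; apply: leq_sum => p _.
  by rewrite inE -andbA; case: (p.1 == p.2); case: (_ && _).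
apply: le_trans (ler_sum _ (fun p h => low p h)).
rewrite -mulr_suml -natr_sum.
rewrite (_ : (\sum_(p : 'I_k * 'I_k | _) _)%N = (k - singles c)%N); last first.
  rewrite -card_twin_pairs -sum1_card big_mkcond [RHS]big_mkcond /=; apply: eq_bigr => p _.
  by rewrite inE; case: (p.1 == p.2); case: (_ == _).
rewrite !mulrA -natrM exprMn !mulrA -!mulrDl.
rewrite ler_wpM2r ?exprn_ge0 ?(ltW n0) //.
apply: (@gap_bound R k r) => //; last by apply: leq_trans (leq_pred _) (leq_pred _).
  have -> : (q.-1 ^_ r.-1 = q.-1 ^_ r.-2 * (q - r).+1)%N.
    have := ffactnSr q.-1 r.-2; rewrite -subn2 -[r.-1]subn1 (_ : (r - 2).+1 = r - 1)%N.
      by move=> ->; congr (_ * _)%N; move: r2 rq; clear -r q; lia.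
    by move: r2; clear -r; lia.
  have F0 : (0 < q.-1 ^_ r.-2)%N by rewrite ffact_gt0; move: r2 rq; clear -r q; lia.
  rewrite mulnCA mulnC ltn_pmul2l //.
  (* Substituting [k + s = 2 * r] in the hypothesis gives [s * (r - 1) < (k - s) * (q - r + 1)], and
     [s <= r]. *)
  have := singles_parts csurj csize2; have : (singles c <= k)%N.
    by rewrite -[X in (_ <= X)%N]card_ord; exact: max_card.
  move: hA rq; move: (singles c) => s; clear -r q k => hA rq sk ks.
  have [d kE] : exists d, (k = s + d)%N by exists (k - s)%N; rewrite subnKC.
  have [e qE] : exists e, (q = r + e)%N by exists (q - r)%N; rewrite subnKC.
  subst q; rewrite {}kE in hA ks sk *; rewrite !addKn in hA *.
  have sr : (s <= r)%N by clear hA; lia.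
  have ssr : (s * s <= s * r)%N by rewrite leq_mul2l sr orbT.
  by case: s hA sk ks sr ssr => [|s] /= hA sk ks sr ssr; nia.
apply: scale_bound_le; last exact: leq_pred.
- apply: leq_trans (leq_subr _ _) _; apply: leq_trans (leq_pmull _ (isT : 0 < 2)%N).
  by rewrite -mulnn leq_pmulr // (ltn_trans _ k2).
exact: leq_pred.
Qed.

End Gaps.

(** * The effect of moving a vertex between parts *)

Section LoadSums.
Variables (k r : nat) (c : 'I_k -> 'I_r) (L : finType).
Local Open Scope nat_scope.
Implicit Type pi : {ffun 'I_r -> L}.

Lemma sum_types1 (F : 'I_r -> nat) a :
  \sum_(pi : {ffun 'I_r -> L} | injectiveb pi) \sum_(j | pi j == a) F j =
  (\sum_j F j) * #|L|.-1 ^_ r.-1.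
Proof.
rewrite (exchange_big_dep predT) //= big_distrl /=; apply: eq_bigr => j _.
rewrite sum_nat_const mulnC -(through1E j a); congr (_ * _).
by apply: eq_card => pi; rewrite [LHS]unfold_in inE.
Qed.

Lemma load_square pi a : injective pi -> load c pi a ^ 2 = \sum_(j | pi j == a) csize c j ^ 2.
Proof.
move=> pinj; rewrite /load; case: (pickP (fun j => pi j == a)) => [j0 /eqP e|no]; last first.
  by rewrite !big_pred0.
by rewrite !(big_pred1 j0) // => j; rewrite -e (inj_eq pinj).
Qed.

(** Expand the product over pairs of classes of [F]. The diagonal terms vanish, since one class
    cannot lie in both parts; adding them back completes the square. *)
Lemma sum_load_product a b : a != b ->
  \sum_(pi : {ffun 'I_r -> L} | injectiveb pi) load c pi a * load c pi b + (\sum_j csize c j ^ 2) * #|L|.-2 ^_ r.-2 =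
  (\sum_j csize c j) ^ 2 * #|L|.-2 ^_ r.-2.
Proof.
move=> ab; rewrite -mulnn big_distrlr /= -[X in _ = X * _](eq_bigr _ (fun j _ => erefl)).
rewrite (eq_bigr (fun pi : {ffun 'I_r -> L} => \sum_j \sum_(j' | (pi j == a) && (pi j' == b)) csize c j * csize c j')); last first.
  move=> pi _; rewrite /load big_distrlr /= big_mkcond /=; apply: eq_bigr => j _.
  by case: (pi j == a) => //; rewrite big_pred0.
rewrite exchange_big /= !big_distrl -big_split /=; apply: eq_bigr => j _.
rewrite (exchange_big_dep predT) //= [LHS]addnC (bigD1 j) //= big1 ?add0n; last first.
  move=> pi /andP[/injectiveP pinj /andP[/eqP h1 /eqP h2]]; case/eqP: ab; by rewrite -h1 -h2.
rewrite [X in _ = X * _](bigD1 j) //= mulnDl mulnn; congr (_ + _).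
rewrite big_distrl /=; apply: eq_bigr => j' jj'.
rewrite sum_nat_const mulnC; congr (_ * _); rewrite -(@through2E _ L j j' a b) // 1?eq_sym //.
by apply: eq_card => pi; rewrite [LHS]unfold_in inE.
Qed.

End LoadSums.

(* When all parts have size m, slope A B m m is about (A + B - (A - B) ^ 2) * m ^ (A + B - 2). *)
Definition gain_weight (A B : nat) := (A + B + 2 * (A * B) - (A ^ 2 + B ^ 2))%N.
Definition loss_weight (A B : nat) := (A ^ 2 + B ^ 2 - (A + B + 2 * (A * B)))%N.

Section Balancing.
Variables (k r : nat) (c : 'I_k -> 'I_r) (R : realFieldType).
Local Notation K := (k%:R : R).
Hypotheses (csurj : forall j, exists i, c i = j) (csize2 : forall j, (csize c j <= 2)%N)
  (r2 : (2 <= r)%N) (k2 : (2 < k)%N).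

Lemma sum_csize_square : (\sum_j csize c j ^ 2 + 2 * r = 3 * k)%N.
Proof.
rewrite -[in RHS](sum_csize c) big_distrr /= -[X in (_ + 2 * X)%N]card_ord mulnC -sum_nat_const.
rewrite -big_split; apply: eq_bigr => j _ /=.
by have := csize2 j; have := csize_gt0 csurj j; case: csize => [|[|[|]]].
Qed.

(** The first two moments of the loads give the sum of [A + B - (A - B) ^ 2]. With [U] the sum of
    the squared class sizes, it is positive exactly when [U * q < k * q.-1 + k ^ 2]. As
    [U = 3 * k - 2 * r], this is the last hypothesis. *)
Lemma weights_gap q (a b : 'I_q) : a != b -> (r <= q)%N -> (2 * (k - r) * q < k * k.-1)%N ->
  (\sum_(pi : {ffun 'I_r -> 'I_q} | injectiveb pi) loss_weight (load c pi a) (load c pi b) <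
   \sum_(pi : {ffun 'I_r -> 'I_q} | injectiveb pi) gain_weight (load c pi a) (load c pi b))%N.
Proof.
move=> ab rq hB.
set T2 := (q.-2 ^_ r.-2)%N; set U := (\sum_j csize c j ^ 2)%N.
have T20 : (0 < T2)%N by rewrite ffact_gt0; move: r2 rq; clear -r q; lia.
have E1 : (q.-1 ^_ r.-1 = q.-1 * T2)%N.
  have := ffactnS q.-1 r.-2; rewrite (_ : r.-2.+1 = r.-1) //.
  by move: r2; clear -r; lia.
have sumA l : (\sum_(pi : {ffun 'I_r -> 'I_q} | injectiveb pi) load c pi l = k * (q.-1 * T2))%N.
  by rewrite /load sum_types1 sum_csize card_ord E1.
have sumA2 l : (\sum_(pi : {ffun 'I_r -> 'I_q} | injectiveb pi) load c pi l ^ 2 = U * (q.-1 * T2))%N.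
  rewrite (eq_bigr (fun pi : {ffun 'I_r -> 'I_q} => \sum_(j | pi j == l) csize c j ^ 2))%N.
    by rewrite sum_types1 card_ord E1.
  by move=> pi /injectiveP; exact: load_square.
have := sum_load_product c ab; rewrite sum_csize card_ord -/T2 -/U => sumAB.
have key : (\sum_(pi : {ffun 'I_r -> 'I_q} | injectiveb pi) gain_weight (load c pi a) (load c pi b) +
   (U * (q.-1 * T2) + U * (q.-1 * T2)) =
   \sum_(pi : {ffun 'I_r -> 'I_q} | injectiveb pi) loss_weight (load c pi a) (load c pi b) +
   (k * (q.-1 * T2) + k * (q.-1 * T2) + 2 * \sum_(pi : {ffun 'I_r -> 'I_q} | injectiveb pi) load c pi a * load c pi b))%N.
  rewrite -{1}(sumA2 a) -(sumA2 b) -{1}(sumA a) -(sumA b) big_distrr -!big_split /=.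
  by apply: eq_bigr => pi _; rewrite /gain_weight /loss_weight; lia.
have sq := sum_csize_square; rewrite -/U in sq.
have q2 : (2 <= q)%N by apply: leq_trans r2 rq.
have rk : (r <= k)%N.
  by rewrite -(sum_csize c) -[X in (X <= _)%N]card_ord -sum1_card; apply: leq_sum => j _; exact: csize_gt0.
have main : (U * q.-1 + U < k * q.-1 + k ^ 2)%N.
  have -> : U = (k + 2 * (k - r))%N by move: sq rk; clear -r k; lia.
  rewrite -mulnSr prednK ?(ltnW q2) // mulnDl -[X in (_ < _ + X)%N]mulnn.
  have -> : (k * q.-1 + k * k = k * q + k * k.-1)%N.
    have e m n : (0 < m)%N -> (0 < n)%N -> (m * n.-1 + m * m = m * n + m * m.-1)%N.
      by case: m n => [|m] [|n] // _ _ /=; clear; lia.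
    by apply: e; [exact: ltn_trans k2 | exact: ltn_trans q2].
  by rewrite ltn_add2l.
move: key sumAB main; move: (\sum_(pi | _) _)%N (\sum_(pi | _) gain_weight _ _)%N (\sum_(pi | _) loss_weight _ _)%N.
move=> S G Ls key sumAB main.
have := main; rewrite -(ltn_pmul2r T20) !mulnDl -!mulnA.
by move: key sumAB; clear; lia.
Qed.

(** Terms with positive slope are bounded below with the smallest part size, negative ones with the
    largest. This leaves the integer comparison of [weights_gap], made quantitative by
    [gap_bound]. *)
Lemma slope_lower (V : finType) q (P : V -> 'I_q) (t : R) (a b : 'I_q) :
  a != b -> (r <= q)%N -> (2 * (k - r) * q < k * k.-1)%N -> nearly_balanced P (t / 2) ->
  admissible k r q t #|V|%:R ->
  q%:R^-1 ^+ k / 2 * #|V|%:R ^+ k.-2 <=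
  \sum_(pi : {ffun 'I_r -> 'I_q} | injectiveb pi) outer_weight c R pi (fun l => #|part P l|) a b *
     slope (load c pi a) (load c pi b) #|part P a|%:R #|part P b|%:R.
Proof.
move=> ab rq hB hP adm; set x := fun l => #|part P l|.
have [t0 tq q1 tn _] := adm; set n := #|V|%:R in tn adm *.
have n0 : 0 < n by rewrite -(pmulr_rgt0 _ (_ : 0 < t / 2)) ?divr_gt0 //; apply: lt_le_trans tn.
have q0 : (0 < q)%N by apply: leq_trans rq; rewrite ltnW.
have z0 : 0 < q%:R^-1 :> R by rewrite invr_gt0 ltr0n.
have tn2 : t / 2 * n + t / 2 * n = t * n by field.
pose l := (q%:R^-1 - t) * n; pose h := (q%:R^-1 + t) * n.
have l0 : 0 <= l by rewrite mulr_ge0 ?subr_ge0 // ltW.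
have xl j : l <= (x j)%:R - 1.
  have /andP[h1 _] := hP j; move: h1 tn; rewrite /l -/n !mulrBl; move: tn2.
  by set u := _ / 2 * n; set v := t * n; set w := _ * n; clear -csurj csize2 r2 k2 R; lra.
have xh j : (x j)%:R <= h.
  have /andP[_ h1] := hP j; apply: le_trans h1 _; rewrite ler_wpM2r ?(ltW n0) //.
  by rewrite lerD2l ler_pdivrMr // ler_peMr ?(ltW t0) // ler1n.
have xl' j : l <= (x j)%:R by apply: le_trans (xl j) _; rewrite gerBl.
have h0 : 0 <= h by apply: le_trans (xh a).
have pow j i : l ^+ csize c i <= ((x j) ^_ csize c i)%:R <= h ^+ csize c i.
  rewrite (ffact1_2 R (x j) (csize2 i)); have := csize2 i; have := csize_gt0 csurj i.
  case: csize => [|[|[|]]] // _ _; first by rewrite !expr1 xl' xh.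
  rewrite !expr2; apply/andP; split; first exact: ler_pM.
  by apply: ler_pM => //; [exact: le_trans (xl j) | rewrite lerBlDr ler_wpDr].
have restb (pi : {ffun 'I_r -> 'I_q}) : l ^+ (\sum_(j | (pi j != a) && (pi j != b)) csize c j) <= outer_weight c R pi x a b <=
     h ^+ (\sum_(j | (pi j != a) && (pi j != b)) csize c j).
  rewrite /outer_weight -!prodrXr; apply/andP; split; apply: ler_prod => j _; have /andP[h1 h2] := pow (pi j) j.
    by rewrite exprn_ge0.
  by rewrite ler0n.
have total (pi : {ffun 'I_r -> 'I_q}) :
    (\sum_(j | (pi j != a) && (pi j != b)) csize c j + load c pi a + load c pi b = k)%N.
  have := sum_csize c; rewrite (bigID (fun j => pi j == a)) /= (bigID (fun j => pi j == b) (fun j => pi j != a)) /=.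
  move=> e; rewrite -[RHS]e -addnA addnC -addnA; congr (_ + (_ + _))%N.
  by apply: eq_bigl => j; have [->|] := eqVneq (pi j) b; rewrite ?andbF // andbT eq_sym (negbTE ab).
set Gs := (\sum_(pi : {ffun 'I_r -> 'I_q} | injectiveb pi) gain_weight (load c pi a) (load c pi b))%N.
set Ls := (\sum_(pi : {ffun 'I_r -> 'I_q} | injectiveb pi) loss_weight (load c pi a) (load c pi b))%N.
have each (pi : {ffun 'I_r -> 'I_q}) : injectiveb pi ->
    (gain_weight (load c pi a) (load c pi b))%:R * l ^+ k.-2 - (loss_weight (load c pi a) (load c pi b))%:R * h ^+ k.-2 <=
    outer_weight c R pi x a b * slope (load c pi a) (load c pi b) (x a)%:R (x b)%:R.
  move=> /injectiveP pinj.
  have [_ la] := prod_load csize2 0 a pinj; have [_ lb] := prod_load csize2 0 b pinj.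
  move: la lb (restb pi) (total pi); set m := (\sum_(j | _) _)%N.
  have r0 : 0 <= outer_weight c R pi x a b by apply: prodr_ge0 => j _.
  move: (load c pi a) (load c pi b) (outer_weight _ _ _ _ _ _) r0 => A B rs rs0 + + /andP[rl rh].
  have xa := xl a; have xb := xl b; have xa' := xl' a; have xb' := xl' b.
  move: (x a)%:R (x b)%:R xa xb xa' xb' => X Y xa xb xa' xb'.
  have lm : 0 <= l ^+ m by rewrite exprn_ge0.
  clearbody l h.
  (* The slope has degree [A + B - 2] in the part sizes and the outer weight has degree [k - A - B],
     so every nonzero term has degree [k.-2]. *)
  case: A => [|[|[|]]] //; case: B => [|[|[|]]] // _ _; rewrite /slope /gain_weight /loss_weight /= => mk;
    rewrite ?mul0r ?mulr0 ?subr0 ?sub0r //.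
  - rewrite (_ : k.-2 = m); last by move: mk; clear; lia.
    by rewrite mulrN lerN2 mulrC ler_wpM2l.
  - rewrite (_ : k.-2 = m); last by move: mk; clear; lia.
    by rewrite mulrC ler_wpM2r.
  - rewrite (_ : k.-2 = m.+1); last by move: mk; clear; lia.
    rewrite -[X in X%:R * _]/2%N exprSr mulrCA ler_pM ?mulr_ge0 //.
    by move: xa xb; clear -csurj csize2 r2 k2 R; lra.
  - rewrite (_ : k.-2 = m); last by move: mk; clear; lia.
    by rewrite mulrN lerN2 mulrC ler_wpM2l.
  - rewrite (_ : k.-2 = m.+1); last by move: mk; clear; lia.
    rewrite -[X in X%:R * _]/2%N exprSr mulrCA ler_pM ?mulr_ge0 //.
    by move: xa xb; clear -csurj csize2 r2 k2 R; lra.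
  - rewrite (_ : k.-2 = m.+2); last by move: mk; clear; lia.
    rewrite -[X in X%:R * _]/4%N exprSr exprSr -mulrA mulrCA ler_pM ?mulr_ge0 //.
    by rewrite [leRHS]mulrAC -[leRHS]mulrA ler_wpM2l // mulrC ler_pM.
apply: le_trans (ler_sum _ each).
rewrite sumrB -!mulr_suml -!natr_sum -/Gs -/Ls /l /h !exprMn !mulrA -mulrBl.
rewrite ler_wpM2r ?exprn_ge0 ?(ltW n0) // lerBrDl.
have k2k : (k.-2 <= k)%N by apply: leq_trans (leq_pred _) (leq_pred _).
apply: le_trans (@gap_bound R k r Gs Ls q k.-2 t n _ _ k2k q0 adm) _.
- exact: weights_gap.
- apply: (@leq_trans (\sum_(pi : {ffun 'I_r -> 'I_q} | injectiveb pi) 4)%N).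
    apply: leq_sum => pi /injectiveP pinj.
    have [_ la] := prod_load csize2 0 a pinj; have [_ lb] := prod_load csize2 0 b pinj.
    move: (load c pi a) (load c pi b) la lb; case=> [|[|[|]]] //; by case=> [|[|[|]]].
  rewrite sum_nat_const mulnC (_ : #|_| = q ^_ r)%N.
    by apply: scale_bound_le => //; apply: (@leq_trans (2 * 3 ^ 2)) => //; rewrite leq_mul2l leq_sqr.
  by rewrite -[in RHS](card_ord q) -card_injections; apply: eq_card => pi; rewrite inE.
by rewrite ler_wpM2l // lerBlDr lerDl divr_ge0 ?exprn_ge0 // ltW.
Qed.

End Balancing.

Lemma part_recolour (V : finType) (L : eqType) (P : V -> L) u b l : P u != b ->
  #|part (recolour P u b) l| = transfer (fun l => #|part P l|) (P u) b l.
Proof.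
move=> ub; rewrite /transfer; have [->|la] := eqVneq l (P u).
  rewrite (cardsD1 u (part P (P u))) inE eqxx /=; apply: eq_card => x.
  by rewrite !inE /recolour; have [_|] := eqVneq x u; rewrite //= eq_sym (negbTE ub).
have [->|lb] := eqVneq l b.
  have uP : u \notin part P b by rewrite inE.
  have := cardsU1 u (part P b); rewrite uP add1n => <-; apply: eq_card => x.
  by rewrite !inE /recolour; have [_|] := eqVneq x u; rewrite //= eqxx.
apply: eq_card => x; rewrite !inE /recolour; have [->|//] := eqVneq x u.
by rewrite eq_sym (negbTE lb) eq_sym (negbTE la).
Qed.

Lemma gdiff_recolour (V : finType) (L : eqType) (P : V -> L) u b :
  (#|gdiff (cmg (recolour P u b)) (cmg P)| <= 2 * #|V|)%N.
Proof. by apply: (@gdiff_off _ _ _ u) => x y xu yu; rewrite !cmgE /recolour (negbTE xu) (negbTE yu). Qed.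

Lemma twins_cmg (V L : finType) (P : V -> L) : twins (cmg P) = (\sum_l #|part P l| ^ 2)%N.
Proof.
rewrite /twins card_pairs (partition_big P predT) //=; apply: eq_bigr => l _.
rewrite -mulnn -sum_nat_const; apply: eq_big => [x|x /eqP xl]; first by rewrite inE.
apply: eq_card => y; rewrite !inE /same_nb /=; apply/forallP/eqP => [/(_ x)|yl w].
  by rewrite !cmgE eqxx => /eqP/esym/negbFE/eqP ->.
by rewrite !cmgE xl yl.
Qed.

Section Steps.
Variables (k r : nat) (c : 'I_k -> 'I_r).

Lemma measure_lt_of_copies (V : finType) (G G' : {set V * V}) :
  (copies c G < copies c G')%N -> (zykov_measure c G < zykov_measure c G')%N.
Proof.
have tw : (twins G <= #|V| ^ 2)%N by rewrite -mulnn -card_prod; exact: max_card.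
rewrite /zykov_measure => h; apply: (@leq_trans ((copies c G).+1 * (#|V| ^ 2).+1)).
  by rewrite mulSn addnC ltn_add2r ltnS.
by apply: leq_trans (leq_addr _ _); rewrite leq_mul2r h orbT.
Qed.

Variable R : realFieldType.
Hypotheses (csurj : forall j, exists i, c i = j) (csize2 : forall j, (csize c j <= 2)%N) (k0 : (0 < k)%N).

Definition slope_sum (V L : finType) (P : V -> L) a b : R :=
  \sum_(pi : {ffun 'I_r -> L} | injectiveb pi) outer_weight c R pi (fun l => #|part P l|) a b *
     slope (load c pi a) (load c pi b) #|part P a|%:R #|part P b|%:R.

Lemma copies_recolour (V L : finType) (P : V -> L) u b : P u != b ->
  2 * ((copies c (cmg (recolour P u b)))%:R - (copies c (cmg P))%:R) =
  (#|part P (P u)|%:R - #|part P b|%:R - 1) * slope_sum P (P u) b.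
Proof.
move=> ub; rewrite !(copies_cmg csurj k0).
rewrite (_ : embeddings c _ = embeddings c (transfer (fun l => #|part P l|) (P u) b)).
  by apply: embeddings_transfer => //; apply/card_gt0P; exists u; rewrite inE.
by apply: eq_bigr => pi _; apply: eq_bigr => j _; rewrite part_recolour.
Qed.

(** Only the loads [2, 2] distinguish the order of the parts, by
    [(X - 1) * Y - (Y - 1) * X = X - Y]. *)
Lemma slope_sum_swap (V L : finType) (P : V -> L) a b : (#|part P b| <= #|part P a|)%N ->
  slope_sum P b a <= slope_sum P a b.
Proof.
move=> ba; apply: ler_sum => pi /injectiveP pinj.
have [_ la] := prod_load csize2 0 a pinj; have [_ lb] := prod_load csize2 0 b pinj.
have -> : outer_weight c R pi (fun l => #|part P l|) b a = outer_weight c R pi (fun l => #|part P l|) a b.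
  by apply: eq_bigl => j; rewrite andbC.
have r0 : 0 <= outer_weight c R pi (fun l => #|part P l|) a b by apply: prodr_ge0.
apply: ler_wpM2l => //; move: ba; rewrite -(ler_nat R).
move: (load c pi a) (load c pi b) la lb (#|part P a|%:R) (#|part P b|%:R) => A B + + X Y.
case: A => [|[|[|]]] //; case: B => [|[|[|]]] // _ _ XY; rewrite /slope //.
- by rewrite [Y + X]addrC.
- by rewrite [Y + X]addrC.
by move: XY; clear -csurj csize2 k0 R; lra.
Qed.

(* If moving a vertex to the smaller part gains nothing, then moving it to the larger part
   loses nothing, because slope_sum P b a <= slope_sum P a b; this creates twins. *)
Lemma unbalanced_step (V L : finType) (P : V -> L) a b :
  (0 < #|part P b|)%N -> (#|part P b| + 2 <= #|part P a|)%N ->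
  exists G', [/\ sgraph G', #|gdiff G' (cmg P)| <= 2 * #|V| & zykov_measure c (cmg P) < zykov_measure c G']%N.
Proof.
move=> b0 ba.
have ab : a != b by apply/eqP => e; rewrite e in ba; lia.
have [u /eqP ua] : exists u, P u == a.
  have /card_gt0P[u] : (0 < #|part P a|)%N by apply: leq_trans ba; rewrite addn2.
  by rewrite inE; exists u.
have [v /eqP vb] : exists v, P v == b by have /card_gt0P[v] := b0; rewrite inE => h; exists v.
have [pos|neg] := ltrP 0 (slope_sum P a b).
  exists (cmg (recolour P u b)); split; [exact: cmg_sgraph|exact: gdiff_recolour|].
  have ub : P u != b by rewrite ua.
  apply: measure_lt_of_copies; rewrite -(ltr_nat R) -subr_gt0 -(pmulr_rgt0 _ (_ : 0 < 2)) // copies_recolour //.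
  rewrite ua mulr_gt0 //; move: ba; rewrite -(ler_nat R) natrD.
  by clear -csurj csize2 k0 R; lra.
exists (cmg (recolour P v a)); split; [exact: cmg_sgraph|exact: gdiff_recolour|].
have va : P v != a by rewrite vb eq_sym.
have h1 : (copies c (cmg P) <= copies c (cmg (recolour P v a)))%N.
  rewrite -(ler_nat R) -subr_ge0 -(pmulr_rge0 _ (_ : 0 < 2)) // copies_recolour // vb.
  have ba' : (#|part P b| <= #|part P a|)%N by apply: leq_trans ba; exact: leq_addr.
  apply: mulr_le0; last by apply: le_trans neg; exact: slope_sum_swap.
  move: ba'; rewrite -(ler_nat R).
  by clear -csurj csize2 k0 R; lra.
have h2 : (twins (cmg P) < twins (cmg (recolour P v a)))%N.
  rewrite !twins_cmg (bigD1 a) //= (bigD1 b) 1?eq_sym //= [ltnRHS](bigD1 a) //= [X in (_ < _ + X)%N](bigD1 b) 1?eq_sym //=.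
  rewrite (eq_bigr (fun l => #|part (recolour P v a) l| ^ 2))%N => [|l /andP[la lb]]; last first.
    by rewrite part_recolour // vb /transfer (negbTE la) (negbTE lb).
  rewrite !part_recolour // vb /transfer eqxx (negbTE ab) eqxx !addnA ltn_add2r.
  move: b0 ba; clear -csurj; case: #|part P b| => // y _; rewrite /= -!mulnn; nia.
by rewrite /zykov_measure -addnS leq_add // leq_mul2r h1 orbT.
Qed.

End Steps.

(** One tolerance has to serve all [q <= Q]; the worst case is [q = Q], except for the condition
    [q^-1 + t <= 1], which uses [2 <= q]. *)
Lemma admissible_exists (R : realFieldType) k r Q : (0 < Q)%N -> exists tau n1 : R,
  [/\ 0 < tau, tau <= Q%:R^-1 & forall q n, (2 <= q <= Q)%N -> n1 <= n -> admissible k r q tau n].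
Proof.
move=> Q0; pose S : R := (scale_bound k r Q)%:R; pose y : R := Q%:R^-1 ^+ k / 4.
have Z0 : 0 < Q%:R^-1 :> R by rewrite invr_gt0 ltr0n.
have y0 : 0 < y by rewrite divr_gt0 // exprn_gt0.
have h2 : 0 < 2^-1 :> R by rewrite invr_gt0.
have [t [t0 /and4P[t1 t2 t3 _]]] : exists x : R, 0 < x /\ all (fun p => p.1 * x <= p.2)
    [:: (1, Q%:R^-1); (1, 2^-1); (S * (2 * k%:R), y)].
  by apply: small_exists; rewrite /= Z0 y0 h2 ler01 !mulr_ge0.
have t02 : 0 < t / 2 by rewrite divr_gt0.
have [n1 [n10 hn]] : exists x : R, 0 < x /\ forall z, x <= z -> all (fun p => p.2 <= p.1 * z)
    [:: (t / 2, 1); (y, S * k%:R ^+ 2); (1, 1)].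
  by apply: large_exists; rewrite /= t02 y0 ltr01 ler01 mulr_ge0 // exprn_ge0.
rewrite !mul1r in t1 t2; exists t, n1; split=> // q n /andP[q2 qQ] /hn/and4P[n2 n3 n4 _].
have n0 : 0 < n by rewrite mul1r in n4; apply: lt_le_trans n4.
have q0 : (0 < q)%N by rewrite (ltn_trans _ q2).
have zq : Q%:R^-1 <= q%:R^-1 :> R by rewrite lef_pV2 ?posrE ?ltr0n // ler_nat.
have z2 : q%:R^-1 <= 2^-1 :> R by rewrite lef_pV2 ?posrE ?ltr0n // (ler_nat R 2).
split=> //; first exact: le_trans zq.
  by have := lerD z2 t2; rewrite (_ : 2^-1 + 2^-1 = 1 :> R) //; field.
apply: (@le_trans _ _ (S * (2 * k%:R * t + k%:R ^+ 2 / n))).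
  rewrite ler_wpM2r ?addr_ge0 ?mulr_ge0 ?invr_ge0 ?exprn_ge0 ?(ltW t0) ?(ltW n0) //.
  have mono m : (q.+1 ^ m <= Q.+1 ^ m)%N by case: m => // m; rewrite leq_exp2r.
  by rewrite /S ler_nat leq_mul2l mono orbT.
apply: (@le_trans _ _ (Q%:R^-1 ^+ k / 2)); last first.
  by rewrite ler_wpM2r ?invr_ge0 // lerXn2r ?nnegrE ?invr_ge0.
rewrite mulrDr (_ : Q%:R^-1 ^+ k / 2 = y + y); last by rewrite /y; field.
by apply: lerD; rewrite mulrA // ler_pdivrMr.
Qed.

(** Each part is compared with the average, which is [#|V| / q]. *)
Lemma close_parts (R : realFieldType) (V : finType) q (P : V -> 'I_q) (t : R) : (0 < q)%N ->
  (forall a b, #|part P a|%:R <= #|part P b|%:R + t * #|V|%:R) -> nearly_balanced P t.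
Proof.
move=> q0 ev j; have q0' : 0 < q%:R :> R by rewrite ltr0n.
have e : q%:R * (q%:R^-1 * #|V|%:R) = #|V|%:R :> R by rewrite mulrA mulfV ?mul1r // gt_eqF.
have sumP : #|V|%:R = \sum_i #|part P i|%:R :> R by rewrite -natr_sum sum_part.
have q1 (y : R) : q%:R * y = \sum_(i < q) y by rewrite sumr_const card_ord mulr_natl.
have h1 : q%:R * #|part P j|%:R <= #|V|%:R + q%:R * (t * #|V|%:R).
  by rewrite !q1 {1}sumP -big_split /=; apply: ler_sum => i _; exact: ev.
have h2 : #|V|%:R <= q%:R * (#|part P j|%:R + t * #|V|%:R).
  by rewrite q1 {1}sumP; apply: ler_sum => i _; exact: ev.
rewrite mulrDr in h2; apply/andP; split; rewrite -(ler_pM2l q0').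
  by rewrite mulrBl mulrBr e lerBlDr.
by rewrite mulrDl mulrDr e.
Qed.

Lemma even_parts (R : realFieldType) (V : finType) q (P : V -> 'I_q) (t : R) : (0 < q)%N ->
  (forall a b, #|part P a| <= #|part P b| + 1)%N -> 1 <= t * #|V|%:R -> nearly_balanced P t.
Proof.
move=> q0 ev tn; apply: close_parts => // a b; apply: (@le_trans _ _ (#|part P b|%:R + 1)).
  by rewrite natr1 -addn1 ler_nat.
by rewrite lerD2l.
Qed.

(** * The number of parts of a nearly extremal graph *)

Section Totals.
Variables (k r : nat) (c : 'I_k -> 'I_r) (R : realFieldType).
Local Notation K := (k%:R : R).
Hypotheses (csurj : forall j, exists i, c i = j).

Lemma pinned_types0 (V L : finType) (P : V -> L) z : #|pinned_types c P set0 z| = (#|L| ^_ r)%N.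
Proof.
rewrite -card_injections; apply: eq_card => pi; rewrite !inE.
by rewrite (_ : [forall _, _]) ?andbT //; apply/forallP => i; rewrite inE.
Qed.

Lemma copies_pinned (V : finType) (G : {set V * V}) z :
  copies c G = #|[set f | pinned set0 z f && copy c G f]|.
Proof.
by apply: eq_card => f; rewrite !inE (_ : pinned _ _ _) //; apply/pinnedP => i; rewrite inE.
Qed.

Lemma copies_upper (V L : finType) (P : V -> L) (H : R) : (0 < #|V|)%N ->
  0 <= H -> (forall l, #|part P l|%:R <= H) ->
  (copies c (cmg P))%:R <= (#|L| ^_ r)%:R * H ^+ k.
Proof.
move=> /card_gt0P[x0 _] H0 hH; rewrite (copies_pinned _ [ffun=> x0]).
apply: le_trans (pinned_upper csurj _ _ H0 hH) _.
by rewrite pinned_types0 setC0 cardsT card_ord.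
Qed.

Lemma copies_lower (V L : finType) (P : V -> L) (lo : R) : (0 < #|V|)%N ->
  0 <= lo -> (forall l, lo * #|V|%:R <= #|part P l|%:R) ->
  (#|L| ^_ r)%:R * ((lo ^+ k - K ^+ 2 / #|V|%:R) * #|V|%:R ^+ k) <= (copies c (cmg P))%:R.
Proof.
move=> V0 lo0 hlo; have /card_gt0P[x0 _] := V0; rewrite (copies_pinned _ [ffun=> x0]).
have n0 : 0 < #|V|%:R :> R by rewrite ltr0n.
apply: le_trans (pinned_lower csurj lo0 n0 hlo _); last by move=> i j; rewrite inE.
by rewrite pinned_types0 setC0 cardsT card_ord.
Qed.

(** The balanced graph with [q'] parts has at most [M] copies, and the given one nearly attains [M].
    Rounding moves part densities by at most [n^-1], which accounts for the error of order
    [n^-1]. *)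
Lemma turan_compare (V : finType) q q' (P : V -> 'I_q) M (delta : R) :
  (0 < q')%N -> (q' <= #|V|)%N -> (2 <= q)%N -> (2 <= #|V|)%N ->
  extremal_bound c V M -> near_extremal c M delta (cmg P) ->
  (forall a b, #|part P a| <= #|part P b| + 1)%N ->
  turan_density R k r q' <= turan_density R k r q + delta +
    ((q ^_ r)%:R * K + (q' ^_ r)%:R * (K + K ^+ 2)) / #|V|%:R.
Proof.
move=> q'0 q'n q2 n2 GM hP ev; set n := #|V|%:R.
have V0 : (0 < #|V|)%N by apply: leq_trans n2.
have n0 : 0 < n by rewrite ltr0n.
have nn : n^-1 * n = 1 by rewrite mulVf // gt_eqF.
have q0 : (0 < q)%N by apply: leq_trans q2.
have z0 : 0 <= q%:R^-1 :> R by rewrite invr_ge0.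
have ni0 : 0 <= n^-1 by rewrite invr_ge0 ltW.
have nb : nearly_balanced P n^-1 by apply: even_parts; rewrite ?nn.
have up : (copies c (cmg P))%:R <= (q ^_ r)%:R * ((q%:R^-1 + n^-1) * n) ^+ k.
  have H0 : 0 <= (q%:R^-1 + n^-1) * n by rewrite mulr_ge0 ?addr_ge0 // ltW.
  have := copies_upper (P := P) V0 H0; rewrite card_ord; apply.
  by move=> l; have /andP[] := nb l.
have [P' hP'] := balanced_colouring V q'0.
have ni' : n^-1 <= q'%:R^-1 by rewrite lef_pV2 ?posrE ?ltr0n // ler_nat.
have low : (q' ^_ r)%:R * (((q'%:R^-1 - n^-1) ^+ k - K ^+ 2 / n) * n ^+ k) <= M%:R.
  apply: (@le_trans _ _ (copies c (cmg P'))%:R); last by rewrite ler_nat; apply: GM; exact: cmg_sgraph.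
  have := copies_lower (P := P') (lo := q'%:R^-1 - n^-1) V0; rewrite card_ord; apply.
    by rewrite subr_ge0.
  move=> l; apply: (@le_trans _ _ (#|V| %/ q')%:R); last by rewrite ler_nat.
  have : (#|V| < (#|V| %/ q').+1 * q')%N by rewrite ltn_ceil.
  rewrite -(ltr_nat R) natrM -natr1 mulrBl nn lerBlDr -/n => /ltW h.
  by rewrite mulrC ler_pdivrMr ?ltr0n.
have h1 := expr_ge_sub k ni0 ni' _.
have {}h1 : q'%:R^-1 ^+ k - K / n <= (q'%:R^-1 - n^-1) ^+ k.
  by apply: h1; rewrite invf_le1 ?ltr0n // ler1n.
have h2 : (q%:R^-1 + n^-1) ^+ k <= q%:R^-1 ^+ k + K / n.
  apply: expr_le_add => //.
  have : q%:R^-1 <= 2^-1 :> R by rewrite lef_pV2 ?posrE ?ltr0n // (ler_nat R 2).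
  have : n^-1 <= 2^-1 :> R by rewrite lef_pV2 ?posrE ?ltr0n // (ler_nat R 2).
  by clear -csurj R; lra.
have nk : 0 < n ^+ k by rewrite exprn_gt0.
have F0 m : 0 <= (m ^_ r)%:R :> R by [].
have h3 : (q' ^_ r)%:R * ((q'%:R^-1 - n^-1) ^+ k - K ^+ 2 / n) <= (q ^_ r)%:R * (q%:R^-1 + n^-1) ^+ k + delta.
  rewrite -(ler_pM2r nk) -mulrA; apply: le_trans low _; apply: le_trans hP _.
  by rewrite mulrDl lerD2r -mulrA -exprMn.
have h4 := ler_wpM2l (F0 q') h1; have h5 := ler_wpM2l (F0 q) h2.
rewrite /turan_density -!exprVn.
rewrite [in leRHS]mulrDl -!mulrA mulrDl.
move: h3 h4 h5; rewrite !mulrBr !mulrDr -!mulrA.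
set a1 := _ * (_ - _) ^+ k; set a2 := _ * (K * (K / n)); set a3 := _ * (_ + _) ^+ k.
set a4 := _ * _ ^+ k; set a5 := _ * _ ^+ k; set a6 := _ * (K / n); set a7 := _ * (K / n).
by clear -csurj R; lra.
Qed.

End Totals.

Lemma nearly_balanced_le (R : realFieldType) (V : finType) q (P : V -> 'I_q) (t t' : R) :
  t <= t' -> nearly_balanced P t -> nearly_balanced P t'.
Proof.
move=> tt hP j; have /andP[h1 h2] := hP j; apply/andP; split.
  by apply: le_trans h1; rewrite ler_wpM2r // lerD2l lerN2.
by apply: le_trans h2 _; rewrite ler_wpM2r // lerD2l.
Qed.

Lemma nearly_balanced_moved (R : realFieldType) (V : finType) q (P P0 : V -> 'I_q) (t t' : R) :
  nearly_balanced P0 t -> #|[set x | P x != P0 x]|%:R <= t' * #|V|%:R -> nearly_balanced P (t + t').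
Proof.
move=> hP h j; have /andP[h1 h2] := hP j; have := part_moved P P0 j; have := part_moved P0 P j.
rewrite (_ : [set x | P0 x != P x] = [set x | P x != P0 x]); last by apply/setP => x; rewrite !inE eq_sym.
rewrite -!(ler_nat R) !natrD => h3 h4; apply/andP; split.
  move: h1 h4 h; rewrite !mulrBl mulrDl.
  by move: (_ * _) (t * _) (t' * _) => *; lra.
move: h2 h3 h; rewrite !mulrDl.
by move: (_ * _) (t * _) (t' * _) => *; lra.
Qed.

Section SinglesMain.
Variables (k r : nat) (c : 'I_k -> 'I_r) (R : archiRealFieldType).
Local Notation K := (k%:R : R).
Variables (i1 : 'I_r).
Hypotheses (i1_big : (2 <= #|[set i | c i == i1]|)%N) (csurj : forall j, exists i, c i = j)
  (r2 : (2 <= r)%N) (k2 : (2 < k)%N) (csize2 : forall j, (csize c j <= 2)%N).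

Lemma parts_lt : (r < k)%N.
Proof.
rewrite -[ltnRHS](sum_csize c) -[ltnLHS]card_ord -sum1_card (bigD1 i1) //= [ltnRHS](bigD1 i1) //=.
rewrite -addSn leq_add //; apply: leq_sum => j _; exact: csize_gt0.
Qed.

(** If one of the last two inequalities failed, then [q + 1] or [q - 1] balanced parts would have a
    density larger by a fixed margin, by [turan_more_parts] or [turan_fewer_parts] and [finite_gap].
    This contradicts [turan_compare]. *)
Lemma near_extremal_balanced (cM : R) : 0 < cM -> exists Q (delta n0 : R),
  [/\ (0 < Q)%N, 0 < delta & forall (V : finType) M q (P : V -> 'I_q), n0 <= #|V|%:R ->
    extremal_bound c V M -> cM * #|V|%:R ^+ k <= M%:R -> near_extremal c M delta (cmg P) ->
    (forall j, 0 < #|part P j|)%N -> (forall a b, #|part P a| <= #|part P b| + 1)%N ->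
    [/\ (r <= q)%N, (q <= Q)%N, (singles c * q < k * (q - r).+1)%N & (2 * (k - r) * q < k * k.-1)%N]].
Proof.
(* With [q] nearly equal parts the density is at most [q ^_ r * (2 / q) ^+ k], hence at most
   [2 ^+ k / q] because [r < k]. It is at least [cM / 4], so [q <= y]. *)
move=> cM0; pose y : R := 2 ^+ k * 4 / cM; have y0 : 0 < y by rewrite divr_gt0 // mulr_gt0 // exprn_gt0.
pose Q := Num.bound y.
have yQ : y < Q%:R by rewrite archi_boundP // ltW.
have Q0 : (0 < Q)%N by rewrite -(ltr0n R); apply: lt_trans yQ.
have [d1 [d10 h1]] := finite_gap (fun q => turan_density R k r q.+1 - turan_density R k r q) Q.
have [d2 [d20 h2]] := finite_gap (fun q => turan_density R k r q.-1 - turan_density R k r q) Q.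
pose B : R := (Q.+1 ^ r)%:R * (2 * K + K ^+ 2).
have B0 : 0 <= B by rewrite mulr_ge0 // addr_ge0 ?mulr_ge0 ?exprn_ge0.
have cM2 : 0 < cM / 2 by rewrite divr_gt0.
have [delta [delta0 /and4P[e1 e2 e3 _]]] : exists x : R, 0 < x /\
    all (fun p => p.1 * x <= p.2) [:: (1, cM / 4); (4, d1); (4, d2)].
  by apply: small_exists; rewrite /= ler01 d10 d20 !ler0n divr_gt0.
have [n0 [n00 hn]] : exists x : R, 0 < x /\ forall z, x <= z -> all (fun p => p.2 <= p.1 * z)
    [:: (1, 2); (1, Q.+1%:R); (d1 / 4, B); (d2 / 4, B)].
  by apply: large_exists; rewrite /= ltr01 !ler0n B0 !divr_gt0.
exists Q, delta, n0; split=> // V M q P /hn/and5P[].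
set n := #|V|%:R; rewrite !mul1r in e1 * => n2 nQ hB1 hB2 _ GM hM hP ne ev.
have n0' : 0 < n by apply: lt_le_trans n2.
have nk : 0 < n ^+ k by rewrite exprn_gt0.
have n2' : (2 <= #|V|)%N by rewrite -(ler_nat R).
have nQ' : (Q.+1 <= #|V|)%N by rewrite -(ler_nat R).
have V0 : (0 < #|V|)%N by apply: leq_trans n2'.
have q0 : (0 < q)%N by have /card_gt0P[x _] := V0; apply: leq_ltn_trans (ltn_ord (P x)).
have q0' : 0 < q%:R :> R by rewrite ltr0n.
have qn : (q <= #|V|)%N.
  by rewrite -(sum_part P) -[X in (X <= _)%N]card_ord -sum1_card; apply: leq_sum => j _; exact: ne.
have N0 : cM / 4 * n ^+ k <= (copies c (cmg P))%:R.
  have : delta * n ^+ k <= cM / 4 * n ^+ k by rewrite ler_wpM2r // ltW.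
  have : 0 <= cM * n ^+ k by rewrite mulr_ge0 // ltW.
  have -> : cM / 4 * n ^+ k = cM * n ^+ k / 4 by field.
  move: hM hP; rewrite /near_extremal -/n; clear -i1_big csurj r2 k2 csize2 R; lra.
have ni0 : 0 <= n^-1 by rewrite invr_ge0 ltW.
have up : (copies c (cmg P))%:R <= (q ^_ r)%:R * ((q%:R^-1 + n^-1) * n) ^+ k.
  have H0 : 0 <= (q%:R^-1 + n^-1) * n by rewrite mulr_ge0 ?addr_ge0 ?invr_ge0 ?ler0n // ltW.
  have := copies_upper csurj (P := P) V0 H0; rewrite card_ord; apply.
  have nb : nearly_balanced P n^-1 by apply: even_parts; rewrite ?mulVf // gt_eqF.
  by move=> l; have /andP[] := nb l.
have rq : (r <= q)%N.
  rewrite -ffact_gt0 lt0n; apply/eqP => e; move: up; rewrite e mul0r leNgt.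
  by rewrite (lt_le_trans _ N0) // mulr_gt0 // divr_gt0.
have qQ : (q <= Q)%N.
  rewrite -(ler_nat R); apply: le_trans (ltW yQ); rewrite ler_pdivlMr //.
  have h3 : cM / 4 <= (q ^_ r)%:R * (q%:R^-1 + n^-1) ^+ k.
    by rewrite -(ler_pM2r nk); apply: le_trans N0 _; rewrite -mulrA -exprMn.
  have h4 : (q%:R^-1 + n^-1) ^+ k <= 2 ^+ k * q%:R^-1 ^+ k.
    rewrite -exprMn lerXn2r ?nnegrE ?addr_ge0 ?mulr_ge0 ?invr_ge0 ?ler0n //.
    by rewrite mulrDl mul1r lerD2l lef_pV2 ?posrE // ler_nat.
  have h5 : q%:R * (q ^_ r)%:R <= q%:R ^+ k :> R.
    rewrite -natrX -natrM ler_nat; apply: (@leq_trans (q ^ r.+1)).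
      by rewrite expnS leq_mul2l ffact_le_exp orbT.
    by rewrite leq_pexp2l // parts_lt.
  have h6 : q%:R * cM / 4 <= 2 ^+ k.
    apply: (@le_trans _ _ (q%:R * ((q ^_ r)%:R * (2 ^+ k * q%:R^-1 ^+ k)))).
      by rewrite -mulrA ler_wpM2l // (le_trans h3) // ler_wpM2l.
    rewrite mulrA mulrCA ger_pMr ?exprn_gt0 // exprVn ler_pdivrMr ?exprn_gt0 //.
    by rewrite mul1r.
  by rewrite -ler_pdivrMr.
have q2 : (2 <= q)%N by apply: leq_trans rq.
have err q' : (q' <= Q.+1)%N -> ((q ^_ r)%:R * K + (q' ^_ r)%:R * (K + K ^+ 2)) <= B.
  move=> q'Q; have le m : (m <= Q.+1)%N -> (m ^_ r)%:R <= (Q.+1 ^ r)%:R :> R.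
    move=> mQ; rewrite ler_nat; apply: leq_trans (ffact_le_exp _ _) _.
    by rewrite leq_exp2r // (ltn_trans _ r2).
  rewrite /B (_ : 2 * K + K ^+ 2 = K + (K + K ^+ 2)); last by ring.
  by rewrite [leRHS]mulrDr lerD // ler_wpM2r ?addr_ge0 ?exprn_ge0 ?ler0n // le // leqW.
have best q' d : (0 < q')%N -> (q' <= Q.+1)%N -> 4 * delta <= d -> B <= d / 4 * n -> 0 < d ->
    turan_density R k r q' - turan_density R k r q < d.
  move=> q'0 q'Q dd Bd d0.
  have := turan_compare csurj q'0 (leq_trans q'Q nQ') q2 n2' GM hP ev.
  have : ((q ^_ r)%:R * K + (q' ^_ r)%:R * (K + K ^+ 2)) / n <= d / 4.
    by rewrite ler_pdivrMr //; apply: le_trans Bd; exact: err.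
  by rewrite -/n; move: dd d0; clear -i1_big csurj r2 k2 csize2 R; lra.
have sK : (singles c)%:R = 2 * r%:R - K.
  by have := congr1 (fun m => m%:R : R) (singles_parts csurj csize2); rewrite natrD natrM => <-; rewrite [K + _]addrC addrK.
have rk := parts_lt.
split=> //; rewrite ltnNge; apply/negP => bad.
  have lt : turan_density R k r q < turan_density R k r q.+1.
    apply: turan_more_parts => //; first exact: ltn_trans r2.
    by move: bad; rewrite -(ler_nat R) !natrM sK -natr1 natrB.
  have := h1 q qQ; rewrite subr_gt0 => /(_ lt); rewrite leNgt => /negP; apply.
  exact: best.
have lt : turan_density R k r q < turan_density R k r q.-1.
  apply: turan_fewer_parts => //.
  by move: bad; rewrite -(ler_nat R) !natrM natrB ?(ltnW rk) // -subn1 natrB // (ltn_trans _ k2).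
have := h2 q qQ; rewrite subr_gt0 => /(_ lt); rewrite leNgt => /negP; apply.
apply: best => //; first by move: q2; clear; case: q => [|[]].
by apply: leq_trans (leq_pred _) _; exact: leqW.
Qed.

(** The penalised maximiser over colourings stays close to [P], hence within the wider tolerance
    [tau / 2], where the slope is positive. If two of its parts differed by more than [tau / 8 * n],
    moving one vertex would gain more than the penalty. *)
Lemma rebalance (tau cV eps : R) : 0 < tau -> 0 < cV -> 0 < eps -> exists delta n0 : R, 0 < delta /\
  forall (V : finType) M q (P0 P : V -> 'I_q), n0 <= #|V|%:R -> (r <= q)%N -> (2 * (k - r) * q < k * k.-1)%N ->
    admissible k r q tau #|V|%:R -> cV <= q%:R^-1 ^+ k / 2 ->
    extremal_bound c V M -> nearly_balanced P0 (tau / 8) ->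
    #|[set x | P x != P0 x]|%:R <= tau / 8 * #|V|%:R -> near_extremal c M delta (cmg P) ->
    exists P' : V -> 'I_q, nearly_balanced P' (tau / 8) /\
      #|gdiff (cmg P) (cmg P')|%:R <= eps * #|V|%:R ^+ 2.
Proof.
move=> tau0 cV0 eps0; pose th := tau / 8; have th0 : 0 < th by rewrite divr_gt0.
pose w := th * cV / 8; have w0 : 0 < w by rewrite divr_gt0 // mulr_gt0.
have we : 0 < w * eps := mulr_gt0 w0 eps0; have wth : 0 < w * th := mulr_gt0 w0 th0.
have [delta [delta0 /and3P[e1 e2 _]]] : exists x : R, 0 < x /\
    all (fun p => p.1 * x <= p.2) [:: (2, w * eps); (1, w * th)].
  by apply: small_exists; rewrite /= ler01 ler0n we wth.
exists delta, (2 / th); split=> // V M q P0 P nn rq hB adm cVq GM nbP0 mv hP; rewrite mul1r in e2.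
set n := #|V|%:R in nn adm mv *.
have n0 : 0 < n by apply: lt_le_trans nn; rewrite divr_gt0.
have thn : 2 <= th * n by rewrite mulrC -ler_pdivrMr.
have kE1 : n ^+ k = n * n ^+ k.-1 by rewrite -exprS prednK // (ltn_trans _ k2).
have kE2 : n ^+ k.-1 = n * n ^+ k.-2 by rewrite -exprS; congr (_ ^+ _); case: k k2 => [|[|]].
have nk1 : 0 < n ^+ k.-1 by rewrite exprn_gt0.
have nk2 : 0 < n ^+ k.-2 by rewrite exprn_gt0.
have W0 : 0 <= w * n ^+ k.-1 by rewrite mulr_ge0 // ltW.
have [P' [h1 h2]] := colouring_ekeland c P W0.
have NM : (copies c (cmg P'))%:R <= M%:R :> R by rewrite ler_nat; apply: GM; exact: cmg_sgraph.
have mv' : w * #|[set x | P' x != P x]|%:R <= delta * n.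
  rewrite -(ler_pM2r nk1) -[leRHS]mulrA -kE1 mulrAC.
  by move: h1 NM hP; rewrite /near_extremal -/n; clear -i1_big csurj r2 k2 csize2 R; lra.
have nbP' : nearly_balanced P' (tau / 2).
  have nbP := nearly_balanced_moved nbP0 mv.
  have : nearly_balanced P' (tau / 8 + tau / 8 + th).
    apply: (nearly_balanced_moved nbP); rewrite -(ler_pM2l w0); apply: le_trans mv' _.
    by rewrite mulrA ler_wpM2r // ltW.
  by apply: nearly_balanced_le; move: tau0; rewrite /th; clear -i1_big csurj r2 k2 csize2 R; lra.
exists P'; split; last first.
  apply: (@le_trans _ _ (2 * n * #|[set x | P' x != P x]|%:R)).
    by rewrite -!natrM ler_nat; exact: gdiff_colourings.
  rewrite -(ler_pM2l w0) (_ : w * (2 * n * _) = 2 * n * (w * #|[set x | P' x != P x]|%:R)); last by ring.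
  apply: (@le_trans _ _ (2 * n * (delta * n))); first by rewrite ler_wpM2l // mulr_ge0 // ltW.
  rewrite (_ : 2 * n * (delta * n) = 2 * delta * n ^+ 2); last by ring.
  by rewrite [leRHS]mulrA ler_wpM2r // exprn_ge0 // ltW.
have q0 : (0 < q)%N by apply: leq_trans rq; apply: ltnW.
apply: close_parts => // a b; rewrite leNgt; apply/negP => big; rewrite -/th -/n in big.
have ab : a != b.
  by apply: contraTneq big => ->; rewrite -leNgt lerDl mulr_ge0 // ltW.
have /card_gt0P[u] : (0 < #|part P' a|)%N.
  by rewrite -(ltr0n R); apply: le_lt_trans big; rewrite addr_ge0 // mulr_ge0 // ltW.
rewrite inE => /eqP ua; have ub : P' u != b by rewrite ua.
have k0 : (0 < k)%N by rewrite (ltn_trans _ k2).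
have g1 := copies_recolour R csurj csize2 k0 ub; rewrite ua in g1.
have g2 := slope_lower csurj csize2 r2 k2 ab rq hB nbP' adm.
have g3 := h2 u b.
have g4 : th * n / 2 * (cV * n ^+ k.-2) <= (#|part P' a|%:R - #|part P' b|%:R - 1) * slope_sum c R P' a b.
  apply: ler_pM.
  - by rewrite divr_ge0 // mulr_ge0 // ltW.
  - by rewrite mulr_ge0 // ltW.
  - by move: big thn; set x := th * n; clear -i1_big csurj r2 k2 csize2 R; lra.
  by apply: le_trans g2; rewrite ler_wpM2r // ltW.
rewrite -g1 in g4.
(* Twice the gain of the move is at least four penalties, whereas maximality allows only two. *)
have g5 : th * n / 2 * (cV * n ^+ k.-2) = 4 * (w * n ^+ k.-1) by rewrite kE2 /w; field.
have : 0 < w * n ^+ k.-1 by rewrite mulr_gt0.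
by move: g3 g4; rewrite g5; clear -i1_big csurj r2 k2 csize2 R; lra.
Qed.

Lemma singles_main : exists C n0 : R, 0 < C /\ forall (V : finType) M (G : {set V * V}), n0 <= #|V|%:R ->
    extremal_bound c V M -> sgraph G -> exists P : V -> V,
      #|gdiff G (cmg P)|%:R * #|V|%:R ^+ k.-2 <= C * (M%:R - (copies c G)%:R).
Proof.
have k0 : (0 < k)%N by rewrite (ltn_trans _ k2).
have r0 : (0 < r)%N by rewrite (ltn_trans _ r2).
have [cM [nM [cM0 hM]]] := extremal_lower c R k0 r0.
have [Q [d0 [nB [Q0 d00 hB]]]] := near_extremal_balanced cM0.
have [tau [nA [tau0 tauQ hadm]]] := admissible_exists R k r Q0.
have th0 : 0 < tau / 8 by rewrite divr_gt0.
have Z0 : 0 < Q%:R^-1 :> R by rewrite invr_gt0 ltr0n.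
pose cV : R := Q%:R^-1 ^+ k / 2; have cV0 : 0 < cV by rewrite divr_gt0 // exprn_gt0.
pose good (V : finType) q (P0 : V -> 'I_q) := [/\ (r <= q)%N, (q <= Q)%N,
  (singles c * q < k * (q - r).+1)%N, (2 * (k - r) * q < k * k.-1)%N & nearly_balanced P0 (tau / 8)].
have adm q n : (r <= q)%N -> (q <= Q)%N -> nA <= n -> admissible k r q tau n.
  by move=> rq qQ; apply: hadm; rewrite qQ andbT (leq_trans r2).
have zle q : (r <= q)%N -> (q <= Q)%N -> Q%:R^-1 <= q%:R^-1 :> R.
  by move=> rq qQ; rewrite lef_pV2 ?posrE ?ltr0n ?(leq_trans r0 rq) // ler_nat.
have cVle q : (r <= q)%N -> (q <= Q)%N -> cV <= q%:R^-1 ^+ k / 2.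
  by move=> rq qQ; rewrite ler_wpM2r ?invr_ge0 // lerXn2r ?nnegrE ?invr_ge0 ?ler0n // zle.
have d1 : 0 < Q%:R^-1 / 2 :> R by rewrite divr_gt0.
apply: (@stability_criterion k r c R i1 i1_big csurj r2 k2 good (Q%:R^-1 / 2) cV cV (tau / 8) nA Q) => //.
- move=> V q P0 nV [rq qQ hA hB' nb].
  have a := adm _ _ rq qQ nV.
  split=> //.
  + move=> j; have /andP[h _] := nb j; apply: le_trans h; rewrite ler_wpM2r //.
    by move: (zle q rq qQ) tauQ tau0; set x := q%:R^-1; set y := Q%:R^-1;
      clear -i1_big csurj r2 k2 csize2 R; lra.
  + have nb2 : nearly_balanced P0 (tau / 2).
      by apply: nearly_balanced_le nb; move: tau0; clear -i1_big csurj r2 k2 csize2 R; lra.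
    move=> u; have [j hj] := universal_balanced csurj r2 k2 rq hA nb2 a u.
    by exists j; apply: le_trans hj; rewrite lerD2l ler_wpM2r ?exprn_ge0 ?cVle.
  + move=> P hP u v uv Puv.
    have nb2 : nearly_balanced P (tau / 2).
      apply: nearly_balanced_le (nearly_balanced_moved nb hP).
      by move: tau0; clear -i1_big csurj r2 k2 csize2 R; lra.
    apply: le_trans (edge_balanced csurj csize2 r2 k2 rq hA nb2 a uv Puv).
    by rewrite lerD2l ler_wpM2r ?exprn_ge0 ?cVle.
(* A multipartite graph with uneven parts admits a further step. An even one is good itself, so its
   distance is 0. *)
- move=> eps eps0; exists d0, (Num.max nM (Num.max nB (8 / tau))); split=> // V M P.
  rewrite !ge_max => /and3P[n1 n2 n3] GM hP.
  have [q [P0 [eP ne]]] := cmg_surjective P; rewrite -eP in hP *.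
  have [/existsP[a /existsP[b ab]]|even] := boolP [exists a, exists b, (#|part P0 b| + 2 <= #|part P0 a|)%N].
    by right; exact: (unbalanced_step R csurj csize2 k0 (ne b) ab).
  have ev a b : (#|part P0 a| <= #|part P0 b| + 1)%N.
    by have := existsPn even a => /existsPn/(_ b); rewrite -ltnNge addn2 addn1 ltnS.
  have [rq qQ hA hB'] := hB V M q P0 n2 GM (hM V M n1 GM) hP ne ev.
  left; exists q, P0; split.
    split=> //; apply: even_parts => //; first exact: leq_trans rq.
    by rewrite mulrAC ler_pdivlMr // mul1r mulrC -ler_pdivrMr.
  rewrite (_ : gdiff _ _ = set0) ?cards0 ?mulr_ge0 ?exprn_ge0 ?(ltW eps0) //.
  by apply/setP => p; rewrite !inE eqxx.
move=> eps eps0; have [delta [n0 [delta0 h]]] := rebalance tau0 cV0 eps0.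
exists delta, (Num.max n0 nA); split=> // V M q P0 P; rewrite ge_max => /andP[n1 n2] GM [rq qQ hA hB' nb] mv hP.
have [P' [nb' hP']] := h V M q P0 P n1 rq hB' (adm _ _ rq qQ n2) (cVle _ rq qQ) GM nb mv hP.
by exists q, P'; split.
Qed.

End SinglesMain.

(** * Induced subgraphs and edit distance *)

Section Transfer.
Local Open Scope nat_scope.

Lemma adj_cmp_graph n r (c : 'I_n -> 'I_r) u v : adj (cmp_graph c) u v = (c u != c v).
Proof.
rewrite /adj inE; apply/andP/idP => [[uv /existsP[x /existsP[y /andP[cxy /eqP e]]]]|cuv].
  have [xe ye] : x \in [set u; v] /\ y \in [set u; v] by rewrite e !inE !eqxx orbT.
  move: xe ye cxy; rewrite !inE => /orP[]/eqP-> /orP[]/eqP->; rewrite ?eqxx //.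
  by rewrite eq_sym.
split; first by apply: contraNneq cuv => ->.
by apply/existsP; exists u; apply/existsP; exists v; rewrite cuv eqxx.
Qed.

Definition arcs n (G : graph n) : {set 'I_n * 'I_n} := [set p | adj G p.1 p.2].

Lemma adj_sym n (G : graph n) u v : adj G u v = adj G v u.
Proof. by rewrite /adj eq_sym setUC. Qed.

Lemma arcs_sgraph n (G : graph n) : sgraph (arcs G).
Proof.
apply/sgraphP; split=> [x|x y]; first by rewrite inE /adj eqxx.
by rewrite !inE adj_sym.
Qed.

Lemma sgraph_arcs n (H : {set 'I_n * 'I_n}) : sgraph H ->
  exists G : graph n, simple_graph G /\ arcs G = H.
Proof.
move=> /sgraphP[Hi Hs]; pose G : graph n := [set [set p.1; p.2] | p in H].
exists G; split.
  apply/forallP => e; apply/implyP => /imsetP[[x y] xyH ->] /=.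
  rewrite cards2; suff -> : x != y by [].
  by apply: contraTneq xyH => ->; rewrite Hi.
apply/setP => -[u v]; rewrite inE /adj /=; apply/andP/idP => [[uv /imsetP[[x y] xyH /= e]]|uvH].
  have [xe ye] : x \in [set u; v] /\ y \in [set u; v] by rewrite e !inE !eqxx orbT.
  move: xe ye xyH; rewrite !inE => /orP[]/eqP-> /orP[]/eqP->; rewrite ?Hi //.
  by rewrite Hs.
split; first by apply: contraTneq uvH => ->; rewrite Hi.
by apply/imsetP; exists (u, v).
Qed.

Section Count.
Variables (k r : nat) (c : 'I_k -> 'I_r).

Definition automorphisms := copies c (cmg c).

Lemma automorphisms_gt0 : 0 < automorphisms.
Proof.
apply/card_gt0P; exists [ffun i => i]; rewrite inE; apply/copyP; split=> [i j|i j]; first by rewrite !ffunE.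
by rewrite cmgE !ffunE.
Qed.

(** Copies with the same image differ by a permutation of the indices that preserves the colouring
    pattern, that is, by an automorphism of [F]. *)
Lemma copies_image n (G : graph n) (f0 : {ffun 'I_k -> 'I_n}) : copy c (arcs G) f0 ->
  #|[set f | copy c (arcs G) f & f @: setT == f0 @: setT]| = automorphisms.
Proof.
move=> /copyP[f0i f0G].
pose T (s : {ffun 'I_k -> 'I_k}) : {ffun 'I_k -> 'I_n} := [ffun i => f0 (s i)].
have Tinj : injective T.
  by move=> s s' /ffunP e; apply/ffunP => i; have := e i; rewrite !ffunE => /f0i.
rewrite /automorphisms /copies -(card_imset _ Tinj); apply: eq_card => f; rewrite inE.
apply/andP/imsetP => [[/copyP[fi fG] /eqP e]|[s]].
  have hs i : exists j, f i = f0 j.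
    have /imsetP[j _ ->] : f i \in f0 @: setT by rewrite -e imset_f.
    by exists j.
  have [s hs'] := fin_all_exists hs.
  exists [ffun i => s i]; last by apply/ffunP => i; rewrite !ffunE hs'.
  rewrite inE; apply/copyP; split=> [i j|i j]; rewrite !ffunE.
    by move=> e'; apply: fi; rewrite !hs' e'.
  by rewrite cmgE -f0G -!hs' fG.
rewrite inE => /copyP[si sG] ->; split.
  apply/copyP; split=> [i j|i j]; rewrite !ffunE; first by move=> /f0i/si.
  by rewrite f0G -cmgE sG.
have sT : s @: setT = setT.
  apply/eqP; rewrite eqEcard subsetT /= card_imset // leqnn //.
apply/eqP/setP => x; apply/imsetP/imsetP => [[i _ ->]|[i _ ->]].
  by exists (s i); rewrite ?inE ?ffunE.
have /imsetP[j _ ->] : i \in s @: setT by rewrite sT inE.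
by exists j; rewrite ?inE ?ffunE.
Qed.

Lemma copies_induced n (G : graph n) :
  copies c (arcs G) = automorphisms * induced_count (cmp_graph c) G.
Proof.
rewrite /induced_count; set I := [set S : {set 'I_n} | _].
rewrite mulnC -sum_nat_const /copies -sum1_card.
have memI S : (S \in I) = [exists f, copy c (arcs G) f && (f @: setT == S)].
  rewrite inE; apply/andP/existsP => [[/eqP Sk /existsP[f /and3P[/forallP fS /injectiveP fi /forallP fG]]]|].
    exists f; apply/andP; split.
      apply/copyP; split=> // i j; have := fG i => /forallP/(_ j)/eqP.
      by rewrite adj_cmp_graph inE => <-.
    rewrite eqEcard card_imset // cardsT card_ord Sk leqnn andbT.
    by apply/subsetP => x /imsetP[i _ ->].
  move=> [f /andP[/copyP[fi fG] /eqP e]].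
  split; first by rewrite -e card_imset // cardsT card_ord.
  apply/existsP; exists f; apply/and3P; split; last 1 first.
  - by apply/forallP => i; apply/forallP => j; rewrite adj_cmp_graph -fG inE.
  - by apply/forallP => i; rewrite -e imset_f.
  - exact/injectiveP.
rewrite (partition_big (fun f : {ffun 'I_k -> 'I_n} => f @: setT) (mem I)) /=; last first.
  by move=> f; rewrite inE => fc; rewrite memI; apply/existsP; exists f; rewrite fc eqxx.
apply: eq_bigr => S; rewrite memI => /existsP[f0 /andP[f0c /eqP e0]].
rewrite sum1_card -(copies_image f0c); apply: eq_card => f.
by rewrite [LHS]unfold_in !inE -e0.
Qed.

Lemma extremal_inducibility n :
  extremal_bound c 'I_n (automorphisms * inducibility (cmp_graph c) n).
Proof.
move=> H /sgraph_arcs[G [Gs <-]]; rewrite copies_induced leq_mul2l; apply/orP; right.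
exact: (leq_bigmax_cond _ Gs).
Qed.

End Count.

Lemma bigminn_le (T : eqType) (s : seq T) (F : T -> nat) x0 i :
  i \in s -> \big[minn/x0]_(j <- s) F j <= F i.
Proof.
elim: s => // j s IH; rewrite inE big_cons => /orP[/eqP ->|/IH]; first exact: geq_minl.
by apply: leq_trans; exact: geq_minr.
Qed.

(** The identity is one of the permutations in the minimum, and every edge in the symmetric
    difference is the image of an ordered pair in [gdiff]. *)
Lemma edit_le n (G : graph n) (P : 'I_n -> 'I_n) : simple_graph G ->
  edit G (cmp_graph P) <= #|gdiff (arcs G) (cmg P)|.
Proof.
move=> /forallP Gs; rewrite /edit.
apply: leq_trans (bigminn_le _ _ (mem_index_enum (1%g : {perm 'I_n}))) _.
have -> : relabel 1 (cmp_graph P) = cmp_graph P.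
  rewrite /relabel -[RHS]imset_id; apply: eq_imset => e /=.
  by rewrite -[RHS]imset_id; apply: eq_imset => x; rewrite perm1.
apply: leq_trans (leq_imset_card (fun p : 'I_n * 'I_n => [set p.1; p.2]) _).
apply: subset_leq_card; apply/subsetP => e he.
have [u [v [uv ee]]] : exists u v, u != v /\ e = [set u; v].
  move: he; rewrite !inE => /orP[/andP[_ eG]|/andP[_ /existsP[u /existsP[v /andP[Puv /eqP ->]]]]].
    by have := Gs e; rewrite eG => /cards2P[u [v [uv ->]]]; exists u, v.
  by exists u, v; split=> //; apply: contraNneq Puv => ->.
apply/imsetP; exists (u, v) => //; rewrite in_gdiff cmgE inE /= -adj_cmp_graph /adj uv /= -ee.
by move: he; rewrite !in_setU !in_setD; case: (e \in G); case: (e \in _).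
Qed.

End Transfer.

(** The split is by the smallest part: if it has at least two vertices, every vertex of [F] has a
    twin; if it has one, the binomial condition bounds all parts by two. *)
Lemma almost_balanced_gap (R : archiRealFieldType) (k r : nat) (c : 'I_k -> 'I_r) :
  (2 <= r)%N -> (forall i, exists x, c x = i) -> almost_balanced c ->
  (2 < k)%N /\ exists C n0 : R, 0 < C /\ forall (V : finType) M (G : {set V * V}), n0 <= #|V|%:R ->
    extremal_bound c V M -> sgraph G -> exists P : V -> V,
      #|gdiff G (cmg P)|%:R * #|V|%:R ^+ k.-2 <= C * (M%:R - (copies c G)%:R).
Proof.
move=> r2 csurj [i1 [ir [hi1 [hir [big bin]]]]].
have k2 : (2 < k)%N by apply: leq_ltn_trans r2 _; exact: (parts_lt big csurj).
split=> //; have [two|one] := leqP 2 (part_size c ir).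
  apply: (nosingle_main R big csurj r2 k2) => i; apply: twin_of => //.
  by rewrite neq_ltn (leq_trans two) ?orbT //; exact: hir.
apply: (singles_main R big csurj r2 k2) => j; apply: leq_trans (hi1 j) _.
have e : part_size c ir = 1%N by have := csize_gt0 csurj ir; move: one; rewrite /part_size /csize; case: #|_| => [|[]].
move: bin; rewrite e ltnS leqn0 -leqn0 leqNgt bin_gt0 -leqNgt => h.
by move: h; rewrite leq_subLR.
Qed.

Theorem theorem1p5 (R : realType) (k r : nat) (c : 'I_k -> 'I_r) :
  (2 <= r)%N ->
  (forall i : 'I_r, exists x : 'I_k, c x = i) ->
  almost_balanced c ->
  exists C : R, 0 < C /\
    forall (n : nat) (G : graph n), C <= n%:R -> simple_graph G ->
      exists H : graph n, complete_multipartite H /\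
        (edit G H)%:R <=
          C * (((inducibility (cmp_graph c) n)%:R - (induced_count (cmp_graph c) G)%:R)
                / ('C(n, k))%:R) * ('C(n, 2))%:R.
Proof.
move=> r2 csurj ab; have [k2 [C0 [n0 [C00 h]]]] := almost_balanced_gap R r2 csurj ab.
set F := cmp_graph c; pose A : R := (automorphisms c)%:R.
have A0 : 0 < A by rewrite ltr0n automorphisms_gt0.
have CA0 : 0 < C0 * A by rewrite mulr_gt0.
(* The 4 comes from [n ^ 2 <= 4 * 'C(n, 2)]; the other summands force [n0 <= n] and [k <= n], so
   that ['C(n, k)] is positive. *)
exists (4 * (C0 * A) + `|n0| + k%:R + 2); split.
  by rewrite ltr_wpDl // !addr_ge0 // mulr_ge0 // ltW.
move=> n G hn Gs.
have n0n : n0 <= n%:R.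
  by move: hn (ler_norm n0) CA0 (ler0n R k); clear; lra.
have kn : (k <= n)%N.
  by rewrite -(ler_nat R); move: hn (normr_ge0 n0) CA0; clear; lra.
have n2 : (2 <= n)%N by apply: leq_trans (ltnW k2) kn.
have [P hP] : exists P : 'I_n -> 'I_n, #|gdiff (arcs G) (cmg P)|%:R * n%:R ^+ k.-2 <=
    C0 * A * ((inducibility F n)%:R - (induced_count F G)%:R).
  have := h 'I_n _ (arcs G) _ (@extremal_inducibility k r c n) (arcs_sgraph G).
  rewrite card_ord => /(_ n0n)[P hP]; exists P; apply: le_trans hP _.
  by rewrite copies_induced !natrM -mulrBr mulrA.
exists (cmp_graph P); split; first by exists P.
apply: (@le_trans _ _ #|gdiff (arcs G) (cmg P)|%:R); first by rewrite ler_nat edit_le.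
set D := _ - _ in hP *.
have D0 : 0 <= D by rewrite subr_ge0 ler_nat; exact: (leq_bigmax_cond _ Gs).
have nr : 0 < n%:R :> R by rewrite ltr0n (leq_trans _ n2).
have nk : 0 < n%:R ^+ k.-2 :> R by rewrite exprn_gt0.
have B0 : 0 < 'C(n, k)%:R :> R by rewrite ltr0n bin_gt0.
have bk : 'C(n, k)%:R <= n%:R ^+ 2 * n%:R ^+ k.-2 :> R.
  rewrite -exprD (_ : (2 + k.-2 = k)%N); last by rewrite -subn2 subnKC // ltnW.
  rewrite -natrX ler_nat; apply: leq_trans (ffact_le_exp n k); rewrite -bin_ffact.
  by rewrite leq_pmulr // fact_gt0.
have b2 : n%:R ^+ 2 <= 4 * 'C(n, 2)%:R :> R.
  rewrite -natrX -natrM ler_nat; have := bin_ffact n 2; rewrite ffactnS ffactn1 => e.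
  rewrite (_ : 4 * 'C(n, 2) = 2 * ('C(n, 2) * 2`!))%N; last by rewrite mulnCA mulnC.
  rewrite e -mulnn mulnCA leq_mul2l; apply/orP; right.
  by rewrite mul2n -addnn -{1}(prednK (ltnW n2)) -addn1 leq_add2l -ltnS prednK // ltnW.
rewrite -(ler_pM2r nk); apply: le_trans hP _.
apply: (@le_trans _ _ (4 * (C0 * A) * (D / 'C(n, k)%:R) * 'C(n, 2)%:R * n%:R ^+ k.-2)).
  rewrite (_ : 4 * (C0 * A) * _ * _ * _ = C0 * A * (D / 'C(n, k)%:R * (4 * 'C(n, 2)%:R * n%:R ^+ k.-2))); last by ring.
  rewrite ler_wpM2l ?(ltW CA0) // -[leLHS](divfK (lt0r_neq0 B0)) ler_wpM2l ?divr_ge0 //.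
  by apply: le_trans bk _; rewrite ler_wpM2r // ltW.
rewrite ler_wpM2r ?(ltW nk) // ler_wpM2r // ler_wpM2r ?divr_ge0 //.
by move: (normr_ge0 n0) (ler0n R k); clear; lra.
Qed.
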